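(* We have $\mathcal{F}(\mathsf{Til})=\mathcal{F}(\mathsf{Spa})\cap\mathcal{F}(\mathsf{Div})\cap\mathcal{F}(\mathsf{Cov})$.
   Context: A $k$-graph is a $k$-uniform hypergraph on a finite vertex set. For $\varepsilon,d>0$, an $n$-vertex $k$-graph $G$ is uniformly $(\varepsilon,d)$-dense if for all (not necessarily disjoint) $X_1,\dots,X_k\subseteq V(G)$ we have $e_G(X_1,\dots,X_k)\geq d|X_1|\cdots|X_k|-\varepsilon n^k$, where $e_G(X_1,\dots,X_k)$ is the number of tuples $(v_1,\dots,v_k)\in X_1\times\dots\times X_k$ with $\{v_1,\dots,v_k\}$ an edge of $G$. $\mathsf{UniDen}_{\varepsilon,d}$ is the set of all uniformly $(\varepsilon,d)$-dense $k$-graphs, for all $k\geq2$. $\mathsf{MinDeg}_{1,\mu}$ is the set of all $k$-graphs $G$ ($k\geq2$) with every vertex in at least $\mu\binom{|V(G)|-1}{k-1}$ edges. An $m$-digraph $H$ has a finite vertex set $V(H)$ and edge set $E(H)\subseteq V(H)^m$ (repeated entries allowed); $\mathrm{m}(v,e)=|\{i:e(i)=v\}|$. For $k$-graphs $F,G$ with $V(F)=\{1,\dots,m\}$, $H(F;G)$ is the $m$-digraph on $V(G)$ with an edge $(\phi(1),\dots,\phi(m))$ for every homomorphism $\phi$ (map $V(F)\to V(G)$ sending edges to edges). $\mathsf{Spa}_\rho$ is the set of $m$-digraphs $H$ admitting $w\colon E(H)\to[0,1]$ with $\sum_{e\in H}w(e)\,\mathrm{m}(v,e)\leq1$ for every $v$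 and $\sum_{e\in H}w(e)\geq(1-\rho)|V(H)|/m$; $\mathsf{Div}$ is the set of digraphs $H$ admitting $w\colon E(H)\to\mathbb{Z}$ with $\sum_{e\in H}w(e)\,\mathrm{m}(v,e)=1$ for all $v$; $\mathsf{Cov}$ is the set of digraphs in which every vertex $v$ has an edge $e$ with $\mathrm{m}(v,e)=1$. $\mathcal{F}(\mathsf{Til})$ contains, for every $k\geq2$, the $k$-graphs $F$ such that for every $d,\mu>0$ there is $\varepsilon>0$ such that for every $n$ large enough divisible by $v(F)$, every $n$-vertex $k$-graph $G\in\mathsf{UniDen}_{\varepsilon,d}\cap\mathsf{MinDeg}_{1,\mu}$ has a perfect $F$-tiling (a set of copies of $F$ in $G$ covering every vertex exactly once). $\mathcal{F}(\mathsf{Div})$ and $\mathcal{F}(\mathsf{Cov})$ are defined in the same way with the conclusion replaced by $H(F;G)\in\mathsf{Div}$ and $H(F;G)\in\mathsf{Cov}$, respectively. $\mathcal{F}(\mathsf{Spa})$ contains the $k$-graphs $F$ such that for every $d,\mu,\rho>0$ there are $\varepsilon,n_0>0$ such that every $k$-graph $G\in\mathsf{UniDen}_{\varepsilon,d}\cap\mathsf{MinDeg}_{1,\mu}$ on $n\geq n_0$ vertices satisfies $H(F;G)\in\mathsf{Spa}_\rho$. *)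

(* Defs.v *)
From HB Require Import structures.
From mathcomp Require Import all_boot all_order all_algebra.
From mathcomp Require Import boolp classical_sets reals.

Set Implicit Arguments.
Unset Strict Implicit.
Unset Printing Implicit Defensive.

Import Order.TTheory GRing.Theory Num.Theory.

Local Open Scope ring_scope.

Record kgraph (k : nat) (V : finType) := KGraph {
  edges :> {set {set V}};
  edges_uniform : [forall e in edges, #|e| == k]
}.

Section Host.
Variables (R : realType) (k : nat) (V : finType).

Definition edge_tuples (G : kgraph k V) (X : 'I_k -> {set V}) : nat :=
  #|[set v : {ffun 'I_k -> V} |
      [forall i, v i \in X i] && ([set v i | i : 'I_k] \in edges G)]|.

Definition UniDen (eps d : R) : set (kgraph k V) :=
  [set G | forall X : 'I_k -> {set V},
    d * (\prod_(i < k) #|X i|%:R) - eps * #|V|%:R ^+ k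
      <= (edge_tuples G X)%:R]%classic.

Definition vertex_degree (G : kgraph k V) (v : V) : nat :=
  #|[set e in edges G | v \in e]|.

Definition MinDeg1 (mu : R) : set (kgraph k V) :=
  [set G | forall v : V,
    mu * 'C(#|V|.-1, k.-1)%:R <= (vertex_degree G v)%:R]%classic.

End Host.

(* The edge (v_1, ..., v_m) of an m-digraph is the finite function i |-> v_i,
   so that a map from 'I_m to V is itself a possible edge. *)
Definition digraph (m : nat) (V : finType) := {set {ffun 'I_m -> V}}.

Section Digraph.
Variables (R : realType) (m : nat) (V : finType).

Definition multiplicity (v : V) (e : {ffun 'I_m -> V}) : nat :=
  #|[set i | e i == v]|.

(* A weighting of E(H) is a function on all m-tuples; its values outside H
   are never used.  In the degenerate case m = 0 the quotient by m is 0. *)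
Definition Spa (rho : R) : set (digraph m V) :=
  [set H | exists w : {ffun 'I_m -> V} -> R,
    [/\ forall e, e \in H -> 0 <= w e <= 1,
        forall v, \sum_(e in H) w e * (multiplicity v e)%:R <= 1
      & (1 - rho) * #|V|%:R / m%:R <= \sum_(e in H) w e]]%classic.

Definition Div : set (digraph m V) :=
  [set H | exists w : {ffun 'I_m -> V} -> int,
    forall v, \sum_(e in H) w e * (multiplicity v e)%:Z = 1]%classic.

Definition Cov : set (digraph m V) :=
  [set H | forall v, exists2 e, e \in H & multiplicity v e = 1%N]%classic.

End Digraph.

Section Tiling.
Variables (k m : nat) (V : finType) (F : kgraph k 'I_m) (G : kgraph k V).

Definition is_hom (phi : {ffun 'I_m -> V}) : bool :=
  [forall e in edges F, phi @: e \in edges G].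

Definition hom_digraph : digraph m V := [set phi | is_hom phi].

(* A copy of F is a subgraph of G isomorphic to F, recorded as the pair of its
   vertex set and its edge set. *)
Definition copies : {set {set V} * {set {set V}}} :=
  [set (phi @: [set: 'I_m], [set phi @: e | e : {set 'I_m} in edges F])
     | phi : {ffun 'I_m -> V} in hom_digraph & injectiveb phi].

Definition has_perfect_tiling : Prop :=
  exists2 T : {set {set V} * {set {set V}}},
    T \subset copies & forall v : V, #|[set S in T | v \in S.1]| = 1%N.

End Tiling.

Section Families.
Variables (R : realType) (k m : nat).

Definition eventually_forced (P : forall V : finType, kgraph k V -> Prop) :=
  forall d mu : R, 0 < d -> 0 < mu ->
  exists2 eps : R, 0 < eps &
  exists n0 : nat, forall n : nat, (n0 <= n)%N -> (m %| n)%N ->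
  forall (V : finType) (G : kgraph k V), #|V| = n ->
    (UniDen eps d `&` MinDeg1 mu)%classic G -> P V G.

Definition F_Til : set (kgraph k 'I_m) :=
  [set F | eventually_forced (fun V G => has_perfect_tiling F G)]%classic.

Definition F_Div : set (kgraph k 'I_m) :=
  [set F | eventually_forced (fun V G => Div (hom_digraph F G))]%classic.

Definition F_Cov : set (kgraph k 'I_m) :=
  [set F | eventually_forced (fun V G => Cov (hom_digraph F G))]%classic.

(* Unlike in the other families, the order of G need not be divisible by m. *)
Definition F_Spa : set (kgraph k 'I_m) :=
  [set F | forall d mu rho : R, 0 < d -> 0 < mu -> 0 < rho ->
    exists2 eps : R, 0 < eps &
    exists2 n0 : nat, (0 < n0)%N &
    forall (V : finType) (G : kgraph k V), (n0 <= #|V|)%N ->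
      (UniDen eps d `&` MinDeg1 mu)%classic G -> Spa rho (hom_digraph F G)]%classic.

End Families.

Arguments F_Til R k m _ : clear implicits.
Arguments F_Div R k m _ : clear implicits.
Arguments F_Cov R k m _ : clear implicits.
Arguments F_Spa R k m _ : clear implicits.

(* Main.v *)
(** A tiling yields the three weightings directly; for [Spa], where [m] need not
    divide the order of [G], one first deletes fewer than [m] vertices.

    Conversely, the hypotheses are applied to bounded-size patterns sampled from
    [G]. A random sample of bounded size inherits uniform density: a set which is
    extremal for the discrepancy of the sample is determined, up to a small error,
    by boundedly many sampled tuples, so only boundedly many sets defined in the
    whole vertex set have to be controlled. By pigeonhole and supersaturation a
    positive proportion of the large blow-ups of a sample repeat the same pattern,
    and in such a blow-up a homomorphism into the pattern becomes a genuine copy.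

    Almost perfect tilings: in a largest tiling, sample blocks among the tiles and
    the uncovered vertices. A fractional tiling of the pattern tiles the blow-up
    almost perfectly and hence improves the tiling if too much was uncovered.

    Absorption: [Div] applied to a pattern with one vertex duplicated shows that
    the homomorphisms span all integer vectors with coordinate sum divisible by
    [m]. By [Cov], each vertex [x_i] to be absorbed lies in a homomorphism with
    vector [x_i + r_i]. A blow-up with class sizes [sum r_i + N sum_phi phi] is
    tileable with [x_1, ..., x_m] by construction, and without them because
    [sum r_i] lies in the lattice and [N] is large. A greedy choice of disjoint
    absorbers then handles every small leftover set. *)

(* Each hypothesis yields only a single weighting or homomorphism, and only in a graph with a degree
   condition; sampling turns this into counts. The obstacle is that a bounded sample need not
   inherit the degree condition at all its vertices. It is checked by a law of large numbers only
   for the few vertices fixed in advance. For the others density suffices: tested on the vertices of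
   degree below [d / 2] it shows that they are few, so they are deleted. The deletion also adjusts
   the order, so that one additional vertex (a duplicate or a vertex to be absorbed) makes it
   divisible by [m].

   A blow-up must follow its pattern for every choice of representatives. Hence edges meeting a
   block twice are dropped: along an edge the representatives of different blocks are then chosen
   independently. For absorbers a block is one vertex; for almost perfect tilings it is an
   [m]-tuple, either a tile or [m] uncovered vertices, so that retiling destroys only whole tiles.

   Densities are averages over ordered tuples, where repeated entries cost only O(1/n). *)
Require Import Defs.
From mathcomp Require Import all_boot all_order all_algebra.
From mathcomp Require Import boolp classical_sets reals.
From mathcomp Require Import zify lra.
(* Last, so that their lemma names take precedence over those of classical_sets. *)
From mathcomp Require Import fintype finset.

Set Implicit Arguments.
Unset Strict Implicit.
Unset Printing Implicit Defensive.

Import Order.TTheory GRing.Theory Num.Theory.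

Local Open Scope ring_scope.

(** * Averages over finite types *)

Section Averages.
Variable R : realType.

(** On an empty type the value is 0, by the convention for division by 0; hence the nonemptiness
    hypotheses below. *)
Definition avg (T : finType) (F : T -> R) : R := (\sum_t F t) / #|T|%:R.

Implicit Types (T S : finType).

Lemma eq_avg T (F G : T -> R) : F =1 G -> avg F = avg G.
Proof. by move=> FG; rewrite /avg (eq_bigr G). Qed.

Lemma le_avg T (F G : T -> R) : (forall t, F t <= G t) -> avg F <= avg G.
Proof.
by move=> FG; rewrite /avg ler_wpM2r ?invr_ge0 ?ler0n//; apply: ler_sum.
Qed.

Lemma avgD T (F G : T -> R) : avg (fun t => F t + G t) = avg F + avg G.
Proof. by rewrite /avg big_split mulrDl. Qed.

Lemma avgZ T c (F : T -> R) : avg (fun t => c * F t) = c * avg F.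
Proof. by rewrite /avg -mulr_sumr mulrA. Qed.

Lemma avgN T (F : T -> R) : avg (fun t => - F t) = - avg F.
Proof. by rewrite /avg sumrN mulNr. Qed.

Lemma avgB T (F G : T -> R) : avg (fun t => F t - G t) = avg F - avg G.
Proof. by rewrite avgD avgN. Qed.

Lemma avg_sum T (I : finType) (F : I -> T -> R) :
  avg (fun t => \sum_i F i t) = \sum_i avg (F i).
Proof. by rewrite /avg exchange_big mulr_suml. Qed.

Lemma avg_const T c : (0 < #|T|)%N -> avg (fun _ : T => c : R) = c.
Proof.
by move=> T0; rewrite /avg sumr_const -[_ *+ _]mulr_natr mulfK// pnatr_eq0 -lt0n.
Qed.

Lemma avg_ge0 T (F : T -> R) : (forall t, 0 <= F t) -> 0 <= avg F.
Proof. by move=> F0; rewrite /avg divr_ge0 ?ler0n ?sumr_ge0. Qed.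

Lemma avg_le_const T (F : T -> R) c :
  0 <= c -> (forall t, F t <= c) -> avg F <= c.
Proof.
move=> c0 Fc; have [T0|T0] := posnP #|T|.
  by rewrite /avg T0 invr0 mulr0.
by rewrite -[leRHS](avg_const c T0); apply: le_avg.
Qed.

Lemma avg_norm T (F : T -> R) : `|avg F| <= avg (fun t => `|F t|).
Proof.
rewrite /avg normrM normfV normr_nat ler_wpM2r ?invr_ge0 ?ler0n//.
exact: ler_norm_sum.
Qed.

Lemma avg_exchange T S (F : T -> S -> R) :
  avg (fun t => avg (F t)) = avg (fun s => avg (F^~ s)).
Proof.
rewrite /avg -!mulr_suml -!mulrA [_^-1 * _]mulrC.
by rewrite exchange_big.
Qed.

Lemma avg_pair T S (F : T * S -> R) :
  avg F = avg (fun t => avg (fun s => F (t, s))).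
Proof.
rewrite /avg -mulr_suml -mulrA card_prod natrM invfM [_^-1 * _]mulrC.
by congr (_ * _); rewrite pair_bigA; apply: eq_bigr => -[].
Qed.

Lemma avg_bij T S (h : T -> S) (F : S -> R) :
  bijective h -> avg (F \o h) = avg F.
Proof.
move=> hb; rewrite /avg (bij_eq_card hb); congr (_ / _).
by rewrite (reindex h) //; apply: onW_bij.
Qed.

Lemma avg_le_sum_pred T (A : {set T}) : avg (fun t => (t \in A)%:R) = #|A|%:R / #|T|%:R.
Proof.
by rewrite /avg -natr_sum -big_mkcond /= sum1_card.
Qed.

Lemma exists_ge_avg T (F : T -> R) : (0 < #|T|)%N -> exists t, avg F <= F t.
Proof.
move=> T0; apply: contrapT => /forallNP FN.
have [t0 _] : exists t0 : T, t0 \in T by apply/card_gt0P.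
suff : avg F < avg (fun _ : T => avg F) by rewrite avg_const // ltxx.
rewrite /avg ltr_pM2r ?invr_gt0 ?ltr0n //.
apply: ltr_sum; first by apply/hasP; exists t0 => //; rewrite mem_index_enum.
by move=> t _; rewrite ltNge; apply/negP.
Qed.

Lemma markov T (F : T -> R) (c : R) :
  (forall t, 0 <= F t) -> 0 < c -> avg (fun t => (c <= F t)%R%:R) <= avg F / c.
Proof.
move=> F0 c0; rewrite ler_pdivlMr // mulrC -avgZ; apply: le_avg => t.
by case: (boolP (c <= F t)) => [|_]; rewrite ?mulr1 // mulr0.
Qed.

(** Independence of the coordinates of a uniformly random function. *)
Lemma avg_prod (I T : finType) (g : I -> T -> R) :
  avg (fun s : {ffun I -> T} => \prod_i g i (s i)) = \prod_i avg (g i).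
Proof.
rewrite /avg -(bigA_distr_bigA (fun i j => g i j)) /=.
rewrite big_split /= prodfV prodr_const card_ffun natrX.
by rewrite -exprVn.
Qed.

Lemma avg_eval (I T : finType) (i : I) (g : T -> R) :
  (0 < #|T|)%N -> avg (fun s : {ffun I -> T} => g (s i)) = avg g.
Proof.
move=> T0; pose h j := if j == i then g else fun=> 1.
rewrite (@eq_avg _ _ (fun s : {ffun I -> T} => \prod_j h j (s j))) => [|s].
  rewrite avg_prod (bigD1 i) //= big1 ?mulr1; first by rewrite /h eqxx.
  by move=> j /negPf ji; rewrite /h ji avg_const.
rewrite (bigD1 i) //= big1 ?mulr1; first by rewrite /h eqxx.
by move=> j /negPf ji; rewrite /h ji.
Qed.

Lemma avg_eval2 (I T : finType) (i j : I) (g h : T -> R) :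
  (0 < #|T|)%N -> i != j ->
  avg (fun s : {ffun I -> T} => g (s i) * h (s j)) = avg g * avg h.
Proof.
move=> T0 ij.
pose f l := if l == i then g else if l == j then h else fun=> 1.
have ji : j != i by rewrite eq_sym.
rewrite (@eq_avg _ _ (fun s : {ffun I -> T} => \prod_l f l (s l))) => [|s].
  rewrite avg_prod (bigD1 i) //= (bigD1 j) //= big1 ?mulr1; last first.
    by move=> l /andP[/negPf li /negPf lj]; rewrite /f li lj avg_const.
  by rewrite /f eqxx (negPf ji) eqxx.
rewrite (bigD1 i) //= (bigD1 j) //= big1 ?mulr1; last first.
  by move=> l /andP[/negPf li /negPf lj]; rewrite /f li lj.
by rewrite /f eqxx (negPf ji) eqxx.
Qed.

(** Jensen's inequality: the tangent of [x ^+ p] at the average [a] lies below the curve, and its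
    linear term averages to 0. *)
Lemma avg_pow T (F : T -> R) p :
  (0 < #|T|)%N -> (forall t, 0 <= F t) -> avg F ^+ p <= avg (fun t => F t ^+ p).
Proof.
move=> T0 F0; have [->|p0] := posnP p.
  by rewrite expr0 -[leLHS](avg_const 1 T0); apply: le_avg => t; rewrite expr0.
set a := avg F.
have a0 : 0 <= a by apply: avg_ge0.
have tangent x : 0 <= x -> a ^+ p + p%:R * a ^+ p.-1 * (x - a) <= x ^+ p.
  move=> x0; case: p {p0} => [|p]; first by rewrite !expr0 mulr0n !mul0r addr0.
  elim: p => [|p IH]; first by rewrite /= !expr1 expr0 !mul1r addrC subrK.
  have := ler_wpM2l x0 IH; rewrite -exprS => /(le_trans _); apply.
  rewrite /= -subr_ge0.
  (* The previous tangent inequality, multiplied by [x], exceeds the next one by exactly this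
     nonnegative term. *)
  rewrite [X in 0 <= X](_ : _ = (p.+1)%:R * a ^+ p * (x - a) ^+ 2).
    by apply: mulr_ge0 (sqr_ge0 _); rewrite mulr_ge0 ?ler0n ?exprn_ge0.
  rewrite -(@natr1 _ p.+1) !exprS expr0 mulr1.
  by move: (a ^+ p) p.+1%:R => A P; lra.
rewrite -[leLHS]addr0 -[X in _ + X](mulr0 (p%:R * a ^+ p.-1)).
rewrite -[X in _ * X](subrr a) {2}/a -[X in _ - X](avg_const a T0) -avgB.
rewrite -avgZ -[X in X + _](avg_const (a ^+ p) T0) -avgD.
by apply: le_avg => t; apply: tangent.
Qed.

(** Freezes the sample on [Z]: a function that depends on the sample only through [Z] becomes
    constant while the remaining coordinates stay random. *)
Definition override (I T : finType) (Z : {set I}) (th s : {ffun I -> T}) :=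
  [ffun i => if i \in Z then th i else s i].

(* Swapping two independent samples on Z preserves their joint law. *)
Lemma avg_override (I T : finType) (Z : {set I}) (G : {ffun I -> T} -> R) :
  (0 < #|T|)%N ->
  avg G = avg (fun th => avg (fun s => G (override Z th s))).
Proof.
move=> T0.
have TI0 : (0 < #|{ffun I -> T}|)%N by rewrite card_ffun expn_gt0 T0.
pose sw (p : {ffun I -> T} * {ffun I -> T}) :=
  (override Z p.1 p.2, override Z p.2 p.1).
have swK : involutive sw.
  by case=> a b; rewrite /sw /=; congr pair; apply/ffunP => i; rewrite !ffunE;
     case: (i \in Z).
rewrite -(avg_pair (fun p => G (override Z p.1 p.2))).
rewrite -(@eq_avg _ ((fun p => G p.1) \o sw)) //.
rewrite avg_bij; last by exists sw.
by rewrite avg_pair; apply: eq_avg => th /=; rewrite avg_const.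
Qed.

End Averages.

(** * Tuples with a distinguished first coordinate *)

Section FfunCons.
Variable k : nat.

Definition ffcons (T : Type) (x : T) (s : {ffun 'I_k -> T}) : {ffun 'I_k.+1 -> T} :=
  [ffun i => if unlift ord0 i is Some j then s j else x].

Lemma ffcons0 T (x : T) s : ffcons x s ord0 = x.
Proof. by rewrite ffunE unlift_none. Qed.

Lemma ffconsS T (x : T) s i : ffcons x s (lift ord0 i) = s i.
Proof. by rewrite ffunE liftK. Qed.

Definition fftail T (v : {ffun 'I_k.+1 -> T}) : {ffun 'I_k -> T} :=
  [ffun i => v (lift ord0 i)].

Lemma ffcons_eta T (v : {ffun 'I_k.+1 -> T}) : ffcons (v ord0) (fftail v) = v.
Proof.
by apply/ffunP => i; case: (unliftP ord0 i) => [j|] ->; rewrite ?ffcons0 ?ffconsS ?ffunE.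
Qed.

Lemma fftailK T (x : T) s : fftail (ffcons x s) = s.
Proof. by apply/ffunP => i; rewrite ffunE ffconsS. Qed.

Lemma avg_cons (R : realType) (T : finType) (F : {ffun 'I_k.+1 -> T} -> R) :
  avg F = avg (fun x => avg (fun s => F (ffcons x s))).
Proof.
rewrite -(avg_pair (fun p => F (ffcons p.1 p.2))).
rewrite -(@avg_bij _ _ _ (fun p : T * {ffun 'I_k -> T} => ffcons p.1 p.2) F) //.
exists (fun v : {ffun 'I_k.+1 -> T} => (v ord0, fftail v)) => [[x s]|v] /=.
  by rewrite ffcons0 fftailK.
exact: ffcons_eta.
Qed.

End FfunCons.

(** * One-sided discrepancy of random samples *)

Section Sampling.
Variable R : realType.

Lemma avg_delta (T : finType) (x : T) : avg (fun y => (x == y)%:R : R) = #|T|%:R^-1.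
Proof.
rewrite /avg -natr_sum (bigD1 x) //= big1 ?eqxx ?mul1r // => y /negPf yx.
by rewrite eq_sym yx.
Qed.

(** Second moment: centred off-diagonal products average to 0 by independence, and the diagonal
    contributes at most [4 / |I|]. *)
Lemma lln (I T : finType) (psi : T -> R) (t : R) :
  (0 < #|T|)%N -> (0 < #|I|)%N -> (forall x, `|psi x| <= 1) ->
  0 < t -> 4 <= t ^+ 2 * #|I|%:R ->
  avg (fun s : {ffun I -> T} => `|avg (fun i => psi (s i)) - avg psi|) <= t.
Proof.
move=> T0 I0 psi1 t0 tI.
pose ps0 x := psi x - avg psi.
have a1 : `|avg psi| <= 1.
  by apply: le_trans (avg_norm _) _; apply: avg_le_const.
have ps04 x : `|ps0 x| <= 2.
  by apply: le_trans (ler_normB _ _) _; move: (psi1 x) a1; lra.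
have ps0avg : avg ps0 = 0 by rewrite avgB avg_const // subrr.
have sq (s : {ffun I -> T}) : (avg (fun i => ps0 (s i))) ^+ 2 =
    avg (fun i => avg (fun i' => ps0 (s i) * ps0 (s i'))).
  rewrite expr2 -avgZ; apply: eq_avg => i; rewrite mulrC -avgZ.
  by apply: eq_avg => i'; rewrite mulrC.
have var : avg (fun s : {ffun I -> T} => (avg (fun i => ps0 (s i))) ^+ 2) <= t ^+ 2.
  rewrite (eq_avg sq) avg_exchange.
  have I0' : 0 < #|I|%:R :> R by rewrite ltr0n.
  apply: (@le_trans _ _ (4 / #|I|%:R)); last by rewrite ler_pdivrMr.
  apply: avg_le_const => [|i]; first by rewrite divr_ge0 // ler0n.
  rewrite avg_exchange -(avg_delta i) -avgZ; apply: le_avg => i'.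
  case: eqVneq => [<-|ii']; last by rewrite avg_eval2 // ps0avg mulr0 mulr0.
  rewrite mulr1; apply: avg_le_const => // s.
  by rewrite -expr2 -real_normK ?num_real //; move: (ps04 (s i)) (normr_ge0 (ps0 (s i))); nra.
(* [|a| <= a ^ 2 / (2 * t) + t / 2] passes from the second moment to the first without square
   roots. *)
have step (s : {ffun I -> T}) : `|avg (fun i => psi (s i)) - avg psi| <=
    (2 * t)^-1 * (avg (fun i => ps0 (s i))) ^+ 2 + t / 2.
  rewrite avgB avg_const //; set a := _ - _.
  rewrite -(@ler_pM2l _ (2 * t)) ?mulr_gt0 // mulrDr mulVKf ?mulf_neq0 ?lt0r_neq0 //.
  rewrite -(@real_normK _ a) ?num_real //.
  by have := sqr_ge0 (`|a| - t); lra.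
apply: le_trans (le_avg step) _.
rewrite avgD avg_const; last by rewrite card_ffun expn_gt0 T0.
rewrite avgZ.
have : (2 * t)^-1 * avg (fun s : {ffun I -> T} => (avg (fun i => ps0 (s i))) ^+ 2) <= t / 2.
  rewrite ler_pdivrMl ?mulr_gt0 //; apply: le_trans var _; lra.
lra.
Qed.

Definition hits (I T : finType) (Z : {set T}) (v : {ffun I -> T}) := [exists i, v i \in Z].

Lemma avg_hits (I T : finType) (Z : {set T}) :
  avg (fun v : {ffun I -> T} => (hits Z v)%:R : R) <= #|I|%:R * #|Z|%:R / #|T|%:R.
Proof.
have [T0|T0] := posnP #|T|.
  rewrite T0 invr0 mulr0; apply: avg_le_const => // v.
  rewrite /hits; case: existsP => // -[i _].
  by have /card0_eq/(_ (v i)) := T0; rewrite inE.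
apply: (@le_trans _ _ (avg (fun v : {ffun I -> T} => \sum_i (v i \in Z)%:R))).
  apply: le_avg => v; rewrite /hits; case: existsP => [[i vi]|_]; last exact: sumr_ge0.
  by rewrite (bigD1 i) //= vi lerDl sumr_ge0.
rewrite avg_sum (eq_bigr (fun=> #|Z|%:R / #|T|%:R)) => [|i _].
  by rewrite sumr_const -[X in X <= _]mulr_natl mulrA.
by rewrite (avg_eval i (fun x => (x \in Z)%:R)) // avg_le_sum_pred.
Qed.

Lemma avg_noninj (I T : finType) :
  avg (fun v : {ffun I -> T} => (~~ injectiveb v)%:R : R) <= (#|I| ^ 2)%:R / #|T|%:R.
Proof.
have [T0|T0] := posnP #|T|.
  rewrite T0 invr0 mulr0; apply: avg_le_const => // v.
  case: injectiveP => // -[] i; exfalso.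
  by have /card0_eq/(_ (v i)) := T0; rewrite inE.
apply: (@le_trans _ _ (avg (fun v : {ffun I -> T} =>
    \sum_(p : I * I) ((p.1 != p.2) && (v p.1 == v p.2))%:R))).
  apply: le_avg => v; case: (boolP (injectiveb v)) => [_|]; first exact: sumr_ge0.
  move=> /injectivePn[i [j ij vij]].
  by rewrite (bigD1 (i, j)) //= ij vij eqxx lerDl sumr_ge0.
rewrite avg_sum; apply: (@le_trans _ _ (\sum_(p : I * I) #|T|%:R^-1)); last first.
  by rewrite sumr_const card_prod -mulnn -[X in X <= _]mulr_natl.
apply: ler_sum => -[i j] _ /=; case: eqVneq => ij /=.
  by rewrite avg_le_const ?invr_ge0.
rewrite (@eq_avg _ _ _ (fun v : {ffun I -> T} =>
    \sum_x ((x == v i)%:R * (x == v j)%:R))) => [|v].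
  rewrite avg_sum (eq_bigr (fun=> (#|T|%:R^-1 * #|T|%:R^-1))) => [|x _].
    rewrite sumr_const -[_ *+ _]mulr_natl mulrA divff ?mul1r //.
    by rewrite pnatr_eq0 -lt0n.
  by rewrite (avg_eval2 (fun y => (x == y)%:R) (fun y => (x == y)%:R)) // !avg_delta.
rewrite (bigD1 (v i)) //= eqxx mul1r big1 ?addr0 // => x /negPf ->.
by rewrite mul0r.
Qed.

Definition ffmap (I A B : finType) (f : A -> B) (z : {ffun I -> A}) : {ffun I -> B} :=
  [ffun i => f (z i)].

Lemma ffmap_cons k (A B : finType) (f : A -> B) x (s : {ffun 'I_k -> A}) :
  ffmap f (ffcons x s) = ffcons (f x) (ffmap f s).
Proof.
by apply/ffunP => i; rewrite !ffunE; case: unlift => // j; rewrite ffunE.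
Qed.

Definition inX k (T : finType) (X : 'I_k -> {set T}) (v : {ffun 'I_k -> T}) :=
  [forall i, v i \in X i].

Lemma inX_cons k (T : finType) (X0 : {set T}) (X : {ffun 'I_k -> {set T}}) x s :
  inX (ffcons X0 X) (ffcons x s) = (x \in X0) && inX X s.
Proof.
apply/forallP/andP => [H|[xX /forallP H] i].
  split; first by have := H ord0; rewrite !ffcons0.
  by apply/forallP => i; have := H (lift ord0 i); rewrite !ffconsS.
by case: (unliftP ord0 i) => [j|] ->; rewrite ?ffconsS ?ffcons0.
Qed.

(** With [f v = d - ted G v], a bound [eps] on this for all boxes [X] is uniform density
    ([UniDen_disc]). *)
Definition disc k (T : finType) (X : 'I_k -> {set T}) (f : {ffun 'I_k -> T} -> R) : R :=
  avg (fun v => (inX X v)%:R * f v).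

Lemma disc_cons k (T : finType) (X0 : {set T}) (X : {ffun 'I_k -> {set T}}) f :
  disc (ffcons X0 X) f =
  avg (fun x => (x \in X0)%:R * disc X (fun s => f (ffcons x s))).
Proof.
rewrite /disc avg_cons; apply: eq_avg => x; rewrite -avgZ; apply: eq_avg => s.
by rewrite inX_cons mulrA -natrM mulnb.
Qed.

Lemma norm_bool_mul (b : bool) (x : R) : `|b%:R * x| <= `|x|.
Proof. by case: b; rewrite ?mul1r // mul0r normr0 normr_ge0. Qed.

Lemma disc_dist k (T : finType) (X : 'I_k -> {set T}) f g :
  `|disc X f - disc X g| <= avg (fun v => `|f v - g v|).
Proof.
rewrite /disc -avgB; apply: le_trans (avg_norm _) _; apply: le_avg => v.
by rewrite -mulrBr norm_bool_mul.
Qed.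

Lemma ffmap_override (I J T : finType) (Z : {set I}) (th s : {ffun I -> T})
    (v : {ffun J -> I}) :
  ~~ hits Z v -> ffmap (override Z th s) v = ffmap s v.
Proof.
rewrite /hits negb_exists => /forallP vZ.
by apply/ffunP => i; rewrite !ffunE (negPf (vZ i)).
Qed.

Lemma dist_le2 (x y : R) : `|x| <= 1 -> `|y| <= 1 -> `|x - y| <= 2.
Proof. by move=> x1 y1; apply: le_trans (ler_normB _ _) _; lra. Qed.

Lemma disc_override k (I T : finType) (X : 'I_k -> {set I}) (Z : {set I})
    (th s : {ffun I -> T}) (f : {ffun 'I_k -> T} -> R) :
  (forall v, `|f v| <= 1) ->
  `|disc X (fun j => f (ffmap (override Z th s) j)) - disc X (fun j => f (ffmap s j))|
    <= 2 * (k%:R * #|Z|%:R / #|I|%:R).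
Proof.
move=> f1; apply: le_trans (disc_dist _ _ _) _.
have := avg_hits 'I_k Z; rewrite card_ord => /(ler_wpM2l (ler0n R 2)).
apply: le_trans; rewrite -avgZ.
apply: le_avg => v; case: (boolP (hits Z v)) => [_|/ffmap_override ->].
  by rewrite mulr1 dist_le2.
by rewrite subrr normr0 mulr0.
Qed.

Definition hdmean k (T : finType) (f : {ffun 'I_k.+1 -> T} -> R) (s : {ffun 'I_k -> T}) : R :=
  avg (fun x => f (ffcons x s)).

Lemma hdmean_le1 k (T : finType) (f : {ffun 'I_k.+1 -> T} -> R) s :
  (forall v, `|f v| <= 1) -> `|hdmean f s| <= 1.
Proof. by move=> f1; apply: le_trans (avg_norm _) _; apply: avg_le_const. Qed.

(** Freezing the sample on the entries of [j] fixes the test function, and [lln] applies to what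
    remains random. The last term is twice the bound on the chance that [y] is itself an entry of
    [j]. *)
Lemma sample_head k (I T : finType) (f : {ffun 'I_k.+1 -> T} -> R) (t : R) :
  (0 < #|T|)%N -> (0 < #|I|)%N -> (forall v, `|f v| <= 1) ->
  0 < t -> 4 <= t ^+ 2 * #|I|%:R ->
  avg (fun s : {ffun I -> T} => avg (fun j : {ffun 'I_k -> I} =>
    `|avg (fun y => f (ffcons (s y) (ffmap s j))) - hdmean f (ffmap s j)|))
  <= t + 2 * (k%:R / #|I|%:R).
Proof.
move=> T0 I0 f1 t0 tI; rewrite avg_exchange.
have c0 : 0 <= t + 2 * (k%:R / #|I|%:R).
  by rewrite addr_ge0 ?mulr_ge0 ?invr_ge0 ?ler0n ?ltW.
apply: avg_le_const => // j; pose Z := [set j i | i : 'I_k].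
have Zk : (#|Z| <= k)%N by rewrite (leq_trans (leq_imset_card _ _)) // card_ord.
rewrite (avg_override Z) //; apply: avg_le_const => // th.
pose psi x := f (ffcons x (ffmap th j)).
have ovj s : ffmap (override Z th s) j = ffmap th j.
  by apply/ffunP => i; rewrite !ffunE imset_f.
apply: (@le_trans _ _ (avg (fun s : {ffun I -> T} =>
    `|avg (fun i => psi (s i)) - avg psi| + 2 * (k%:R / #|I|%:R)))); last first.
  rewrite avgD avg_const; last by rewrite card_ffun expn_gt0 T0.
  by rewrite lerD2r; apply: lln => // x; apply: f1.
apply: le_avg => s; rewrite ovj -/(avg psi).
set a := avg _; set b := avg (fun i => psi (s i)).
have ab : `|a - b| <= 2 * (k%:R / #|I|%:R).
  rewrite /a /b -avgB; apply: le_trans (avg_norm _) _.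
  apply: (@le_trans _ _ (avg (fun i : I => 2 * (i \in Z)%:R))).
    apply: le_avg => i; rewrite /psi ffunE; case: (i \in Z).
      by rewrite mulr1 dist_le2.
    by rewrite subrr normr0 mulr0.
  rewrite avgZ avg_le_sum_pred ler_wpM2l // ler_wpM2r ?invr_ge0 ?ler0n //.
  by rewrite ler_nat.
by move: ab; rewrite /hdmean -/psi; have := ler_normD (b - avg psi) (a - b);
  rewrite addrC addrA subrK; lra.
Qed.

End Sampling.

(** * Uniform density passes to random samples *)

Section SamplingTheorem.
Variable R : realType.

Lemma exists_nat_ge (x : R) : exists n : nat, x <= n%:R.
Proof.
exists (Num.bound `|x|); apply: le_trans (ler_norm x) _.
by apply/ltW/archi_boundP.
Qed.

Lemma ffun0_eq (T : Type) (u v : {ffun 'I_0 -> T}) : u = v.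
Proof. by apply/ffunP => -[]. Qed.

Lemma avg_ffun0 (T : finType) (F : {ffun 'I_0 -> T} -> R) v : avg F = F v.
Proof.
rewrite (@eq_avg _ _ _ (fun=> F v)) => [|u]; last by rewrite (ffun0_eq u v).
by rewrite avg_const // card_ffun card_ord expn0.
Qed.

Lemma avg_hdmean k (T : finType) (f : {ffun 'I_k.+1 -> T} -> R) :
  avg (hdmean f) = avg f.
Proof. by rewrite avg_cons avg_exchange. Qed.

(** One coordinate at a time is replaced by its mean: [sample_head] controls the replacement, the
    induction hypothesis treats the mean. *)
Lemma poly_lln k (I T : finType) (f : {ffun 'I_k -> T} -> R) (t : R) :
  (0 < #|T|)%N -> (0 < #|I|)%N -> (forall v, `|f v| <= 1) ->
  0 < t -> 4 <= t ^+ 2 * #|I|%:R ->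
  avg (fun s : {ffun I -> T} => `|avg (fun j : {ffun 'I_k -> I} => f (ffmap s j)) - avg f|)
  <= k%:R * (t + 2 * (k%:R / #|I|%:R)).
Proof.
move=> T0 I0 + t0 tI; elim: k f => [|k IH] f f1.
  rewrite mul0r; apply: avg_le_const => // s; pose j0 : {ffun 'I_0 -> I} := ffun0 (card_ord 0).
  by rewrite (avg_ffun0 _ j0) (avg_ffun0 _ (ffmap s j0)) subrr normr0.
have := sample_head T0 I0 f1 t0 tI; have := IH (hdmean f) (fun s => hdmean_le1 s f1).
set A := avg _; set B := avg _; move=> A1 B1.
apply: (@le_trans _ _ (A + B)).
  rewrite -avgD; apply: le_avg => s; rewrite avg_hdmean.
  have -> : avg (fun j => f (ffmap s j)) =
      avg (fun j : {ffun 'I_k -> I} => avg (fun y => f (ffcons (s y) (ffmap s j)))).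
    rewrite avg_cons avg_exchange; apply: eq_avg => j; apply: eq_avg => y.
    by rewrite ffmap_cons.
  set a := avg _; set b := avg _; set c := avg (fun j => hdmean f _).
  have : `|a - c| <= avg (fun j : {ffun 'I_k -> I} => `|avg (fun y => f (ffcons (s y) (ffmap s
    j)))
      - hdmean f (ffmap s j)|).
    by rewrite /a /c -avgB; apply: avg_norm.
  by have := ler_normD (c - b) (a - c); rewrite addrC addrA subrK; lra.
apply: le_trans (lerD A1 B1) _; rewrite -(natr1 k).
have r0 : 0 <= #|I|%:R^-1 :> R by rewrite invr_ge0.
have k0 : 0 <= k%:R :> R by rewrite ler0n.
by have := mulr_ge0 k0 r0; move: (#|I|%:R^-1) (k%:R) r0 => r K; lra.
Qed.

(** The initial 0 of the maximum makes this the positive part of the worst violation, so that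
    Markov's inequality applies. *)
Definition excess k (I T : finType) (f : {ffun 'I_k -> T} -> R) (c : R)
    (s : I -> T) : R :=
  \big[Order.max/0]_(Y : {ffun 'I_k -> {set I}}) (disc Y (fun j => f (ffmap s j)) - c).

(* The first set is the whole index set: it has been moved into the integrand. *)
Definition excess1 k (I T : finType) (f : {ffun 'I_k.+1 -> T} -> R) (c : R)
    (s : I -> T) : R :=
  \big[Order.max/0]_(Y : {ffun 'I_k -> {set I}})
     (disc (ffcons [set: I] Y) (fun j => f (ffmap s j)) - c).

Lemma excess_ge0 k (I T : finType) f c s : 0 <= @excess k I T f c s.
Proof.
by rewrite /excess; elim/big_rec: _ => // Y x _ x0; rewrite le_max x0 orbT.
Qed.

Lemma excess1_ge0 k (I T : finType) f c s : 0 <= @excess1 k I T f c s.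
Proof.
by rewrite /excess1; elim/big_rec: _ => // Y x _ x0; rewrite le_max x0 orbT.
Qed.

Lemma disc_excess k (I T : finType) f c s (Y : {ffun 'I_k -> {set I}}) :
  disc Y (fun j => f (ffmap s j)) - c <= @excess k I T f c s.
Proof. exact: (le_bigmax 0 (fun Y : {ffun 'I_k -> {set I}} => disc Y _ - c)). Qed.

Lemma disc_excess1 k (I T : finType) f c s (Y : {ffun 'I_k -> {set I}}) :
  disc (ffcons [set: I] Y) (fun j => f (ffmap s j)) - c <= @excess1 k I T f c s.
Proof.
exact: (le_bigmax 0 (fun Y : {ffun 'I_k -> {set I}} => disc (ffcons [set: I] Y) _ - c)).
Qed.

(** As the first set is everything, the first coordinate can be averaged out; the price is the
    quantity bounded in [sample_head]. *)
Lemma excess1_le k (I T : finType) f c s :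
  @excess1 k I T f c s <= excess (hdmean f) c s +
    avg (fun j : {ffun 'I_k -> I} =>
      `|avg (fun y => f (ffcons (s y) (ffmap s j))) - hdmean f (ffmap s j)|).
Proof.
apply: bigmax_le => [|Y _]; first by rewrite addr_ge0 ?excess_ge0 ?avg_ge0.
have -> : disc (ffcons [set: I] Y) (fun j => f (ffmap s j)) =
    disc Y (fun j => avg (fun y => f (ffcons (s y) (ffmap s j)))).
  rewrite disc_cons /disc; rewrite (@eq_avg _ _ _ (fun y => avg (fun j =>
    (inX Y j)%:R * f (ffcons (s y) (ffmap s j))))) => [|y].
    by rewrite avg_exchange; apply: eq_avg => j; rewrite avgZ.
  by rewrite inE mul1r; apply: eq_avg => j; rewrite ffmap_cons.
have := disc_dist Y (fun j => avg (fun y => f (ffcons (s y) (ffmap s j))))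
  (fun j => hdmean f (ffmap s j)).
have := disc_excess (hdmean f) c s Y.
set a := disc _ _; set b := disc _ _; set d := avg _.
by move=> H1 /ler_normlP[_ H2]; move: H1 H2; lra.
Qed.

Lemma excess1_override k (I T : finType) f c (Z : {set I}) (th s : {ffun I -> T}) :
  (forall v, `|f v| <= 1) ->
  @excess1 k I T f c (override Z th s) <=
  excess1 f c s + 2 * (k.+1%:R * #|Z|%:R / #|I|%:R).
Proof.
move=> f1; apply: bigmax_le => [|Y _].
  by rewrite addr_ge0 ?excess1_ge0 ?mulr_ge0 ?invr_ge0 ?ler0n.
have := disc_override (ffcons [set: I] Y) Z th s f1.
have := disc_excess1 f c s Y.
by move=> H1 /ler_normlP[_ H2]; move: H1 H2; lra.
Qed.

Section Step.
Variables (k q : nat) (T : finType) (f : {ffun 'I_k.+1 -> T} -> R).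

(** Empirical gain from putting [x] into the first set, measured on [q] test tuples; [K] stands for
    the tests that lie in the remaining sets. *)
Definition estim (K : {set 'I_q}) (zt : 'I_q -> {ffun 'I_k -> T}) (x : T) : R :=
  avg (fun t => (t \in K)%:R * f (ffcons x (zt t))).

(** The first set, selected by a positive estimated gain, is moved into the integrand; this is why
    [excess1] fits. *)
Definition cutoff K zt (v : {ffun 'I_k.+1 -> T}) : R :=
  (0 < estim K zt (v ord0))%R%:R * f v.

(* The optimal first set for given remaining sets [Y] is determined, up to a
   small error, by the values of [f] on [q] random sample tuples and the set of
   those tuples lying in [Y]; there are only [2 ^ q] such sets. *)
Lemma excess_step (I : finType) (c t : R) (s : {ffun I -> T}) :
  (0 < #|I|)%N -> (0 < q)%N -> (forall v, `|f v| <= 1) ->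
  0 < t -> 4 <= t ^+ 2 * q%:R ->
  excess f c s <= avg (fun z : {ffun 'I_q -> {ffun 'I_k -> I}} =>
     \sum_(K : {set 'I_q}) excess1 (cutoff K (fun i => ffmap s (z i))) c s) + 2 * t.
Proof.
move=> I0 q0 f1 t0 tq; apply: bigmax_le => [|Y _].
  apply: addr_ge0; last by rewrite mulr_ge0 ?ltW.
  by apply: avg_ge0 => z; apply: sumr_ge0 => K _; apply: excess1_ge0.
rewrite -(ffcons_eta Y); move: (Y ord0) (fftail Y) => {}Y0 {}Y.
pose F y := disc Y (fun j => f (ffcons (s y) (ffmap s j))).
pose psi y j := (inX Y j)%:R * f (ffcons (s y) (ffmap s j)).
pose e (z : {ffun 'I_q -> {ffun 'I_k -> I}}) y := avg (fun i => psi y (z i)).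
have -> : disc (ffcons Y0 Y) (fun j => f (ffmap s j)) =
    avg (fun y => (y \in Y0)%:R * F y).
  rewrite disc_cons; apply: eq_avg => y; congr (_ * _).
  by apply: eq_avg => j; rewrite ffmap_cons.
have IJ : (0 < #|{ffun 'I_k -> I}|)%N by rewrite card_ffun expn_gt0 I0.
have zq : (0 < #|{ffun 'I_q -> {ffun 'I_k -> I}}|)%N by rewrite card_ffun expn_gt0 IJ.
have err : avg (fun z : {ffun 'I_q -> {ffun 'I_k -> I}} => avg (fun y => `|e z y - F y|)) <= t.
  rewrite avg_exchange; apply: avg_le_const => [|y]; first exact: ltW.
  apply: (@lln R 'I_q {ffun 'I_k -> I} (psi y)) => //; rewrite ?card_ord //.
  by move=> j; apply: le_trans (norm_bool_mul _ _) _.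
have pt (z : {ffun 'I_q -> {ffun 'I_k -> I}}) : avg (fun y => (y \in Y0)%:R * F y) - c <=
   \sum_(K : {set 'I_q}) excess1 (cutoff K (fun i => ffmap s (z i))) c s
    + 2 * avg (fun y => `|e z y - F y|).
  (* The sets [Y] enter the estimate only through [K], so summing over all [K] covers every [Y]. *)
  pose K := [set i | inX Y (z i)].
  have eK y : estim K (fun i => ffmap s (z i)) (s y) = e z y.
    by apply: eq_avg => i; rewrite inE.
  rewrite (bigD1 K) //= -addrA.
  apply: (@le_trans _ _ (avg (fun y => (0 < e z y)%R%:R * F y) - c
      + 2 * avg (fun y => `|e z y - F y|))); last first.
    apply: lerD; last by rewrite lerDr; apply: sumr_ge0 => ? _; apply: excess1_ge0.
    apply: le_trans (disc_excess1 _ c s Y); rewrite lerD2r disc_cons.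
    apply: le_avg => y; rewrite inE mul1r -eK /F /disc -avgZ; apply: le_avg => j.
    by rewrite ffmap_cons /cutoff ffcons0 mulrCA.
  (* Selecting [y] by the sign of [e z y] is as good as any [Y0] up to the error: where the two
     choices differ, the loss is at most [|e z y - F y|]. *)
  rewrite addrAC lerD2r -avgZ -avgD; apply: le_avg => y.
  have := ler_norm (e z y - F y); have := ler_norm (F y - e z y); rewrite distrC.
  by case: (y \in Y0); case: (ltP 0 (e z y)) => //=; lra.
apply: (@le_trans _ _ (avg (fun z : {ffun 'I_q -> {ffun 'I_k -> I}} => \sum_(K : {set 'I_q})
    excess1 (cutoff K (fun i => ffmap s (z i))) c s + 2 * avg (fun y => `|e z y - F y|)))).
  by rewrite -[leLHS](avg_const _ zq); apply: le_avg => z; apply: pt.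
by rewrite avgD avgZ lerD2l ler_wpM2l.
Qed.

End Step.

(** Induction on [k]. After [excess_step] the first set is one of [2 ^ q] sets determined by test
    tuples. Freezing the at most [q * k] sampled points in these tuples makes it deterministic, and
    averaging out the first coordinate leaves a function of [k] variables that still satisfies the
    bound [c]. *)
Theorem sampling k (delta : R) : 0 < delta ->
  exists r0 : nat, forall I T : finType, (r0 <= #|I|)%N -> (0 < #|T|)%N ->
  forall (f : {ffun 'I_k -> T} -> R) c, (forall v, `|f v| <= 1) ->
  (forall X : {ffun 'I_k -> {set T}}, disc X f <= c) ->
  avg (fun s : {ffun I -> T} => excess f c s) <= delta.
Proof.
elim: k delta => [|k IH] delta d0.
  exists 0%N => I T _ T0 f c f1 fc; apply: avg_le_const => [|s]; first exact: ltW.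
  apply: bigmax_le => [|Y _]; first exact: ltW.
  apply: le_trans (ltW d0); rewrite subr_le0; apply: le_trans (fc [ffun=> set0]).
  have inX0 (U : finType) (X : 'I_0 -> {set U}) v : inX X v = true.
    by apply/forallP => -[].
  pose j0 : {ffun 'I_0 -> I} := ffun0 (card_ord 0).
  by rewrite /disc (avg_ffun0 _ j0) (avg_ffun0 _ (ffmap s j0)) !inX0.
(* Budget: [2 * t = delta / 4] for estimating the first set, and [3 * d'] for each of the
   [M = 2 ^ q] candidates, together [3 / 4 * delta]. *)
pose t := delta / 8; have t0 : 0 < t by rewrite divr_gt0.
have [q1 q1P] := exists_nat_ge (4 / t ^+ 2).
pose q := q1.+1.
have qP : 4 <= t ^+ 2 * q%:R.
  rewrite mulrC -ler_pdivrMr ?exprn_gt0 //; apply: le_trans q1P _.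
  by rewrite ler_nat.
pose M : R := 2 ^+ q; have M0 : 0 < M by rewrite exprn_gt0.
pose d' := delta / (4 * M); have d'0 : 0 < d' by rewrite divr_gt0 ?mulr_gt0.
have [r1 r1P] := IH d' d'0.
have [r2 r2P] := exists_nat_ge (4 / d' ^+ 2).
pose C : R := 2 * k%:R + 2 * (k.+1%:R * (q * k)%:R).
have [r3 r3P] := exists_nat_ge (C / d').
exists (r1 + r2 + r3).+1 => I T rI T0 f c f1 fc.
have I0 : (0 < #|I|)%N by apply: leq_trans rI.
have I0' : 0 < #|I|%:R :> R by rewrite ltr0n.
have [r1I r2I r3I] : [/\ r1 <= #|I|, r2 <= #|I| & r3 <= #|I|]%N.
  by clear -rI; split; lia.
have tI : 4 <= d' ^+ 2 * #|I|%:R.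
  rewrite mulrC -ler_pdivrMr ?exprn_gt0 //; apply: le_trans r2P _.
  by rewrite ler_nat.
have CI : C / #|I|%:R <= d'.
  rewrite ler_pdivrMr // mulrC -ler_pdivrMr //; apply: le_trans r3P _.
  by rewrite ler_nat.
have IT : (0 < #|{ffun I -> T}|)%N by rewrite card_ffun expn_gt0 T0.
have cut1 (K : {set 'I_q}) (zt : 'I_q -> {ffun 'I_k -> T}) v : `|cutoff f K zt v| <= 1.
  by apply: le_trans (norm_bool_mul _ _) _.
have main (K : {set 'I_q}) (z : {ffun 'I_q -> {ffun 'I_k -> I}}) :
    avg (fun s : {ffun I -> T} => excess1 (cutoff f K (fun i => ffmap s (z i))) c s)
    <= 3 * d'.
  pose Z := [set z p.1 p.2 | p : 'I_q * 'I_k].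
  have Zc : (#|Z| <= q * k)%N.
    by rewrite (leq_trans (leq_imset_card _ _)) // card_prod !card_ord.
  have d'3 : 0 <= 3 * d' by rewrite mulr_ge0 ?ltW.
  rewrite (avg_override Z) //; apply: avg_le_const => // th.
  pose g := cutoff f K (fun i => ffmap th (z i)).
  have gE s : cutoff f K (fun i => ffmap (override Z th s) (z i)) = g.
    rewrite /g; congr (cutoff f K _); apply: funext => i; apply/ffunP => j.
    rewrite !ffunE (_ : z i j \in Z) //.
    by apply/imsetP; exists (i, j).
  have s1 (s : {ffun I -> T}) : excess1 (cutoff f K (fun i => ffmap (override Z th s) (z i))) c
      (override Z th s) <= excess (hdmean g) c s +
      avg (fun j : {ffun 'I_k -> I} =>
      `|avg (fun y => g (ffcons (s y) (ffmap s j))) - hdmean g (ffmap s j)|)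
      + 2 * (k.+1%:R * #|Z|%:R / #|I|%:R).
    rewrite gE; apply: le_trans (excess1_override _ _ _ _ (cut1 _ _)) _.
    by rewrite lerD2r excess1_le.
  apply: le_trans (le_avg s1) _; rewrite !avgD avg_const //.
  have e1 : avg (fun s : {ffun I -> T} => excess (hdmean g) c s) <= d'.
    apply: r1P => //.
      by move=> v; apply: hdmean_le1 => w; apply: cut1.
    (* [g] is [f] cut down to first coordinates in [X0], so the hypothesis on [f] for the sets [X0],
       [X] is the bound needed for [hdmean g]. *)
    move=> X; pose X0 := [set x | 0 < estim f K (fun i => ffmap th (z i)) x].
    apply: le_trans (fc (ffcons X0 X)); rewrite disc_cons /disc le_eqVlt; apply/orP; left;
      apply/eqP.
    transitivity (avg (fun s => avg (fun x => (inX X s)%:R * g (ffcons x s)))).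
      by apply: eq_avg => s; rewrite avgZ.
    rewrite avg_exchange; apply: eq_avg => x; rewrite -avgZ; apply: eq_avg => s.
    by rewrite /g /cutoff ffcons0 inE mulrCA.
  have e2 := sample_head T0 I0 (cut1 K (fun i => ffmap th (z i))) d'0 tI.
  have e3 : 2 * (k%:R / #|I|%:R) + 2 * (k.+1%:R * #|Z|%:R / #|I|%:R) <= d'.
    have : k.+1%:R * #|Z|%:R / #|I|%:R <= k.+1%:R * (q * k)%:R / #|I|%:R :> R.
      by rewrite ler_wpM2r ?invr_ge0 ?ler0n // ler_wpM2l ?ler0n // ler_nat.
    by move=> H; apply: le_trans CI; rewrite /C; clear -H; lra.
  clear -e1 e2 e3; rewrite -/g in e2; lra.
apply: le_trans (le_avg (fun s => excess_step c s I0 (ltn0Sn q1) f1 t0 qP)) _.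
rewrite avgD avg_const // avg_exchange.
have : avg (fun z : {ffun 'I_q -> {ffun 'I_k -> I}} => avg (fun s : {ffun I -> T} =>
   \sum_(K : {set 'I_q}) excess1 (cutoff f K (fun i => ffmap s (z i))) c s)) <= M * (3 * d').
  apply: avg_le_const => [|z]; first by apply/mulr_ge0/mulr_ge0; rewrite ?ltW.
  rewrite avg_sum; apply: (@le_trans _ _ (\sum_(K : {set 'I_q}) 3 * d')).
    by apply: ler_sum => K _; apply: main.
  have cardK : #|{set 'I_q}| = (2 ^ q)%N.
    by rewrite -cardsT -powersetT card_powerset cardsT card_ord.
  by rewrite sumr_const -[X in X <= _]mulr_natl cardK natrX.
have -> : M * (3 * d') = 3 / 4 * delta.
  have : d' * (4 * M) = delta by rewrite divfK // lt0r_neq0 ?mulr_gt0.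
  by clear; lra.
by rewrite /t; clear; lra.
Qed.

End SamplingTheorem.

(** * Supersaturation *)

Section Supersaturation.
Variable R : realType.

(** The array spans a complete [r]-partite subsystem of [D] with parts of size [b]. Repeated entries
    are allowed here; [colored_blowup] excludes them. *)
Definition transversals r b (N : finType) (D : pred {ffun 'I_r -> N})
    (xi : {ffun 'I_r -> {ffun 'I_b -> N}}) :=
  [forall g : {ffun 'I_r -> 'I_b}, D [ffun i => xi i (g i)]].

Lemma transversals_cons r b (N : finType) (D : pred {ffun 'I_r.+1 -> N})
    (z : {ffun 'I_b -> N}) xi :
  transversals D (ffcons z xi) =
  transversals (fun s => [forall j, D (ffcons (z j) s)]) xi.
Proof.
apply/forallP/forallP => [H g|H g].
  apply/forallP => j; have := H (ffcons j g); congr (is_true (D _)).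
  apply/ffunP => i; rewrite ffunE.
  by case: (unliftP ord0 i) => [l|] ->; rewrite ?ffconsS ?ffcons0 ?ffunE.
have /forallP/(_ (g ord0)) := H (fftail g); congr (is_true (D _)).
apply/ffunP => i; rewrite [RHS]ffunE.
by case: (unliftP ord0 i) => [l|] ->; rewrite ?ffconsS ?ffcons0 ?ffunE.
Qed.

Lemma forallb_prod (I : finType) (P : pred I) :
  [forall i, P i]%:R = \prod_i (P i)%:R :> R.
Proof.
case: (boolP [forall i, P i]) => [/forallP H|].
  by rewrite big1 // => i _; rewrite H.
rewrite negb_forall => /existsP[i /negPf iP].
by rewrite (bigD1 i) //= iP mul0r.
Qed.

(** Two convexity steps per coordinate: [b] independent choices of the first coordinate raise its
    conditional density to the power [b], and the induction hypothesis is then averaged over these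
    choices. Hence the exponent [b ^ r]. *)
Lemma blowup_density r b (N : finType) (D : pred {ffun 'I_r -> N}) :
  (0 < #|N|)%N ->
  avg (fun s => (D s)%:R : R) ^+ (b ^ r) <=
  avg (fun xi : {ffun 'I_r -> {ffun 'I_b -> N}} => (transversals D xi)%:R : R).
Proof.
move=> N0; elim: r D => [|r IH] D.
  rewrite expn0 expr1; pose s0 : {ffun 'I_0 -> N} := ffun0 (card_ord 0).
  pose x0 : {ffun 'I_0 -> {ffun 'I_b -> N}} := ffun0 (card_ord 0).
  rewrite (avg_ffun0 _ s0) (avg_ffun0 _ x0) ler_nat.
  case Ds: (D s0) => //; suff -> : transversals D x0 by [].
  by apply/forallP => g; rewrite (ffun0_eq [ffun i => x0 i (g i)] s0).
rewrite avg_cons.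
pose Dz (z : {ffun 'I_b -> N}) s := [forall j, D (ffcons (z j) s)].
have Nb0 : (0 < #|{ffun 'I_b -> N}|)%N by rewrite card_ffun expn_gt0 N0.
have Nr0 : (0 < #|{ffun 'I_r -> N}|)%N by rewrite card_ffun expn_gt0 N0.
apply: (@le_trans _ _ (avg (fun z : {ffun 'I_b -> N} => avg (fun s : {ffun 'I_r -> N} => (Dz z
  s)%:R : R) ^+ (b ^ r)))); last first.
  rewrite [leRHS]avg_cons.
  apply: le_avg => z; apply: le_trans (IH _) _; apply: le_avg => xi.
  by rewrite transversals_cons.
apply: le_trans (avg_pow _ Nb0 _); last by move=> z; apply: avg_ge0 => s; rewrite ler0n.
rewrite expnS exprM lerXn2r ?nnegrE ?exprn_ge0 ?avg_ge0 // => [s|z|].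
- by apply: avg_ge0.
- by apply: avg_ge0.
rewrite [leLHS](_ : _ = avg (fun s : {ffun 'I_r -> N} => avg (fun x => (D (ffcons x s))%:R)) ^+
  b); last first.
  by rewrite avg_exchange.
apply: le_trans (avg_pow b Nr0 _) _; first by move=> s; apply: avg_ge0.
rewrite [leRHS]avg_exchange; apply: le_avg => s.
rewrite (@eq_avg _ _ _ (fun z : {ffun 'I_b -> N} => \prod_j (D (ffcons (z j) s))%:R)).
  by rewrite (avg_prod (fun j x => (D (ffcons x s))%:R)) prodr_const card_ord.
by move=> z; rewrite /Dz forallb_prod.
Qed.

Definition uncurryf r b (N : finType) (xi : {ffun 'I_r -> {ffun 'I_b -> N}}) :
  {ffun 'I_r * 'I_b -> N} := [ffun p => xi p.1 p.2].

Lemma uncurryf_bij r b (N : finType) : bijective (@uncurryf r b N).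
Proof.
exists (fun h : {ffun 'I_r * 'I_b -> N} => [ffun i => [ffun j => h (i, j)]]) => [xi|h].
  by apply/ffunP => i; apply/ffunP => j; rewrite !ffunE.
by apply/ffunP => -[i j]; rewrite !ffunE.
Qed.

Lemma array_hits r b (N : finType) (Z : {set N}) :
  avg (fun xi : {ffun 'I_r -> {ffun 'I_b -> N}} => (hits Z (uncurryf xi))%:R : R)
  <= (r * b)%:R * #|Z|%:R / #|N|%:R.
Proof.
rewrite (avg_bij (fun h : {ffun 'I_r * 'I_b -> N} => (hits Z h)%:R) (@uncurryf_bij r b N)).
by apply: le_trans (avg_hits _ _ _) _; rewrite card_prod !card_ord.
Qed.

Lemma array_noninj r b (N : finType) :
  avg (fun xi : {ffun 'I_r -> {ffun 'I_b -> N}} => (~~ injectiveb (uncurryf xi))%:R : R)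
  <= ((r * b) ^ 2)%:R / #|N|%:R.
Proof.
rewrite (avg_bij (fun h : {ffun 'I_r * 'I_b -> N} => (~~ injectiveb h)%:R) (@uncurryf_bij r b N)).
by apply: le_trans (avg_noninj _ _ _) _; rewrite card_prod !card_ord.
Qed.

Lemma le_div_nat (a c : R) : 0 < c -> exists n0, forall n : nat, (n0 <= n)%N -> a / n%:R <= c.
Proof.
move=> c0; have [n0 n0P] := exists_nat_ge (a / c).
exists n0.+1 => n n0n; have n0' : 0 < n%:R :> R by rewrite ltr0n; apply: leq_trans n0n.
rewrite ler_pdivrMr // mulrC -ler_pdivrMr //; apply: le_trans n0P _.
by rewrite ler_nat ltnW.
Qed.

(** Arrays with a repeated entry have density O(1/|N|) and cost at most half of the bound from
    [blowup_density] for the most frequent colour. *)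
Lemma colored_blowup r b (Col : finType) :
  exists2 c : R, 0 < c & exists n0 : nat, forall N : finType, (n0 <= #|N|)%N ->
  forall (col : {ffun 'I_r -> N} -> Col) (good : pred {ffun 'I_r -> N}),
  1 / 2 <= avg (fun s => (good s)%:R : R) ->
  exists kap, c <= avg (fun xi : {ffun 'I_r -> {ffun 'I_b -> N}} =>
    (injectiveb (uncurryf xi) &&
     transversals (fun s => good s && (col s == kap)) xi)%:R : R).
Proof.
(* The successor makes the pigeonhole comparison strict: [|Col| * c1 < 1 / 2]. *)
pose c1 : R := (2 * #|Col|.+1%:R)^-1.
have c10 : 0 < c1 by rewrite invr_gt0 mulr_gt0 ?ltr0n.
pose c := c1 ^+ (b ^ r) / 2; have c0 : 0 < c by rewrite divr_gt0 ?exprn_gt0.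
have [n1 n1P] := le_div_nat (((r * b) ^ 2)%:R) c0.
exists c => //; exists n1.+1 => N N1 col good gd.
have N0 : (0 < #|N|)%N by apply: leq_trans N1.
have [kap kapP] : exists kap, c1 <= avg (fun s => (good s && (col s == kap))%:R : R).
  apply: contrapT => /forallNP H; suff : avg (fun s => (good s)%:R : R) < 1 / 2.
    by move: gd; lra.
  rewrite (@eq_avg _ _ _ (fun s => \sum_kap (good s && (col s == kap))%:R)); last first.
    move=> s; rewrite (bigD1 (col s)) //= eqxx andbT big1 ?addr0 // => kap.
    by rewrite eq_sym => /negPf ->; rewrite andbF.
  rewrite avg_sum; apply: (@le_lt_trans _ _ (\sum_(kap : Col) c1)).
    apply: ler_sum => kap _; have /negP := H kap; rewrite -ltNge; exact: ltW.
  rewrite sumr_const -[X in X < _]mulr_natl /c1 invfM mulrA ltr_pdivrMr ?ltr0n //.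
  by rewrite -(natr1 #|Col|); lra.
exists kap; have := blowup_density b (fun s => good s && (col s == kap)) N0.
have := array_noninj r b N; have := n1P #|N| (ltnW N1).
have : c1 ^+ (b ^ r) <= avg (fun s => (good s && (col s == kap))%:R : R) ^+ (b ^ r).
  by rewrite lerXn2r // ?nnegrE ?avg_ge0 // ltW.
set D := fun s => _ && _; set X := avg _ ^+ _; set Y := avg _; set Z := avg _; set W := avg _.
have : Z - Y <= W.
  rewrite /Z /Y /W -avgB; apply: le_avg => xi.
  by case: (injectiveb _); case: (transversals _ _) => /=; lra.
by rewrite /c; lra.
Qed.

End Supersaturation.

(** * Ordered edges, degrees and pull-backs *)

Section TupleEdges.
Variable R : realType.

Lemma sum_avg (T : finType) (F : T -> R) : \sum_t F t = avg F * #|T|%:R.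
Proof.
have [T0|T0] := posnP #|T|.
  rewrite T0 mulr0 big1 // => t.
  by have /card0_eq/(_ t) := T0; rewrite inE.
by rewrite /avg divfK // pnatr_eq0 -lt0n.
Qed.

Lemma natr_card (T : finType) (P : pred T) : #|P|%:R = \sum_t (t \in P)%:R :> R.
Proof. by rewrite -natr_sum -big_mkcond /= sum1_card. Qed.

(** A tuple with a repetition is never an edge, because its image has fewer than [k] elements. *)
Definition ted k (V : finType) (G : kgraph k V) (v : {ffun 'I_k -> V}) :=
  [set v i | i : 'I_k] \in edges G.

Lemma card_edge k (V : finType) (G : kgraph k V) e : e \in edges G -> #|e| = k.
Proof. by move=> eG; have /forallP/(_ e) := edges_uniform G; rewrite eG => /eqP. Qed.

Lemma imsetTE (A B : finType) (f : A -> B) : f @: [set: A] = [set f x | x : A].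
Proof. by apply/setP => y; apply/imsetP/imsetP => -[x _ ->]; exists x. Qed.

Lemma card_imset_inj (A B : finType) (f : A -> B) :
  #|[set f x | x : A]| = #|A| -> injective f.
Proof.
move=> fA; have /imset_injP H : #|f @: [set: A]| == #|[set: A]|.
  by rewrite imsetTE cardsT fA.
by move=> x y; apply: H; rewrite inE.
Qed.

Definition dsum k (V : finType) (X : 'I_k -> {set V}) (f : {ffun 'I_k -> V} -> R) : R :=
  \sum_v (inX X v)%:R * f v.

Lemma sum_inX k (V : finType) (X : 'I_k -> {set V}) :
  \sum_v (inX X v)%:R = \prod_i #|X i|%:R :> R.
Proof.
rewrite (eq_bigr (fun v : {ffun 'I_k -> V} => \prod_i (v i \in X i)%:R)); last first.
  by move=> v _; rewrite /inX forallb_prod.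
rewrite -(bigA_distr_bigA (fun i x => (x \in X i)%:R)) /=.
by apply: eq_bigr => i _; rewrite natr_card.
Qed.

Lemma edge_tuplesE k (V : finType) (G : kgraph k V) X :
  (edge_tuples G X)%:R = \sum_v (inX X v)%:R * (ted G v)%:R :> R.
Proof.
rewrite /edge_tuples natr_card; apply: eq_bigr => v _.
by rewrite inE -natrM mulnb.
Qed.

Lemma UniDenE k (V : finType) (eps d : R) (G : kgraph k V) :
  UniDen eps d G <->
  (forall X, dsum X (fun v => d - (ted G v)%:R) <= eps * #|V|%:R ^+ k).
Proof.
suff E X : dsum X (fun v => d - (ted G v)%:R) =
    d * (\prod_(i < k) #|X i|%:R) - (edge_tuples G X)%:R.
  by split=> H X; have := H X; rewrite E; lra.
rewrite edge_tuplesE -sum_inX mulr_sumr -sumrB; apply: eq_bigr => v _.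
by rewrite mulrBr [d * _]mulrC.
Qed.

Lemma card_tuples k (V : finType) : #|{ffun 'I_k -> V}|%:R = #|V|%:R ^+ k :> R.
Proof. by rewrite card_ffun card_ord natrX. Qed.

(** A degree as a density of ordered tuples, so that sampling becomes averaging. The vertex [x] may
    lie outside the image of [f], like a vertex to be absorbed relative to the sampled ones. *)
Definition rdeg k (V W : finType) (G : kgraph k.+1 V) (f : W -> V) (x : V) : R :=
  avg (fun s : {ffun 'I_k -> W} => (ted G (ffcons x (ffmap f s)))%:R).

Definition tdeg k (V : finType) (G : kgraph k.+1 V) (x : V) : R :=
  avg (fun s : {ffun 'I_k -> V} => (ted G (ffcons x s))%:R).

Lemma imset_ffcons k (V : finType) (x : V) (s : {ffun 'I_k -> V}) :
  [set ffcons x s i | i : 'I_k.+1] = x |: [set s i | i : 'I_k].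
Proof.
apply/setP => y; rewrite !inE; apply/imsetP/idP => [[i _ ->]|].
  case: (unliftP ord0 i) => [j|] ->; rewrite ?ffcons0 ?eqxx // ffconsS.
  by rewrite imset_f ?orbT.
case/orP => [/eqP ->|/imsetP[j _ ->]]; first by exists ord0; rewrite ?ffcons0.
by exists (lift ord0 j); rewrite ?ffconsS.
Qed.

Lemma card_link_tuples k (V : finType) (x : V) (e : {set V}) :
  #|e| = k.+1 -> x \in e ->
  #|[set s : {ffun 'I_k -> V} | x |: [set s i | i : 'I_k] == e]| = k`!.
Proof.
move=> ek xe; have exk : #|e :\ x| = k by move: ek; rewrite (cardsD1 x) xe => -[].
have := card_inj_ffuns_on 'I_k (mem (e :\ x)); rewrite exk card_ord ffactnn => <-.
apply: eq_card => s; rewrite !inE; apply/eqP/andP => [es|[/ffun_onP se /injectiveP sinj]].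
  have sk : #|[set s i | i : 'I_k]| = k.
    apply/eqP; rewrite eqn_leq; apply/andP; split.
      by rewrite (leq_trans (leq_imset_card _ _)) // card_ord.
    by rewrite -ltnS -ek -es cardsU1 -addn1 addnC leq_add // leq_b1.
  split; last by apply/injectiveP/card_imset_inj; rewrite sk card_ord.
  apply/ffun_onP => i; rewrite !inE -es !inE imset_f // orbT andbT.
  apply/negP => /eqP six; have := ek; rewrite -es cardsU1 -six imset_f //= add0n sk.
  by move/eqP; rewrite eqn_leq ltnn andbF.
apply/eqP; rewrite eqEcard ek cardsU1 card_imset // card_ord.
have -> : x \notin [set s i | i : 'I_k].
  by apply/negP => /imsetP[i _ xs]; have := se i; rewrite -xs !inE eqxx.
rewrite add1n leqnn andbT; apply/subsetP => y; rewrite !inE.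
by case/orP => [/eqP ->//|/imsetP[i _ ->]]; have := se i; rewrite !inE => /andP[].
Qed.

Lemma tdegE k (V : finType) (G : kgraph k.+1 V) x :
  tdeg G x * #|V|%:R ^+ k = (vertex_degree G x * k`!)%:R.
Proof.
rewrite -card_tuples -sum_avg -natr_sum; congr (_%:R).
rewrite (eq_bigr (fun s : {ffun 'I_k -> V} => (\sum_(e in [set e in edges G | x \in e])
    (x |: [set s i | i : 'I_k] == e))%N)) => [|s _]; last first.
  rewrite /ted imset_ffcons -big_mkcondr /=.
  case: (boolP (_ \in edges G)) => [sG|sG].
    rewrite (bigD1 (x |: [set s i | i : 'I_k])) /=; last by rewrite inE sG setU11 eqxx.
    by rewrite big1 ?addn0 // => e /andP[/andP[_ /eqP <-]]; rewrite eqxx.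
  by rewrite big1 // => e /andP[]; rewrite inE => /andP[eG _] /eqP E; rewrite E eG in sG.
rewrite exchange_big /= (eq_bigr (fun=> k`!)) => [|e].
  by rewrite sum_nat_const.
rewrite inE => /andP[eG xe]; rewrite -(card_link_tuples (card_edge eG) xe).
by rewrite -sum1_card [RHS]big_mkcond; apply: eq_bigr => s _; rewrite inE.
Qed.

Lemma inj_avoid_count k (V : finType) (x : V) :
  ((#|V|.-1) ^_ k)%:R = \sum_(s : {ffun 'I_k -> V}) (injectiveb s && ~~ hits [set x] s)%:R :> R.
Proof.
rewrite -natr_sum; congr (_%:R); rewrite -big_mkcond /= sum1_card.
have <- : #|[set~ x]| = #|V|.-1.
  by rewrite -(cardsC [set x]) cards1.
have := card_inj_ffuns_on 'I_k (mem [set~ x]); rewrite card_ord => <-.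
apply: eq_card => s; rewrite !inE andbC.
congr (_ && _); rewrite /hits negb_exists; apply/ffun_onP/forallP => H i; have := H i;
  rewrite !inE //.
Qed.

Lemma tdeg_MinDeg k (V : finType) (G : kgraph k.+1 V) (mu : R) :
  0 <= mu -> (forall x, mu <= tdeg G x) -> MinDeg1 mu G.
Proof.
move=> mu0 H x /=; have k0 : 0 < k`!%:R :> R by rewrite ltr0n fact_gt0.
rewrite -(ler_pM2r k0) -[leRHS]natrM -tdegE -mulrA -natrM bin_ffact.
apply: (@le_trans _ _ (mu * #|V|%:R ^+ k)); last first.
  by rewrite ler_wpM2r ?exprn_ge0.
rewrite ler_wpM2l // (inj_avoid_count _ x) -card_tuples.
by rewrite natr_card; apply: ler_sum => s _; rewrite ler_nat leq_b1.
Qed.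

(** Up to [k!] the binomial coefficient counts the injective tuples avoiding [x], and these are all
    but a fraction [(k ^ 2 + k) / |V|] of the tuples. *)
Lemma MinDeg_tdeg k (V : finType) (G : kgraph k.+1 V) (mu : R) x :
  0 <= mu -> MinDeg1 mu G ->
  mu * (1 - (k ^ 2 + k)%:R / #|V|%:R) <= tdeg G x.
Proof.
move=> mu0 /(_ x) /=; have k0 : 0 < k`!%:R :> R by rewrite ltr0n fact_gt0.
have V0 : (0 < #|V|)%N by apply/card_gt0P; exists x.
rewrite -(ler_pM2r k0) -[leRHS]natrM -tdegE -mulrA -natrM bin_ffact.
have N0 : 0 < #|V|%:R ^+ k :> R by rewrite exprn_gt0 // ltr0n.
move=> H; rewrite -(ler_pM2r N0); apply: le_trans H.
rewrite -mulrA ler_wpM2l // (inj_avoid_count _ x) -card_tuples sum_avg.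
rewrite ler_wpM2r ?ler0n //.
have := avg_noninj R 'I_k V; have := avg_hits R 'I_k [set x].
rewrite card_ord cards1 mulr1.
set A := avg _; set B := avg _; set C := avg _ => hA hB.
have : 1 - A - B <= C.
  have c1 : (0 < #|{ffun 'I_k -> V}|)%N by rewrite card_ffun expn_gt0 V0.
  rewrite -(avg_const (1 : R) c1) /A /B /C -!avgB; apply: le_avg => s.
  by case: injectiveb; case: (hits _ _) => /=; lra.
by rewrite natrD mulrDl; lra.
Qed.

(** For non-injective [f] this is a blow-up: the two cardinalities force [f] to be injective on each
    edge. *)
Program Definition pull k (W V : finType) (f : W -> V) (G : kgraph k V) : kgraph k W :=
  @KGraph k W [set e : {set W} | (#|e| == k) && (f @: e \in edges G)] _.
Next Obligation.
by move=> *; apply/forallP => e; apply/implyP; rewrite inE => /andP[].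
Qed.

Program Definition block_pull k (W V I : finType) (p : W -> I) (f : W -> V)
    (G : kgraph k V) : kgraph k W :=
  @KGraph k W [set e : {set W} | [&& #|e| == k, #|p @: e| == k & f @: e \in edges G]] _.
Next Obligation.
by move=> *; apply/forallP => e; apply/implyP; rewrite inE => /and3P[].
Qed.

Lemma imset_ffmap (I A B : finType) (f : A -> B) (v : {ffun I -> A}) (e : {set I}) :
  f @: (v @: e) = ffmap f v @: e.
Proof.
by rewrite -imset_comp; apply: eq_imset => i; rewrite /= ffunE.
Qed.

Lemma imset_ffmapT (I A B : finType) (f : A -> B) (v : {ffun I -> A}) :
  f @: [set v i | i : I] = [set ffmap f v i | i : I].
Proof. by rewrite -!imsetTE imset_ffmap. Qed.

Lemma card_imset_mono (A B : finType) (f : A -> B) (e : {set A}) k :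
  (#|e| <= k)%N -> #|f @: e| = k -> #|e| = k.
Proof.
move=> ek fek; apply/eqP; rewrite eqn_leq ek -fek leq_imset_card.
by [].
Qed.

Lemma ted_pull k (W V : finType) (f : W -> V) (G : kgraph k V) v :
  ted (pull f G) v = ted G (ffmap f v).
Proof.
rewrite /ted inE imset_ffmapT; case: (boolP (_ \in edges G)) => [H|]; last by rewrite andbF.
rewrite andbT; apply/eqP; apply: (@card_imset_mono _ _ f).
  by rewrite (leq_trans (leq_imset_card _ _)) // card_ord.
by rewrite imset_ffmapT; apply: card_edge H.
Qed.

Lemma ted_block k (W V I : finType) (p : W -> I) (f : W -> V) (G : kgraph k V) v :
  ted (block_pull p f G) v = injectiveb (ffmap p v) && ted G (ffmap f v).
Proof.
rewrite /ted inE !imset_ffmapT andbA andbC [RHS]andbC.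
case: (boolP (_ \in edges G)) => //= H.
apply/andP/injectiveP => [[_ /eqP pk]|pinj].
  by apply: card_imset_inj; rewrite pk card_ord.
have pk : #|[set ffmap p v i | i : 'I_k]| = k by rewrite card_imset // card_ord.
split; last by rewrite pk.
apply/eqP; apply: (@card_imset_mono _ _ p); last by rewrite imset_ffmapT.
by rewrite (leq_trans (leq_imset_card _ _)) // card_ord.
Qed.

Lemma sum_ffmap (I W V : finType) (f : W -> V) (g : {ffun I -> V} -> R) :
  injective f ->
  \sum_(u : {ffun I -> W}) g (ffmap f u) =
  \sum_(v | ~~ hits (~: (f @: [set: W])) v) g v.
Proof.
move=> finj; have minj : injective (@ffmap I W V f).
  move=> u v /ffunP H; apply/ffunP => i; have := H i.
  by rewrite !ffunE => /finj.
transitivity (\sum_(v in ffmap f @: [set: {ffun I -> W}]) g v).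
  rewrite big_imset /=; last by move=> ? ? _ _; apply: minj.
  by apply: eq_bigl => u; rewrite inE.
apply: eq_bigl => v; apply/imsetP/idP => [[u _ ->]|].
  by rewrite /hits negb_exists; apply/forallP => i; rewrite ffunE !inE negbK imset_f ?inE.
rewrite /hits negb_exists => /forallP H.
have {}H i : exists w, f w == v i.
  by have := H i; rewrite !inE negbK => /imsetP[w _ ->]; exists w.
exists [ffun i => xchoose (H i)]; first by rewrite inE.
by apply/ffunP => i; rewrite !ffunE (eqP (xchooseP (H i))).
Qed.

Lemma tail_sum_ffmap (I W V : finType) (f : W -> V) (g : {ffun I -> V} -> R) :
  injective f -> (forall v, g v <= 1) ->
  \sum_v g v - #|I|%:R * #|~: (f @: [set: W])|%:R / #|V|%:R * #|{ffun I -> V}|%:R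
  <= \sum_(u : {ffun I -> W}) g (ffmap f u).
Proof.
move=> finj g1; rewrite sum_ffmap // (bigID (fun v => ~~ hits (~: (f @: [set: W])) v)) /=.
set A := \sum_(_ | _) _; rewrite lerBlDr lerD2l.
apply: le_trans (ler_wpM2r _ (avg_hits R I (~: (f @: [set: W])))); last exact: ler0n.
rewrite -sum_avg [leRHS](bigID (fun v => ~~ hits (~: (f @: [set: W])) v)) /=.
apply: ler_wpDl; first by apply: sumr_ge0 => v _; rewrite ler0n.
by apply: ler_sum => v; rewrite negbK => ->.
Qed.

Lemma head_sum_ffmap (I W V : finType) (f : W -> V) (g : {ffun I -> V} -> R) :
  injective f -> (forall v, 0 <= g v) ->
  \sum_(u : {ffun I -> W}) g (ffmap f u) <= \sum_v g v.
Proof.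
move=> finj g1; rewrite sum_ffmap // [leRHS](bigID (fun v => ~~ hits (~: (f @: [set: W])) v)) /=.
by rewrite lerDl sumr_ge0.
Qed.

Lemma inX_ffmap k (W V : finType) (f : W -> V) (X : 'I_k -> {set V}) u :
  inX X (ffmap f u) = inX (fun i => f @^-1: X i) u.
Proof. by apply: eq_forallb => i; rewrite ffunE inE. Qed.

(** Sets in [W] are sets in [V]; only the normalisation changes, by [|V| ^ k <= 2 ^ k * |W| ^ k]. *)
Lemma UniDen_restrict k (W V : finType) (f : W -> V) (G : kgraph k V) (eps d : R) :
  injective f -> 0 <= eps -> (#|V| <= 2 * #|W|)%N ->
  UniDen eps d G -> UniDen (2 ^+ k * eps) d (pull f G).
Proof.
move=> finj e0 VW /UniDenE H; apply/UniDenE => X.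
apply: (@le_trans _ _ (eps * #|V|%:R ^+ k)); last first.
  rewrite -mulrA mulrCA ler_wpM2l // -exprMn -natrM.
  by rewrite lerXn2r ?nnegrE ?ler0n // ler_nat.
apply: le_trans (H (fun i => f @: X i)).
rewrite /dsum [leRHS](bigID (fun v => ~~ hits (~: (f @: [set: W])) v)) /=.
rewrite -(@sum_ffmap 'I_k W V f
  (fun v => (inX (fun i => f @: X i) v)%:R * (d - (ted G v)%:R))) //.
rewrite [X in _ <= _ + X]big1 ?addr0.
  rewrite le_eqVlt; apply/orP; left; apply/eqP.
  apply: eq_bigr => u _; rewrite inX_ffmap ted_pull; congr ((nat_of_bool _)%:R * _).
  by apply: eq_forallb => i; rewrite inE mem_imset.
move=> v; rewrite negbK => /existsP[i vi].
suff -> : inX (fun i => f @: X i) v = false by rewrite mul0r.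
apply/negP => /forallP/(_ i) /imsetP[w _ vw].
by move: vi; rewrite vw !inE imset_f ?inE.
Qed.

(** By [avg_hits] few tuples use a vertex outside the image of [f], and each of them contributes at
    most [d <= 1]. *)
Lemma UniDen_extend k (W V : finType) (f : W -> V) (G : kgraph k V) (eps d : R) :
  injective f -> 0 <= eps -> 0 <= d <= 1 ->
  UniDen eps d (pull f G) ->
  UniDen (eps + k%:R * #|~: (f @: [set: W])|%:R / #|V|%:R) d G.
Proof.
move=> finj e0 /andP[d0 d1] /UniDenE H; apply/UniDenE => X.
have /= := @tail_sum_ffmap 'I_k W V f
  (fun v => (inX X v)%:R * (d - (ted G v)%:R)) finj.
have WV : (#|W| <= #|V|)%N by apply: leq_card finj.
have H1 := H (fun i => f @^-1: X i).
have : \sum_(u : {ffun 'I_k -> W}) (inX X (ffmap f u))%:R * (d - (ted G (ffmap f u))%:R)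
    <= eps * #|V|%:R ^+ k.
  apply: (@le_trans _ _ (eps * #|W|%:R ^+ k)).
    apply: le_trans H1; rewrite /dsum le_eqVlt; apply/orP; left; apply/eqP.
    by apply: eq_bigr => u _; rewrite inX_ffmap ted_pull.
  by rewrite ler_wpM2l // lerXn2r ?nnegrE ?ler0n // ler_nat.
rewrite card_ord card_tuples mulrDl /dsum => H2 H3.
rewrite -lerBlDr; apply: le_trans H2; apply: H3 => v.
by case: inX; case: ted => /=; lra.
Qed.

Lemma tdeg_restrict k (W V : finType) (f : W -> V) (G : kgraph k.+1 V) w :
  injective f ->
  tdeg G (f w) - k%:R * #|~: (f @: [set: W])|%:R / #|V|%:R <= tdeg (pull f G) w.
Proof.
move=> finj; have W0 : (0 < #|W|)%N by apply/card_gt0P; exists w.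
have WV : (#|W| <= #|V|)%N by apply: leq_card finj.
have V0 : (0 < #|V|)%N by apply: leq_trans WV.
have := @tail_sum_ffmap 'I_k W V f (fun v => (ted G (ffcons (f w) v))%:R) finj.
rewrite sum_avg -/(tdeg G (f w)) -mulrBl card_ord card_tuples.
set A := _ - _ => /(_ (fun v => _))-/(_ _)/wrap[|H].
  by move=> v; case: ted.
have pw : 0 < #|W|%:R ^+ k :> R by rewrite exprn_gt0 // ltr0n.
have [A0|A0] := leP A 0; first by apply: le_trans A0 _; apply: avg_ge0.
rewrite -(ler_pM2r pw); apply: (@le_trans _ _ (A * #|V|%:R ^+ k)).
  by rewrite ler_wpM2l ?(ltW A0) // lerXn2r ?nnegrE ?ler0n // ler_nat.
apply: le_trans H _; rewrite -card_tuples -sum_avg le_eqVlt; apply/orP; left; apply/eqP.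
by apply: eq_bigr => s _; rewrite ted_pull ffmap_cons.
Qed.

Lemma tdeg_extend k (W V : finType) (f : W -> V) (G : kgraph k.+1 V) (x : V) :
  injective f -> (#|V| <= 2 * #|W|)%N ->
  rdeg G f x <= 2 ^+ k * tdeg G x.
Proof.
move=> finj VW; have V0 : (0 < #|V|)%N by apply/card_gt0P; exists x.
have := @head_sum_ffmap 'I_k W V f (fun v => (ted G (ffcons x v))%:R) finj.
move=> /(_ (fun v => ler0n _ _)); rewrite !sum_avg !card_tuples => H.
have W0 : (0 < #|W|)%N by have := leq_trans V0 VW; rewrite muln_gt0.
have pw : 0 < #|W|%:R ^+ k :> R by rewrite exprn_gt0 // ltr0n.
rewrite -(ler_pM2r pw); apply: le_trans H _; rewrite -/(tdeg G x).
have -> : 2 ^+ k * tdeg G x * #|W|%:R ^+ k = tdeg G x * (2 * #|W|)%:R ^+ k.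
  by rewrite natrM exprMn [RHS]mulrCA [RHS]mulrA.
apply: ler_wpM2l; first exact: avg_ge0.
by rewrite lerXn2r ?nnegrE ?ler0n // ler_nat.
Qed.

End TupleEdges.

(** * Tilings and blow-ups *)

Section Tilings.
Variables (k m : nat).
Hypothesis m_gt0 : (0 < m)%N.
Variable F : kgraph k 'I_m.

(** A tiling is remembered only by the set it covers, which is all that unions and absorption need;
    [tileable_perfect] recovers the copies. *)
Inductive tileable (V : finType) (G : kgraph k V) : {set V} -> Prop :=
| tileable0 : tileable G set0
| tileableU (phi : {ffun 'I_m -> V}) (U : {set V}) : is_hom F G phi -> injective phi ->
    [disjoint U & phi @: [set: 'I_m]] -> tileable G U ->
    tileable G (U :|: phi @: [set: 'I_m]).

Lemma tileable_disjointU (V : finType) (G : kgraph k V) (A B : {set V}) :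
  tileable G A -> tileable G B -> [disjoint A & B] -> tileable G (A :|: B).
Proof.
move=> tA; elim: B / => [|phi B hphi iphi dB tB IH]; first by rewrite setU0.
move=> dAB; rewrite setUA; apply: tileableU => //.
  rewrite disjoints_subset subUset -!disjoints_subset dB andbT.
  by apply: disjointWr dAB; exact: subsetUr.
by apply: IH; apply: disjointWr dAB; exact: subsetUl.
Qed.

Lemma tileable_bigcup (V I : finType) (G : kgraph k V) (P : pred I) (A : I -> {set V}) :
  (forall i j, P i -> P j -> i != j -> [disjoint A i & A j]) ->
  (forall i, P i -> tileable G (A i)) -> tileable G (\bigcup_(i | P i) A i).
Proof.
move=> dA tA; rewrite -big_filter.
have : all P [seq i <- index_enum I | P i] by rewrite filter_all.
have : uniq [seq i <- index_enum I | P i] by rewrite filter_uniq // index_enum_uniq.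
elim: [seq _ <- _ | _] => [|i s IH] /=; first by rewrite big_nil => _ _; constructor.
case/andP => is_ us /andP[Pi Ps]; rewrite big_cons; apply: tileable_disjointU; auto.
rewrite disjoint_sym disjoints_subset big_seq; elim/big_ind: _.
- exact: sub0set.
- by move=> B B' sB sB'; rewrite subUset sB.
move=> j js; rewrite -disjoints_subset; apply: dA => //; first by apply: (allP Ps).
by apply: contraNneq is_ => <-.
Qed.

Lemma tileable_card (V : finType) (G : kgraph k V) A : tileable G A -> (m %| #|A|)%N.
Proof.
elim: A / => [|phi B hphi iphi dB tB IH]; first by rewrite cards0.
by rewrite cardsU disjoint_setI0 // cards0 subn0 card_imset // cardsT card_ord dvdn_addr.
Qed.

Lemma tileable_perfect (V : finType) (G : kgraph k V) :
  tileable G [set: V] -> has_perfect_tiling F G.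
Proof.
suff H U : tileable G U -> exists2 T : {set {set V} * {set {set V}}},
    T \subset copies F G & forall v, #|[set S in T | v \in S.1]| = (v \in U).
  by move=> /H[T TF Tv]; exists T => // v; rewrite Tv inE.
elim: U / => [|phi U hphi iphi dU tU [T TF Tv]].
  exists set0; first by rewrite sub0set.
  by move=> v; rewrite inE; apply/eqP; rewrite cards_eq0; apply/eqP/setP => S; rewrite !inE.
pose p := (phi @: [set: 'I_m], [set phi @: e | e : {set 'I_m} in edges F]).
have pC : p \in copies F G.
  by apply/imsetP; exists phi => //; rewrite !inE hphi; apply/injectiveP.
exists (p |: T); first by rewrite subUset sub1set pC.
move=> v; rewrite !inE.
have [vp|vp] := boolP (v \in phi @: [set: 'I_m]).
  have vU : v \notin U by rewrite (disjointFl dU vp).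
  rewrite orbT; suff -> : [set S in p |: T | v \in S.1] = [set p] by rewrite cards1.
  apply/setP => S; rewrite !inE; case: eqVneq => [->|_] //=.
  have /eqP := Tv v; rewrite (negPf vU) cards_eq0 => /eqP/setP/(_ S).
  by rewrite !inE.
rewrite orbF -Tv; apply: eq_card => S; rewrite !inE.
by case: eqVneq => [->|_] //=; rewrite (negPf vp) andbF.
Qed.

Lemma multiplicity_inj (V : finType) (e : {ffun 'I_m -> V}) v :
  injective e -> multiplicity v e = (v \in e @: [set: 'I_m]).
Proof.
move=> einj; rewrite /multiplicity; case: imsetP => [[i _ ->]|H].
  rewrite (_ : [set _ | _] = [set i]) ?cards1 //.
  by apply/setP => j; rewrite !inE (inj_eq einj).
apply/eqP; rewrite cards_eq0; apply/eqP/setP => i; rewrite !inE.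
by apply/negP => /eqP ei; apply: H; exists i.
Qed.

Lemma sum_multiplicity (V : finType) (e : {ffun 'I_m -> V}) :
  (\sum_v multiplicity v e = m)%N.
Proof.
rewrite -[RHS]card_ord -sum1_card (partition_big e predT) //=.
apply: eq_bigr => v _; rewrite /multiplicity -sum1_card.
by apply: eq_bigl => i; rewrite inE.
Qed.

Lemma multiplicity_ffmap (V W : finType) (f : W -> V) (e : {ffun 'I_m -> W}) v :
  (multiplicity v (ffmap f e) = \sum_(w | f w == v) multiplicity w e)%N.
Proof.
rewrite /multiplicity -sum1_card (partition_big e (fun w => f w == v)) /=.
  apply: eq_bigr => w /eqP fw; rewrite -sum1_card; apply: eq_bigl => i.
  by rewrite !inE ffunE; case: (eqVneq (e i) w) => [->|_]; rewrite ?andbF // fw eqxx.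
by move=> i; rewrite inE ffunE.
Qed.

(** Automorphisms of [F] give several embeddings with the same copy; exactly one is chosen, so that
    the multiplicities add up to 1. *)
Lemma perfect_family (V : finType) (G : kgraph k V) :
  has_perfect_tiling F G ->
  exists2 E : {set {ffun 'I_m -> V}},
    {in E, forall e, is_hom F G e /\ injective e} &
    forall v, (\sum_(e in E) multiplicity v e = 1)%N.
Proof.
case=> T TF Tv.
pose cp (phi : {ffun 'I_m -> V}) :=
  (phi @: [set: 'I_m], [set phi @: e | e : {set 'I_m} in edges F]).
have [phi0 _|no] := pickP (fun _ : {ffun 'I_m -> V} => true); last first.
  by exists set0 => [e|v]; [rewrite inE|have := no [ffun => v]].
pose emb S := odflt phi0
  [pick phi | [&& phi \in hom_digraph F G, injectiveb phi & S == cp phi]].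
have embP S : S \in T -> [/\ is_hom F G (emb S), injective (emb S) & S = cp (emb S)].
  move=> /(subsetP TF)/imsetP[phi]; rewrite inE => /andP[h i] ->.
  rewrite /emb; case: pickP => [psi|/(_ phi)] /=.
    by rewrite inE => /and3P[? /injectiveP ? /eqP ?].
  by rewrite h i eqxx.
exists (emb @: T) => [e /imsetP[S /embP[? ? _] ->]//|v].
rewrite big_imset /=; last by move=> S S' /embP[_ _ {2}->] /embP[_ _ {2}->] ->.
transitivity (\sum_(S in T) (v \in S.1))%N.
  by apply: eq_bigr => S /embP[_ einj eS]; rewrite multiplicity_inj // {2}eS.
rewrite -(Tv v) -sum1_card [RHS]big_mkcond /= big_mkcond; apply: eq_bigr => S _.
by rewrite inE; case: (S \in T).
Qed.

Lemma tile_blowup (V W : finType) (G : kgraph k V) (C : W -> {set V})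
    (s : seq {ffun 'I_m -> W}) :
  (forall w w', w != w' -> [disjoint C w & C w']) ->
  (forall phi, phi \in s -> forall psi : {ffun 'I_m -> V},
     (forall a, psi a \in C (phi a)) -> is_hom F G psi) ->
  (forall w, #|C w| = \sum_(phi <- s) multiplicity w phi)%N ->
  tileable G (\bigcup_w C w).
Proof.
elim: s C => [|phi s IH] C dC hC cC.
  suff -> : \bigcup_w C w = set0 by constructor.
  by apply: big1 => w _; apply/eqP; rewrite -cards_eq0 cC big_nil.
have leC w : (multiplicity w phi <= #|C w|)%N by rewrite cC big_cons leq_addr.
have [x0 _] : exists x, x \in C (phi (Ordinal m_gt0)).
  apply/card_gt0P; apply: leq_trans (leC _).
  by apply/card_gt0P; exists (Ordinal m_gt0); rewrite inE.
(* The rank of [a] among the indices with the same image: repeated values of [phi] receive different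
   vertices of the class. *)
pose idx a := index a (enum [set a' | phi a' == phi a]).
have idx_lt a : (idx a < size (enum (C (phi a))))%N.
  apply: (@leq_trans (multiplicity (phi a) phi)); last by rewrite -cardE.
  by rewrite /multiplicity cardE index_mem mem_enum inE.
pose psi : {ffun 'I_m -> V} := [ffun a => nth x0 (enum (C (phi a))) (idx a)].
have psiC a : psi a \in C (phi a) by rewrite ffunE -mem_enum mem_nth.
have same_block v w w' : v \in C w -> v \in C w' -> w = w'.
  move=> vw vw'; apply/eqP/negPn/negP => /dC dw.
  by rewrite (disjointFr dw vw) in vw'.
have psi_inj : injective psi.
  move=> a a' E; have phiE : phi a = phi a'.
    by apply: (@same_block (psi a)); rewrite // E.
  move: E; rewrite !ffunE -phiE => /eqP; rewrite nth_uniq ?enum_uniq //; last first.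
    by rewrite phiE.
  rewrite /idx -phiE => /eqP /(congr1 (nth a (enum [set a0 | phi a0 == phi a]))).
  by rewrite !nth_index ?mem_enum ?inE ?phiE.
pose C' w := C w :\: (psi @: [set: 'I_m]).
have -> : \bigcup_w C w = \bigcup_w C' w :|: psi @: [set: 'I_m].
  apply/setP => v; rewrite inE; apply/bigcupP/orP => [[w _ vw]|[/bigcupP[w _]|/imsetP[a _ ->]]].
  - have [vp|vp] := boolP (v \in psi @: [set: 'I_m]); first by right.
    by left; apply/bigcupP; exists w; rewrite // inE vp.
  - by rewrite inE => /andP[_ vw]; exists w.
  - by exists (phi a).
apply: tileableU => //; first by apply: (hC phi _ psi psiC); rewrite inE eqxx.
  rewrite disjoints_subset; apply/bigcupsP => w _.
  by apply/subsetP => v; rewrite !inE => /andP[].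
apply: IH => [w w' /dC dw|phi' phi's psi' psi'C|w].
- apply: disjointWl (subsetDl _ _) _; apply: disjointWr dw; exact: subsetDl.
- apply: (hC phi' _ psi'); first by rewrite inE phi's orbT.
  by move=> a; have := psi'C a; rewrite inE => /andP[].
rewrite cardsD cC big_cons; suff -> : #|C w :&: psi @: [set: 'I_m]| = multiplicity w phi.
  by rewrite addKn.
rewrite /multiplicity -(card_imset _ psi_inj); apply: eq_card => v; rewrite !inE.
apply/andP/imsetP => [[vw /imsetP[a _ va]]|[a]].
  by exists a => //; rewrite inE; apply/eqP/(@same_block v) => //; rewrite va.
by rewrite inE => /eqP <- ->; rewrite psiC imset_f ?inE.
Qed.

Lemma hom_pull (V W : finType) (f : W -> V) (G : kgraph k V) (phi : {ffun 'I_m -> W}) :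
  is_hom F (pull f G) phi -> is_hom F G (ffmap f phi).
Proof.
move=> /forallP H; apply/forallP => e; apply/implyP => eF.
by have := H e; rewrite eF /= inE -imset_ffmap => /andP[].
Qed.

(** An edge of [E] meets each block at most once, so along one edge of [F] the representatives [c a]
    concern different blocks and a single choice [g] realises them. Different edges may need
    different [g], hence [E] has to be the pattern of every [g]. *)
Lemma lift_hom (V W I J : finType) (G : kgraph k V) (E : kgraph k W) (p : W -> I)
    (sig : {ffun I -> J} -> W -> V) (phi : {ffun 'I_m -> W}) (c : 'I_m -> J)
    (psi : {ffun 'I_m -> V}) :
  (0 < k)%N -> (forall g, edges E = edges (block_pull p (sig g) G)) ->
  is_hom F E phi ->
  (forall a (g : {ffun I -> J}), g (p (phi a)) = c a -> psi a = sig g (phi a)) ->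
  is_hom F G psi.
Proof.
move=> k0 EG /forallP hphi psiE; apply/forallP => e; apply/implyP => eF.
have eE : phi @: e \in edges E by have := hphi e; rewrite eF.
have /card_gt0P[a0 a0e] : (0 < #|e|)%N by rewrite (card_edge eF).
(* The default [a0] only fills the blocks that the edge misses. *)
pose g : {ffun I -> J} := [ffun i => c (odflt a0 [pick a in e | p (phi a) == i])].
have inj_e : {in e &, injective (fun a => p (phi a))}.
  apply/imset_injP; rewrite (card_edge eF); have := eE; rewrite (EG g) inE => /and3P[_ + _].
  by rewrite -imset_comp.
have gE a : a \in e -> g (p (phi a)) = c a.
  move=> ae; rewrite ffunE; case: pickP => [a' /andP[a'e /eqP pa]|/(_ a)] /=.
    by rewrite (inj_e _ _ a'e ae pa).
  by rewrite ae eqxx.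
suff -> : psi @: e = sig g @: (phi @: e).
  by have := eE; rewrite (EG g) inE => /and3P[].
by rewrite -imset_comp; apply: eq_in_imset => a ae; apply: psiE; apply: gE.
Qed.

End Tilings.

(** * Necessity *)

Section Necessity.
Variable R : realType.

Lemma sum_indicator (A : pzRingType) (T : finType) (E H : {set T}) (x : T -> A) :
  E \subset H -> \sum_(e in H) (e \in E)%:R * x e = \sum_(e in E) x e.
Proof.
move=> EH; rewrite [RHS]big_mkcond [LHS]big_mkcond /=; apply: eq_bigr => e _.
case: (boolP (e \in E)) => [/(subsetP EH) ->|_]; first by rewrite mul1r.
by rewrite mul0r; case: ifP.
Qed.

Lemma perfect_Div k m (V : finType) (F : kgraph k 'I_m) (G : kgraph k V) :
  has_perfect_tiling F G -> Div (hom_digraph F G).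
Proof.
move=> /perfect_family[E EH Ev]; exists (fun e => (e \in E)%:R) => v.
rewrite sum_indicator; last by apply/subsetP => e /EH[? _]; rewrite inE.
have := Ev v => /(congr1 (fun n => n%:Z)); rewrite -natz natr_sum => H.
by rewrite -[RHS]H; apply: eq_bigr => e _; rewrite natz.
Qed.

Lemma perfect_Cov k m (V : finType) (F : kgraph k 'I_m) (G : kgraph k V) :
  has_perfect_tiling F G -> Cov (hom_digraph F G).
Proof.
move=> /perfect_family[E EH Ev] v.
have [e eE ev] : exists2 e, e \in E & multiplicity v e != 0%N.
  apply: contrapT => H; have := Ev v; rewrite big1 // => e eE.
  by apply/eqP/negPn/negP => ev; apply: H; exists e.
have [he einj] := EH e eE; exists e; first by rewrite inE.
by move: ev; rewrite (multiplicity_inj _ einj); case: (v \in _).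
Qed.

Lemma perfect_pull_Spa k m (V W : finType) (f : W -> V) (F : kgraph k 'I_m)
    (G : kgraph k V) (rho : R) :
  (0 < m)%N -> injective f -> (1 - rho) * #|V|%:R <= #|W|%:R ->
  has_perfect_tiling F (pull f G) -> Spa rho (hom_digraph F G).
Proof.
move=> m0 finj VW /perfect_family[E EH Ev].
have minj : injective (@ffmap 'I_m W V f).
  move=> u v /ffunP H; apply/ffunP => i; have := H i.
  by rewrite !ffunE => /finj.
pose E' := ffmap f @: E.
have EH' : E' \subset hom_digraph F G.
  apply/subsetP => _ /imsetP[e /EH[he _] ->]; rewrite inE; exact: hom_pull.
exists (fun e => (e \in E')%:R); split.
- by move=> e _; case: (e \in E'); rewrite ?lexx ler01.
- move=> v; rewrite sum_indicator // big_imset /=; last by move=> ? ? _ _; apply: minj.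
  rewrite -natr_sum lern1.
  rewrite (eq_bigr (fun e => \sum_(w | f w == v) multiplicity w e)%N); last first.
    by move=> e _; rewrite multiplicity_ffmap.
  rewrite exchange_big /= (eq_bigr (fun=> 1%N)) => [|w _]; last exact: Ev.
  rewrite sum1_card; apply/card_le1_eqP => w w'.
  by move=> /eqP fw /eqP fw'; apply: finj; rewrite fw fw'.
- rewrite ler_pdivrMr ?ltr0n //; apply: le_trans VW _.
  rewrite (eq_bigr (fun e => (e \in E')%:R * 1)); last by move=> *; rewrite mulr1.
  rewrite sum_indicator // big_imset /=; last by move=> ? ? _ _; apply: minj.
  rewrite sumr_const -natrM ler_nat.
  (* Double counting: [|W| = |E| * m]. *)
  have : (\sum_w \sum_(e in E) multiplicity w e = #|W|)%N.
    by rewrite (eq_bigr (fun=> 1%N)) ?sum1_card // => w _; apply: Ev.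
  rewrite exchange_big /= (eq_bigr (fun=> m)) => [|e _]; last exact: sum_multiplicity.
  by rewrite sum_nat_const => ->.
Qed.

Lemma ord_injection (V : finType) n : (n <= #|V|)%N -> exists f : 'I_n -> V, injective f.
Proof.
move=> nV; exists (fun i => enum_val (widen_ord nV i)) => i j /enum_val_inj /(congr1 val) ij.
exact: val_inj.
Qed.

Lemma card_coimage (V W : finType) (f : W -> V) :
  injective f -> #|~: (f @: [set: W])| = (#|V| - #|W|)%N.
Proof.
by move=> finj; rewrite -(cardsC (f @: [set: W])) card_imset // cardsT addKn.
Qed.

(** At most [m] vertices are deleted to make the order divisible; a perfect tiling of the rest, as a
    0/1 weighting, misses at most a fraction [rho]. *)
Lemma Til_Spa k m (F : kgraph k.+1 'I_m) : (0 < m)%N -> F_Til R k.+1 m F -> F_Spa R k.+1 m F.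
Proof.
move=> m0 FT d mu rho d0 mu0 rho0.
(* Half of [mu] survives the passage to tuple densities, and [mu / 4] of it pays for the deleted
   vertices. *)
have mu40 : 0 < mu / 4 by rewrite divr_gt0.
have [eps1 eps10 [n1 n1P]] := FT d (mu / 4) d0 mu40.
exists (eps1 / 2 ^+ k.+1); first by rewrite divr_gt0 ?exprn_gt0.
have [n2 n2P] := le_div_nat (k ^ 2 + k)%:R (ltac:(by lra) : 0 < 1 / 2 :> R).
have [n3 n3P] := le_div_nat (k * m)%:R mu40.
have [n4 n4P] := le_div_nat m%:R rho0.
exists (n1 + n2 + n3 + n4 + 2 * m)%N; first by clear -m0; lia.
move=> V G nV [/= GU GM].
set n := #|V| in nV; pose nW := (n %/ m * m)%N.
have rm : (n %% m < m)%N by rewrite ltn_mod.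
have nE := divn_eq n m; rewrite -/nW in nE.
have nWV : (nW <= #|V|)%N by rewrite -/n; clear -nE; lia.
have [f finj] := ord_injection nWV.
have [b1 b2 b3 b4] : [/\ n2 <= n, n3 <= n, n4 <= n & 0 < n]%N.
  by clear -nV m0; split; lia.
have n0 : 0 < n%:R :> R by rewrite ltr0n.
have coim : (#|~: (f @: [set: 'I_nW])| <= m)%N.
  by rewrite card_coimage // card_ord -/n; clear -nE rm; lia.
apply: (perfect_pull_Spa m0 finj).
  rewrite card_ord -/n; have := n4P n b3; rewrite ler_pdivrMr // => H.
  have : n%:R <= nW%:R + m%:R :> R by rewrite -natrD ler_nat; clear -nE rm; lia.
  by lra.
apply: (n1P nW); rewrite ?card_ord //.
- by clear -nV nE rm; lia.
- exact: dvdn_mull.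
split => /=.
  have -> : eps1 = 2 ^+ k.+1 * (eps1 / 2 ^+ k.+1).
    by rewrite mulrCA divff ?mulr1 // lt0r_neq0 // exprn_gt0.
  apply: UniDen_restrict => //; first by rewrite divr_ge0 ?exprn_ge0 ?ltW.
  by rewrite card_ord -/n; clear -nV nE rm; lia.
apply: tdeg_MinDeg; first exact: ltW.
move=> w; apply: (le_trans _ (tdeg_restrict _ _ w finj)).
have H1 := MinDeg_tdeg (f w) (ltW mu0) GM.
have H2 : k%:R * #|~: (f @: [set: 'I_nW])|%:R / #|V|%:R <= mu / 4.
  apply: (le_trans _ (n3P n b2)); rewrite natrM ler_wpM2r ?invr_ge0 ?ler0n //.
  by rewrite ler_wpM2l ?ler0n // ler_nat.
have H3 := n2P n b1.
have : mu * (1 - (k ^ 2 + k)%:R / n%:R) >= mu / 2.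
  by rewrite ler_wpM2l ?(ltW mu0) //; lra.
by rewrite -/n in H1 H2 *; lra.
Qed.

(** Divisibility by 0 forces order 0, which the threshold 1 excludes. *)
Lemma eventually_forced0 k (P : forall V : finType, kgraph k V -> Prop) :
  eventually_forced R 0 P.
Proof.
move=> d mu _ _; exists 1; first exact: ltr01.
by exists 1%N => n n1; rewrite dvd0n => /eqP n0; rewrite n0 in n1.
Qed.

Lemma F_Spa0 k (F : kgraph k 'I_0) : F_Spa R k 0 F.
Proof.
move=> d mu rho d0 mu0 rho0; exists 1; first exact: ltr01.
exists 1%N => // V G _ _; exists (fun=> 0); split=> [e _|v|].
- by rewrite lexx ler01.
- by rewrite big1 // => e _; rewrite mul0r.
- by rewrite big1 // invr0 mulr0.
Qed.

End Necessity.

(** * Absorbers in a pattern *)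

Section Absorbers.
Variable R : realType.

Lemma UniDen_disc k (W : finType) (G : kgraph k W) (eps d : R) :
  (0 < #|W|)%N -> UniDen eps d G <->
  forall X : {ffun 'I_k -> {set W}}, disc X (fun v => d - (ted G v)%:R) <= eps.
Proof.
move=> W0; have Wk : 0 < #|W|%:R ^+ k :> R by rewrite exprn_gt0 // ltr0n.
have E X : dsum X (fun v => d - (ted G v)%:R) =
    disc X (fun v => d - (ted G v)%:R) * #|W|%:R ^+ k.
  by rewrite -card_tuples -sum_avg.
split=> [/UniDenE H X|H]; first by have := H X; rewrite E ler_pM2r.
apply/UniDenE => X; rewrite E ler_pM2r //.
have := H [ffun i => X i]; congr (_ <= _); apply: eq_avg => v.
by congr ((nat_of_bool _)%:R * _); apply: eq_forallb => i; rewrite ffunE.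
Qed.

Lemma UniDen_ext k (W : finType) (G G' : kgraph k W) (eps d : R) :
  (forall v, ted G v = ted G' v) -> UniDen eps d G -> UniDen eps d G'.
Proof.
move=> E /UniDenE H; apply/UniDenE => X; apply: le_trans (H X).
by apply: ler_sum => v _; rewrite E.
Qed.

Lemma UniDen_le k (W : finType) (G : kgraph k W) (eps eps' d d' : R) :
  eps <= eps' -> d' <= d -> UniDen eps d G -> UniDen eps' d' G.
Proof.
move=> ee dd H X /=; apply: le_trans (H X); apply: lerB.
  by rewrite ler_wpM2r // prodr_ge0.
by rewrite ler_wpM2r // exprn_ge0.
Qed.

Lemma subset_card (T : finType) (A : {set T}) j :
  (j <= #|A|)%N -> exists2 J : {set T}, J \subset A & #|J| = j.
Proof.
move=> jA; exists [set x in take j (enum A)].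
  by apply/subsetP => x; rewrite inE => /mem_take; rewrite mem_enum.
rewrite cardsE; have /card_uniqP -> : uniq (take j (enum A)) by rewrite take_uniq ?enum_uniq.
by rewrite size_take -cardE; move: jA; rewrite leq_eqVlt => /orP[/eqP ->|->//]; rewrite ltnn.
Qed.

(* Uniform density alone bounds the number of vertices of small degree. *)
Lemma high_degree_core k m (d eta : R) : (0 < m)%N -> 0 < d -> 0 < eta <= 1 ->
  exists2 eps : R, 0 < eps & exists s0 : nat,
  forall (W : finType) (G : kgraph k.+1 W), (s0 <= #|W|)%N -> UniDen eps d G ->
  exists J : {set W}, [/\ #|~: J|%:R <= eta * #|W|%:R, (m %| #|J|.+1)%N &
    {in J, forall w, d / 2 <= tdeg R G w}].
Proof.
move=> m0 d0 /andP[eta0 eta1]; pose eps := eta * d / 4.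
have eps0 : 0 < eps by rewrite !(divr_gt0, mulr_gt0).
exists eps => //; have [s1 s1P] := le_div_nat (2 * m%:R) eta0.
exists (s1 + 2 * m).+1 => W G Ws GU.
have W0 : (0 < #|W|)%N by apply: leq_trans Ws.
have W0' : 0 < #|W|%:R :> R by rewrite ltr0n.
pose B := [set w | tdeg R G w < d / 2].
have Bsmall : #|B|%:R <= eta / 2 * #|W|%:R.
  (* Density is tested with [B] in the first coordinate and everything in the others: each vertex of
     [B] falls short of [d] by more than [d / 2]. *)
  have /(UniDen_disc _ _ _ W0)/(_ (ffcons B [ffun=> [set: W]])) := GU.
  rewrite disc_cons => H.
  have : avg (fun x => (x \in B)%:R * (d / 2)) <= eps.
    apply: le_trans H; apply: le_avg => x.
    rewrite inE; case: ltP => [xB|_]; last by rewrite !mul0r.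
    rewrite !mul1r /disc (@eq_avg _ _ _ (fun s => d - (ted G (ffcons x s))%:R)); last first.
      move=> s; rewrite (_ : inX _ _ = true) ?mul1r //.
      by apply/forallP => i; rewrite ffunE inE.
    rewrite avgB avg_const; last by rewrite card_ffun expn_gt0 W0.
    by rewrite -/(tdeg R G x); lra.
  rewrite (@eq_avg _ _ _ (fun x => (d / 2) * (x \in B)%:R)); last by move=> x; rewrite mulrC.
  rewrite avgZ avg_le_sum_pred mulrA ler_pdivrMr // /eps => H1.
  rewrite -(@ler_pM2l _ (d / 2)) ?divr_gt0 //; apply: le_trans H1 _.
  by rewrite le_eqVlt; apply/orP; left; apply/eqP; lra.
have Bhalf : (2 * #|B| <= #|W|)%N.
  by rewrite -(ler_nat R) natrM; move: Bsmall W0' eta1; nra.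
(* The largest size up to [c] that is -1 modulo [m], leaving room for one additional vertex. *)
pose c := #|~: B|; pose j := ((c.+1 %/ m) * m).-1.
have cE := divn_eq c.+1 m; have cm := ltn_pmod c.+1 m0.
have jc : (j <= c)%N by rewrite /j; clear -cE; lia.
have cb := cardsC B; rewrite -/c in cb.
have jS : j.+1 = (c.+1 %/ m * m)%N.
  by rewrite /j prednK // muln_gt0 m0 andbT divn_gt0 //; clear -cb Bhalf Ws; lia.
have [J JB Jj] := subset_card jc.
exists J; split.
- have cc := cardsC J; have : (#|~: J| <= #|B| + m)%N.
    by clear -cc cb cE cm Jj jS; lia.
  rewrite -(ler_nat R) natrD => /le_trans; apply.
  have := s1P #|W| (ltac:(by clear -Ws; lia)); rewrite ler_pdivrMr //.
  by move: Bsmall; lra.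
- by rewrite Jj jS dvdn_mull.
- by move=> w /(subsetP JB); rewrite !inE -leNgt.
Qed.

Section Lattice.
Variables (k m : nat) (S : finType) (F : kgraph k 'I_m) (P : kgraph k S).

Definition in_lattice (x : S -> int) :=
  exists c : {ffun 'I_m -> S} -> int,
  forall v, x v = \sum_(phi in hom_digraph F P) c phi * (multiplicity v phi)%:Z.

Lemma in_lattice_comb (x y : S -> int) (a : int) :
  in_lattice x -> in_lattice y -> in_lattice (fun v => x v + a * y v).
Proof.
move=> [c xc] [e ye]; exists (fun phi => c phi + a * e phi) => v.
rewrite xc ye mulr_sumr -big_split; apply: eq_bigr => phi _ /=.
by rewrite mulrDl mulrA.
Qed.

Lemma in_lattice0 : in_lattice (fun=> 0).
Proof. by exists (fun=> 0) => v; rewrite big1 // => phi _; rewrite mul0r. Qed.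

Lemma in_lattice_ext (x y : S -> int) : x =1 y -> in_lattice x -> in_lattice y.
Proof. by move=> xy [c xc]; exists c => v; rewrite -xy. Qed.

Lemma in_lattice_sum (I : finType) (a : I -> int) (x : I -> S -> int) :
  (forall i, in_lattice (x i)) -> in_lattice (fun v => \sum_i a i * x i v).
Proof.
move=> xL; elim: (index_enum I) => [|i s IH].
  by apply: in_lattice_ext in_lattice0 => v; rewrite big_nil.
apply: in_lattice_ext (in_lattice_comb (a i) IH (xL i)) => v.
by rewrite big_cons addrC.
Qed.

(* The pull-back along [odflt u] duplicates the vertex [u]. *)
Hypothesis dup_Div : forall u : S,
  Div (hom_digraph F (pull (fun o : option S => odflt u o) P)).

Lemma big_optionE (A : nmodType) (f : option S -> A) :
  \sum_o f o = f None + \sum_v f (Some v).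
Proof.
rewrite (bigD1 None) //=; congr (_ + _).
rewrite (reindex_omap Some id) => [|[]//]; apply: eq_bigl => v.
by rewrite eqxx.
Qed.

(** Push the weighting of the duplicated pattern forward to [P]: the unit loads of the two copies of
    [u] add up. *)
Lemma dup_in_lattice (u : S) : in_lattice (fun v => 1 + (v == u)%:Z).
Proof.
have [w wE] := dup_Div u; set H := hom_digraph F _ in wE.
pose pr := ffmap (I := 'I_m) (fun o : option S => odflt u o).
exists (fun phi => \sum_(psi in H | pr psi == phi) w psi) => v.
have prH psi : psi \in H -> pr psi \in hom_digraph F P.
  by rewrite !inE; apply: hom_pull.
transitivity (\sum_(psi in H) w psi * (multiplicity v (pr psi))%:Z).
  rewrite (eq_bigr (fun psi => \sum_(o | odflt u o == v) w psi * (multiplicity o psi)%:Z)).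
    rewrite exchange_big /= (eq_bigr (fun=> 1)) => [|o _]; last exact: wE.
    rewrite big_mkcond /= big_optionE /= addrC eq_sym; congr (_ + _); last by case: eqP.
    by rewrite -big_mkcond big_pred1_eq.
  by move=> psi _; rewrite multiplicity_ffmap -mulr_sumr -natz natr_sum;
     congr (_ * _); apply: eq_bigr => o _; rewrite natz.
rewrite (partition_big pr (mem (hom_digraph F P))) //=.
apply: eq_bigr => phi _; rewrite mulr_suml; apply: eq_bigr => psi /andP[_ /eqP <-].
by [].
Qed.

(* Duplicating [u] shows that the all-ones vector plus [u] lies in the lattice,
   hence so do all differences of unit vectors. *)
Lemma full_lattice (x : S -> int) :
  (m%:Z %| \sum_v x v)%Z -> in_lattice x.
Proof.
have [u0 _|no] := pickP (fun _ : S => true); last first.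
  by move=> _; exists (fun=> 0) => v; have := no v.
move=> /dvdzP[t xt].
have diff u : in_lattice (fun v => (v == u)%:Z - (v == u0)%:Z).
  have := in_lattice_comb (-1) (dup_in_lattice u) (dup_in_lattice u0).
  by apply: in_lattice_ext => v; lra.
have [phi0 phi0H] : exists phi, phi \in hom_digraph F P.
  apply: contrapT => /forallNP H; have [c /(_ u0)] := dup_in_lattice u0.
  by rewrite big1 ?eqxx // => phi /H.
(* The differences move all [m] entries of one homomorphism to [u0]. *)
have mL : in_lattice (fun v => m%:Z * (v == u0)%:Z).
  have phiL : in_lattice (fun v => (multiplicity v phi0)%:Z).
    exists (fun phi => (phi == phi0)%:Z) => v.
    rewrite (bigD1 phi0) //= eqxx mul1r big1 ?addr0 // => phi /andP[_ /negPf ->].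
    by rewrite mul0r.
  have := in_lattice_comb (-1) phiL
    (in_lattice_sum (fun=> 1) (fun a : 'I_m => diff (phi0 a))).
  apply: in_lattice_ext => v.
  rewrite (eq_bigr (fun a : 'I_m => (v == phi0 a)%:Z - (v == u0)%:Z)); last first.
    by move=> a _; rewrite mul1r.
  rewrite sumrB sumr_const card_ord -[_ *+ m]mulr_natl natz.
  suff -> : \sum_a (v == phi0 a)%:Z = (multiplicity v phi0)%:Z.
    by rewrite mulN1r opprB addrCA subrr addr0.
  rewrite /multiplicity -sum1_card -natz natr_sum [RHS]big_mkcond /=.
  by apply: eq_bigr => a _; rewrite inE eq_sym; case: eqP.
(* Moving the whole mass of [x] to [u0] leaves [t * m] there. *)
have := in_lattice_comb t (in_lattice_sum x diff) mL.
apply: in_lattice_ext => v.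
rewrite (eq_bigr (fun u => x u * (v == u)%:Z - x u * (v == u0)%:Z)); last first.
  by move=> u _; rewrite mulrBr.
rewrite sumrB -mulr_suml xt (bigD1 v) //= eqxx big1 ?addr0.
  by rewrite mulr1 -mulrA subrK.
by move=> u /negPf uv; rewrite eq_sym uv mulr0.
Qed.

End Lattice.

End Absorbers.

(** * From integer combinations to absorbers *)

Section AbsorberVector.
Variable R : realType.

Lemma rdeg_restrict k (S W V : finType) (f : S -> W) (h : W -> V) (G : kgraph k.+1 V) x :
  (0 < #|S|)%N -> injective f ->
  rdeg R G h x - k%:R * #|~: (f @: [set: S])|%:R / #|W|%:R <= rdeg R G (h \o f) x.
Proof.
move=> S0 finj; have SW : (#|S| <= #|W|)%N by apply: leq_card finj.
have := @tail_sum_ffmap R 'I_k S W f (fun s => (ted G (ffcons x (ffmap h s)))%:R) finj.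
rewrite sum_avg -/(rdeg R G h x) -mulrBl card_ord card_tuples.
set A := _ - _ => H.
have {}H := H (fun v => ltac:(by case: ted)).
have pw : 0 < #|S|%:R ^+ k :> R by rewrite exprn_gt0 // ltr0n.
have [A0|A0] := leP A 0; first by apply: le_trans A0 _; apply: avg_ge0.
rewrite -(ler_pM2r pw); apply: (@le_trans _ _ (A * #|W|%:R ^+ k)).
  by rewrite ler_wpM2l ?(ltW A0) // lerXn2r ?nnegrE ?ler0n // ler_nat.
apply: le_trans H _; rewrite -card_tuples -sum_avg le_eqVlt; apply/orP; left; apply/eqP.
apply: eq_bigr => s _; congr (nat_of_bool (ted G (ffcons x _)))%:R.
by apply/ffunP => i; rewrite !ffunE.
Qed.

(** A multiset of homomorphisms as a list, the input format of [tile_blowup]. *)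
Definition nseqs (T : Type) (r : seq T) (a : T -> nat) := flatten [seq nseq (a t) t | t <- r].

Lemma sum_nseqs (T : Type) (r : seq T) (a g : T -> nat) :
  (\sum_(t <- nseqs r a) g t = \sum_(t <- r) a t * g t)%N.
Proof.
rewrite /nseqs big_flatten big_map; apply: eq_bigr => t _.
by rewrite big_nseq iter_addn_0 mulnC.
Qed.

Lemma mem_nseqs (T : eqType) (r : seq T) (a : T -> nat) t : t \in nseqs r a -> t \in r.
Proof. by move=> /flatten_mapP[t' t'r]; rewrite mem_nseq => /andP[_ /eqP ->]. Qed.

(* [s0] tiles the absorber alone and [s1] tiles it together with one copy of
   each of the [m] vertices to be absorbed. *)
Definition absorbing (k m : nat) (W : finType) (F : kgraph k 'I_m) (P : kgraph k ('I_m + W)%type)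
    (T : W -> nat) (s0 s1 : seq {ffun 'I_m -> ('I_m + W)%type}) :=
  [/\ {in s0, forall phi, is_hom F P phi}, {in s1, forall phi, is_hom F P phi},
      forall w, (\sum_(phi <- s0) multiplicity (inr w) phi = T w /\
                 \sum_(phi <- s1) multiplicity (inr w) phi = T w)%N
    & forall i, (\sum_(phi <- s0) multiplicity (inl i) phi = 0 /\
                 \sum_(phi <- s1) multiplicity (inl i) phi = 1)%N].

(* Here [None] is a vertex to be absorbed and [x v] counts the occurrences of [v]
   in the homomorphisms [e i]; adding [N] copies of every homomorphism makes the
   integer combination representing [x] nonnegative. *)
Lemma lattice_absorbing k m (W S : finType) (F : kgraph k 'I_m) (P : kgraph k ('I_m + W)%type)
    (f : S -> W) (e : 'I_m -> {ffun 'I_m -> option S}) :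
  (forall x : S -> int, (m%:Z %| \sum_v x v)%Z -> in_lattice F (pull f (pull inr P)) x) ->
  (forall i, multiplicity None (e i) = 1%N) ->
  (forall i, is_hom F P
    (ffmap (fun o => if o is Some a then inr (f a) else inl i) (e i))) ->
  exists T s0 s1, absorbing F P T s0 s1.
Proof.
move=> lat e1 eP.
pose x v := (\sum_i multiplicity (Some v) (e i))%N.
(* Each [e i] has [m - 1] entries other than [None], so the coordinate sum of [x] is
   [m * (m - 1)]. *)
have [|c cE] := lat (fun v => (x v)%:Z).
  apply/dvdzP; exists (m.-1)%:Z.
  rewrite -(big_morph Posz PoszD (erefl _)) -PoszM; congr Posz.
  rewrite exchange_big /= (eq_bigr (fun=> m.-1)) ?sum_nat_const ?card_ord 1?mulnC // => i _.
  have : (multiplicity None (e i) + \sum_v multiplicity (Some v) (e i) = m)%N.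
    by rewrite -[RHS](sum_multiplicity (e i)) big_optionE.
  by rewrite e1 => /(congr1 predn).
pose H := hom_digraph F (pull f (pull inr P)).
(* Dominates every [|c phi|], so that [N + c phi] is a natural number. *)
pose N := (\sum_(phi in H) `|c phi|)%N.
pose up := ffmap (I := 'I_m) (fun v : S => inr (f v) : ('I_m + W)%type).
pose a0 phi := absz (N%:Z + c phi).
pose s0 := map up (nseqs (enum H) a0).
pose s1 := [seq ffmap (fun o => if o is Some a then inr (f a) else inl i) (e i) | i <- enum 'I_m]
   ++ map up (nseqs (enum H) (fun=> N)).
have a0E phi : phi \in H -> (a0 phi)%:Z = N%:Z + c phi.
  move=> phiH; rewrite /a0 gez0_abs //.
  have : (`|c phi| <= N)%N by rewrite /N (bigD1 phi) //= leq_addr.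
  by clear; lia.
(* The loads of [s0] and [s1] on sampled vertices agree: [x] is represented by [c] on one side and
   by the [e i] on the other. *)
have key v : (\sum_(phi in H) a0 phi * multiplicity v phi =
    x v + \sum_(phi in H) N * multiplicity v phi)%N.
  apply/eqP; rewrite -eqz_nat PoszD cE !(big_morph Posz PoszD (erefl _)) -big_split /=.
  apply/eqP/eq_bigr => phi phiH; rewrite !PoszM a0E // mulrDl addrC //.
have upE (a : {ffun 'I_m -> S} -> nat) z :
    (\sum_(phi <- map up (nseqs (enum H) a)) multiplicity z phi =
     \sum_(v | inr (f v) == z) \sum_(phi in H) a phi * multiplicity v phi)%N.
  rewrite big_map sum_nseqs big_enum /= exchange_big /=; apply: eq_bigr => phi _.
  by rewrite multiplicity_ffmap big_distrr.
have s1E z : (\sum_(phi <- s1) multiplicity z phi =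
    \sum_i multiplicity z (ffmap (fun o => if o is Some a then inr (f a) else inl i) (e i)) +
    \sum_(v | inr (f v) == z) \sum_(phi in H) N * multiplicity v phi)%N.
  by rewrite big_cat /= upE big_map big_enum.
exists (fun w => \sum_(phi <- s0) multiplicity (inr w) phi)%N, s0, s1; split.
- move=> _ /mapP[phi /mem_nseqs + ->]; rewrite mem_enum inE => hphi.
  by have := hom_pull (hom_pull hphi); congr (is_hom F P _); apply/ffunP => i; rewrite !ffunE.
- move=> phi; rewrite mem_cat => /orP[/mapP[i _ ->]|]; first exact: eP.
  move=> /mapP[psi /mem_nseqs + ->]; rewrite mem_enum inE => hpsi.
  by have := hom_pull (hom_pull hpsi); congr (is_hom F P _); apply/ffunP => i; rewrite !ffunE.
- move=> w; split=> //; rewrite s1E upE [RHS](eq_bigr _ (fun v _ => key v)) [RHS]big_split /=.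
  congr addn; rewrite exchange_big /=; apply: eq_bigr => i _.
  by rewrite multiplicity_ffmap big_mkcond /= big_optionE /= add0r [RHS]big_mkcond.
- move=> i; have E0 (g : S -> nat) : (\sum_(v | inr (f v) == inl i :> ('I_m + W)%type) g v = 0)%N.
    exact: big_pred0.
  rewrite s1E upE !E0 addn0; split=> //.
  rewrite (bigD1 i) //= big1 ?addn0 => [|j ji];
    rewrite multiplicity_ffmap big_mkcond big_optionE /=.
    by rewrite eqxx e1 big1.
  by case: eqP => [[ji']|_]; [rewrite ji' eqxx in ji|rewrite big1].
Qed.

Lemma ffmap_comp (I A B C : finType) (f : A -> B) (g : B -> C) (h : A -> C) (v : {ffun I -> A}) :
  (forall a, g (f a) = h a) -> ffmap g (ffmap f v) = ffmap h v.
Proof. by move=> gf; apply/ffunP => i; rewrite !ffunE. Qed.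

Lemma ffmap_id (I A : finType) (h : A -> A) (v : {ffun I -> A}) :
  (forall a, h a = a) -> ffmap h v = v.
Proof. by move=> hE; apply/ffunP => i; rewrite !ffunE. Qed.

(** Shared by both uses of an additional vertex. Few tuples contain it, so density survives;
    renormalisation costs degrees at most a factor [2 ^+ k]. *)
Lemma add_vertex k (S : finType) (G : kgraph k.+1 S) (Q : kgraph k.+1 (option S))
    (eps eps' d mu : R) :
  (0 < #|S|)%N -> 0 <= eps -> 0 <= d <= 1 -> 0 <= mu ->
  (forall v, ted Q (ffmap Some v) = ted G v) ->
  eps + k.+1%:R / #|S|.+1%:R <= eps' ->
  UniDen eps d G -> (forall a, mu <= tdeg R G a) -> mu <= rdeg R Q Some None ->
  UniDen eps' d Q /\ MinDeg1 (mu / 2 ^+ k) Q.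
Proof.
move=> S0 e0 d01 mu0 QG ee GU Gd QN.
have sinj : injective (@Some S) by move=> ? ? [].
have coS : #|~: (Some @: [set: S])| = 1%N by rewrite card_coimage // card_option subSnn.
split.
  have := @UniDen_extend R k.+1 S (option S) Some Q eps d sinj e0 d01.
  rewrite coS card_option mulr1 => H; apply: UniDen_le (H _) => //.
  by apply: UniDen_ext GU => v; rewrite ted_pull QG.
apply: tdeg_MinDeg => [|o]; first by rewrite divr_ge0 ?exprn_ge0.
rewrite ler_pdivrMr ?exprn_gt0 // mulrC; apply: le_trans (tdeg_extend R Q o sinj _); last first.
  by rewrite card_option mul2n -addnn -addn1 leq_add2l.
case: o => [a|//]; apply: le_trans (Gd a) _; rewrite le_eqVlt; apply/orP; left; apply/eqP.
by apply: eq_avg => s; rewrite -QG ffmap_cons.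
Qed.

(** The sample is cut down to a core of high degree whose order is -1 modulo [m]. Duplicating a core
    vertex produces an input for [Div], adding a vertex to be absorbed one for [Cov]. *)
Theorem absorber_vector k m (F : kgraph k.+1 'I_m) (d mu : R) :
  (0 < m)%N -> F_Div R k.+1 m F -> F_Cov R k.+1 m F -> 0 < d <= 1 -> 0 < mu ->
  exists2 eps : R, 0 < eps & exists s0 : nat,
  forall (W : finType) (P : kgraph k.+1 ('I_m + W)%type), (s0 <= #|W|)%N ->
  UniDen eps d (pull inr P) -> (forall i, mu <= rdeg R P inr (inl i)) ->
  exists T s0 s1, absorbing F P T s0 s1.
Proof.
move=> m0 FD FC /andP[d0 d1] mup.
(* One threshold for both sources of degree: [mu] for the vertices to be absorbed, [d / 2] inside
   the core. *)
pose mu0 := Num.min mu (d / 2); have mu00 : 0 < mu0 by rewrite lt_min mup divr_gt0.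
have mu0mu : mu0 <= mu by rewrite ge_min lexx.
have mu0d : mu0 <= d / 2 by rewrite ge_min lexx orbT.
(* Deleting an [eta] fraction of the sample lowers degrees by at most [k * eta <= mu0 / 2]. *)
pose eta := mu0 / (2 * k.+1%:R).
have k1 : 1 <= k.+1%:R :> R by rewrite ler1n.
have eta0 : 0 < eta by rewrite divr_gt0 // mulr_gt0 // ltr0n.
have etaE : eta * (2 * k.+1%:R) = mu0 by rewrite divfK // mulf_neq0 // pnatr_eq0.
have eta14 : eta <= 1 / 4 by move: etaE mu0d k1 eta0 d1; clear; nra.
have etak : k%:R * eta <= mu0 / 2.
  by move: etaE; rewrite -(natr1 k) => <-; move: eta0; clear; lra.
pose mu1 := mu0 / 2 / 2 ^+ k.
have mu10 : 0 < mu1 by rewrite !divr_gt0 ?exprn_gt0.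
have [epsD epsD0 [nD nDP]] := FD d mu1 d0 mu10.
have [epsC epsC0 [nC nCP]] := FC d mu1 d0 mu10.
have [epsJ epsJ0 [sJ sJP]] := high_degree_core k m0 d0 (ltac:(by apply/andP; split;
  [exact: eta0|lra]) : 0 < eta <= 1).
pose e := Num.min epsD epsC; have e0 : 0 < e by rewrite lt_min epsD0.
pose eps := Num.min epsJ (e / (2 * 2 ^+ k.+1)).
have eps0 : 0 < eps by rewrite lt_min epsJ0 divr_gt0 // mulr_gt0 ?exprn_gt0.
have epse : 2 ^+ k.+1 * eps <= e / 2.
  have pk : 0 < 2 ^+ k.+1 :> R by rewrite exprn_gt0.
  have : eps <= e / (2 * 2 ^+ k.+1) by rewrite ge_min lexx orbT.
  by rewrite ler_pdivlMr ?mulr_gt0 //; clear; lra.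
have [s1 s1P] := le_div_nat k.+1%:R (ltac:(by rewrite divr_gt0) : 0 < e / 2).
exists eps => //; exists (sJ + 2 * (s1 + nD + nC + 1))%N => W P Ws PU Pd.
have epsJle : eps <= epsJ by rewrite ge_min lexx.
have sJW : (sJ <= #|W|)%N by clear -Ws; lia.
have [J [Jc Jm Jd]] := sJP W (pull inr P) sJW (UniDen_le epsJle (lexx d) PU).
have W0 : (0 < #|W|)%N by clear -Ws; lia.
have W0' : 0 < #|W|%:R :> R by rewrite ltr0n.
have JW : (#|W| <= 2 * #|J|)%N.
  have : (2 * #|~: J| <= #|W|)%N.
    by rewrite -(ler_nat R) natrM; move: Jc W0' eta14; clear; nra.
  by have := cardsC J; clear; lia.
pose S : finType := 'I_#|J|; pose f : S -> W := enum_val.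
have finj : injective f by apply: enum_val_inj.
have fJ a : f a \in J by apply: enum_valP.
have SJ : #|S| = #|J| by rewrite card_ord.
have S0 : (0 < #|S|)%N by rewrite SJ; clear -JW W0; lia.
have cof : k%:R * #|~: (f @: [set: S])|%:R / #|W|%:R <= mu0 / 2.
  rewrite (_ : #|~: (f @: [set: S])| = #|~: J|); last first.
    by rewrite card_coimage // SJ -(cardsC J) addKn.
  apply: le_trans etak; rewrite -mulrA ler_wpM2l // ler_pdivrMr //.
pose G := pull f (pull inr P).
have GU : UniDen (2 ^+ k.+1 * eps) d G.
  by apply: UniDen_restrict => //; rewrite ?SJ // ltW.
have Gd a : mu0 / 2 <= tdeg R G a.
  by apply: (le_trans _ (tdeg_restrict _ _ a finj)); move: (Jd _ (fJ a)) cof mu0d; clear; lra.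
have epsS : 2 ^+ k.+1 * eps + k.+1%:R / #|S|.+1%:R <= e.
  have := s1P #|S|.+1 (ltac:(by rewrite SJ; clear -JW Ws; lia)).
  by move=> H; apply: le_trans (lerD epse H) _; rewrite -splitr.
have common (Q : kgraph k.+1 (option S)) : (forall v, ted Q (ffmap Some v) = ted G v) ->
    mu0 / 2 <= rdeg R Q Some None -> UniDen e d Q /\ MinDeg1 mu1 Q.
  move=> QG QN; apply: (@add_vertex k S G Q (2 ^+ k.+1 * eps) e d (mu0 / 2)) => //.
  - by rewrite mulr_ge0 ?exprn_ge0 // ltW.
  - by rewrite ltW.
  - by rewrite ltW // divr_gt0.
have oS : #|{: option S}| = #|J|.+1 by rewrite card_option SJ.
have lat : forall x : S -> int, (m%:Z %| \sum_v x v)%Z -> in_lattice F G x.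
  apply: full_lattice => u; set Q := pull _ _.
  have [|| QU QM] := common Q.
  - move=> v; rewrite ted_pull; congr (ted G _).
    by rewrite (ffmap_comp (h := id)) // ffmap_id.
  - apply: le_trans (Gd u) _; rewrite le_eqVlt; apply/orP; left; apply/eqP.
    apply: eq_avg => s; rewrite [in RHS]ted_pull ffmap_cons; congr (nat_of_bool (ted G _))%:R.
    by rewrite (ffmap_comp (h := id)) // ffmap_id.
  apply: (nDP #|J|.+1) => //; first by clear -JW Ws; lia.
  by split=> //; apply: UniDen_le QU => //; rewrite ge_min lexx.
have cov i : exists2 e : {ffun 'I_m -> option S}, multiplicity None e = 1%N &
    is_hom F P (ffmap (fun o => if o is Some a then inr (f a) else inl i) e).
  pose g o : ('I_m + W)%type := if o is Some a then inr (f a) else inl i.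
  have [|| QU QM] := common (pull g P).
  - move=> v; rewrite !ted_pull; congr (ted P _).
    by rewrite (ffmap_comp (h := inr \o f)) // (ffmap_comp (h := inr \o f)).
  - have := rdeg_restrict inr P (inl i) S0 finj.
    move: (Pd i) cof mu0mu; set A := rdeg R P inr _; set B := rdeg R P _ _; set C := _ / _.
    have -> : rdeg R (pull g P) Some None = B.
      apply: eq_avg => s; rewrite ted_pull ffmap_cons;
        congr (nat_of_bool (ted P (ffcons _ _)))%:R.
      by rewrite (ffmap_comp (h := inr \o f)).
    by clear; lra.
  have [||e' e'H e'1] := nCP #|J|.+1 _ Jm _ (pull g P) oS _ None.
  - by clear -JW Ws; lia.
  - by split=> //; apply: UniDen_le QU => //; rewrite ge_min lexx orbT.
  by exists e' => //; apply: hom_pull; rewrite inE in e'H.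
have [e' e'1 e'P] := fin_all_exists2 cov.
exact: (lattice_absorbing lat e'1 e'P).
Qed.

End AbsorberVector.

(** * Random patterns *)

Section Patterns.
Variable R : realType.

Definition blk (Y : finType) r q (w : (Y + 'I_r * 'I_q)%type) : (Y + 'I_r)%type :=
  match w with inl y => inl y | inr p => inr p.1 end.

Definition place (V N Y : finType) r q (x : Y -> V) (beta : N -> 'I_q -> V)
    (tau : 'I_r -> N) (w : (Y + 'I_r * 'I_q)%type) : V :=
  match w with inl y => x y | inr p => beta (tau p.1) p.2 end.

(* The pattern induced on fixed vertices and sampled blocks; edges meeting a
   block twice are discarded, so that blocks can be replaced independently. *)
Definition pat k (V N Y : finType) r q (x : Y -> V) (beta : N -> 'I_q -> V)
    (tau : 'I_r -> N) (G : kgraph k V) : kgraph k (Y + 'I_r * 'I_q)%type :=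
  block_pull (@blk Y r q) (place x beta tau) G.

Definition ffpair (I A B : finType) (p : {ffun I -> A} * {ffun I -> B}) : {ffun I -> A * B} :=
  [ffun i => (p.1 i, p.2 i)].

Lemma ffpair_bij (I A B : finType) : bijective (@ffpair I A B).
Proof.
exists (fun v : {ffun I -> A * B} => (ffmap fst v, ffmap snd v)) => [[a b]|v].
  by congr pair; apply/ffunP => i; rewrite !ffunE.
by apply/ffunP => i; rewrite !ffunE -surjective_pairing.
Qed.

Lemma sum_ffpair (I A B : finType) (g : {ffun I -> A * B} -> R) :
  \sum_v g v = \sum_(b : {ffun I -> B}) \sum_(a : {ffun I -> A}) g (ffpair (a, b)).
Proof.
rewrite exchange_big pair_bigA /= (reindex (@ffpair I A B)) /=.
  by apply: eq_bigr => -[].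
exact/onW_bij/ffpair_bij.
Qed.

Definition spread k (V N : finType) q (beta : N -> 'I_q -> V) (a : {ffun 'I_k -> 'I_q})
    (s : {ffun 'I_k -> N}) : {ffun 'I_k -> V} := [ffun i => beta (s i) (a i)].

(** With the positions [a] fixed, different block tuples give different vertex tuples, so boxes of
    blocks inherit the bound for boxes of vertices. The factor [(2 * q) ^+ k] renormalises from
    [|V|] to [|N|]. *)
Lemma disc_spread k (V N : finType) q (beta : N -> 'I_q -> V) (a : {ffun 'I_k -> 'I_q})
    (G : kgraph k V) (eps d : R) (X : {ffun 'I_k -> {set N}}) :
  (forall i, injective (beta^~ i)) -> (0 < #|N|)%N -> (#|V| <= 2 * (q * #|N|))%N ->
  0 <= eps -> UniDen eps d G ->
  disc X (fun s => d - (ted G (spread beta a s))%:R) <= eps * (2 * q%:R) ^+ k.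
Proof.
move=> binj N0 VN e0 /UniDenE/(_ (fun i => beta^~ (a i) @: X i)) H.
have Nk : 0 < #|N|%:R ^+ k :> R by rewrite exprn_gt0 // ltr0n.
have sinj : injective (@spread k V N q beta a).
  move=> s s' /ffunP E; apply/ffunP => i; have := E i; rewrite !ffunE.
  exact: binj.
rewrite -(ler_pM2r Nk) -{1}card_tuples /disc -sum_avg -mulrA -exprMn.
apply: (@le_trans _ _ (eps * #|V|%:R ^+ k)); last first.
  rewrite ler_wpM2l // lerXn2r ?nnegrE ?mulr_ge0 ?ler0n //.
  by rewrite -mulrA -!natrM ler_nat.
apply: le_trans H; rewrite /dsum (bigID (mem (spread beta a @: [set: {ffun 'I_k -> N}]))) /=.
rewrite [X in _ <= _ + X]big1 ?addr0; last first.
  move=> v vN; suff -> : inX (fun i => beta^~ (a i) @: X i) v = false by rewrite mul0r.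
  apply: contraNF vN => /forallP vX; apply/imsetP.
  have ex i : exists n, beta n (a i) == v i.
    by have /imsetP[n _ ->] := vX i; exists n.
  exists [ffun i => xchoose (ex i)]; first by rewrite inE.
  by apply/ffunP => i; rewrite !ffunE (eqP (xchooseP (ex i))).
rewrite big_imset /=; last by move=> ? ? _ _; apply: sinj.
rewrite [leRHS](eq_bigl predT); last by move=> s; rewrite inE.
rewrite le_eqVlt; apply/orP; left; apply/eqP; apply: eq_bigr => s _.
congr ((nat_of_bool _)%:R * _); apply: eq_forallb => i.
by rewrite ffunE mem_imset.
Qed.

(** Sorting tuples by their positions [a] inside the blocks splits the pattern into [q ^ k] sampled
    relations. Only tuples repeating a block are lost, a fraction of at most [k ^ 2 / r]. *)
Lemma pat_disc k (V N Y : finType) r q (x : Y -> V) (beta : N -> 'I_q -> V)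
    (tau : {ffun 'I_r -> N}) (G : kgraph k V) (d c : R)
    (X : 'I_k -> {set 'I_r * 'I_q}) :
  0 <= d <= 1 ->
  dsum X (fun v => d - (ted (pull inr (pat x beta tau G)) v)%:R) <=
  ((q%:R ^+ k) * (c + (k ^ 2)%:R / r%:R) +
   \sum_(a : {ffun 'I_k -> 'I_q}) excess (fun s => d - (ted G (spread beta a s))%:R) c tau)
  * r%:R ^+ k.
Proof.
move=> /andP[d0 d1].
pose f (a : {ffun 'I_k -> 'I_q}) s : R := d - (ted G (spread beta a s))%:R.
apply: (@le_trans _ _ (\sum_(a : {ffun 'I_k -> 'I_q}) (c + excess (f a) c tau
    + (k ^ 2)%:R / r%:R) * r%:R ^+ k)); last first.
  rewrite -mulr_suml; apply: ler_wpM2r; first by rewrite exprn_ge0.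
  rewrite !big_split /= !sumr_const card_ffun !card_ord.
  rewrite -[c *+ _]mulr_natl -[_ / _ *+ _]mulr_natl !natrX mulrDr.
  by rewrite /f addrAC.
rewrite /dsum sum_ffpair; apply: ler_sum => a _.
pose Xa : {ffun 'I_k -> {set 'I_r}} := [ffun i => [set j | (j, a i) \in X i]].
have := disc_excess (f a) c tau Xa; have := avg_noninj R 'I_k 'I_r.
rewrite !card_ord /disc => H1 H2.
apply: (@le_trans _ _ ((avg (fun v : {ffun 'I_k -> 'I_r} => (inX Xa v)%:R * f a (ffmap tau v)) +
  avg (fun v : {ffun 'I_k -> 'I_r} => (~~ injectiveb v)%:R)) * r%:R ^+ k)); last first.
  by apply: ler_wpM2r; [rewrite exprn_ge0|lra].
have := @card_tuples R k 'I_r; rewrite card_ord => <-.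
rewrite mulrDl -!sum_avg -big_split /=; apply: ler_sum => v _.
have -> : inX X (ffpair (v, a)) = inX Xa v.
  by apply: eq_forallb => i; rewrite !ffunE inE.
rewrite ted_pull ted_block.
have -> : injectiveb (ffmap (@blk Y r q) (ffmap inr (ffpair (v, a)))) = injectiveb v.
  apply/injectiveP/injectiveP => inj i j.
    by move=> vij; apply: inj; rewrite !ffunE /= vij.
  by rewrite !ffunE /= => -[/inj].
have -> : ffmap (place x beta tau) (ffmap inr (ffpair (v, a))) = spread beta a (ffmap tau v).
  by apply/ffunP => i; rewrite !ffunE.
rewrite /f; case: injectiveb; case: ted; case: inX => /=; lra.
Qed.

(** [sampling] bounds the expected excess for each position vector, and Markov's inequality treats
    their sum. It matters that [eps] is chosen before [r]. *)
Theorem sample_UniDen k q (d eps' delta : R) :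
  (0 < q)%N -> 0 <= d <= 1 -> 0 < eps' -> 0 < delta ->
  exists2 eps : R, 0 < eps & exists r0 : nat,
  forall r (V N Y : finType) (x : Y -> V) (beta : N -> 'I_q -> V) (G : kgraph k V),
  (r0 <= r)%N -> (forall i, injective (beta^~ i)) -> (0 < #|N|)%N ->
  (#|V| <= 2 * (q * #|N|))%N -> UniDen eps d G ->
  1 - delta <= avg (fun tau : {ffun 'I_r -> N} =>
    (`[< UniDen eps' d (pull inr (pat x beta tau G)) >])%:R).
Proof.
move=> q0 d01 e'0 dl0.
have q0' : 0 < q%:R :> R by rewrite ltr0n.
have q2k : 0 < (2 * q%:R) ^+ k :> R by rewrite exprn_gt0 // mulr_gt0.
have qk : 1 <= q%:R ^+ k :> R by rewrite exprn_ege1 // ler1n.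
pose eps := eps' / 3 / (2 * q%:R) ^+ k; have e0 : 0 < eps by rewrite !divr_gt0.
(* Summed over [q ^ k] position vectors the expected excess is at most [delta * c], so Markov's
   inequality at level [c = eps' / 3] fails with probability at most [delta]. *)
pose dl1 := delta * (eps' / 3) / q%:R ^+ k.
have dl10 : 0 < dl1 by rewrite !(divr_gt0, mulr_gt0) // exprn_gt0.
have [r1 r1P] := sampling k dl10.
have [r2 r2P] := le_div_nat (k ^ 2)%:R (ltac:(by rewrite divr_gt0) : 0 < eps' / 3).
exists eps => //; exists (r1 + r2)%N => r V N Y x beta G rr binj N0 VN GU.
pose f (a : {ffun 'I_k -> 'I_q}) s : R := d - (ted G (spread beta a s))%:R.
pose c := eps' / 3; have c0 : 0 < c by rewrite divr_gt0.
pose tot (tau : {ffun 'I_r -> N}) := \sum_a excess (f a) c tau.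
have tot0 tau : 0 <= tot tau by apply: sumr_ge0 => a _; apply: excess_ge0.
have avtot : avg tot <= delta * c.
  rewrite avg_sum; apply: (@le_trans _ _ (\sum_(a : {ffun 'I_k -> 'I_q}) dl1)).
    apply: ler_sum => a _; apply: r1P => //.
    - by rewrite card_ord; clear -rr; lia.
    - by move=> v; rewrite /f ler_norml; case/andP: d01 => d0 d1; case: ted => /=; lra.
    - move=> X; apply: le_trans (disc_spread a X binj N0 VN (ltW e0) GU) _.
      by rewrite /eps divfK // lt0r_neq0.
  rewrite sumr_const card_ffun !card_ord -[X in X <= _]mulr_natl natrX.
  by rewrite /dl1 mulrCA divff ?mulr1 // lt0r_neq0 // (lt_le_trans ltr01).
have := markov tot0 c0.
have T0 : (0 < #|{ffun 'I_r -> N}|)%N by rewrite card_ffun expn_gt0 N0.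
have : avg tot / c <= delta by rewrite ler_pdivrMr.
set A := avg (fun t => (c <= tot t)%R%:R) => H1 H2.
apply: (@le_trans _ _ (1 - A)); first by lra.
rewrite -[X in X - _](avg_const (1 : R) T0) /A -avgB; apply: le_avg => tau.
case: (leP c (tot tau)) => [_|tc] /=; first by rewrite subrr ler0n.
suff -> : `[< UniDen eps' d (pull inr (pat x beta tau G)) >] by rewrite subr0.
apply/asboolP/UniDenE => X; apply: le_trans (pat_disc x beta tau G c X d01) _.
rewrite card_prod !card_ord natrM exprMn [r%:R ^+ k * _]mulrC mulrA.
apply: ler_wpM2r; first by rewrite exprn_ge0.
have := r2P r (ltac:(by clear -rr; lia)); rewrite -/c => rc.
have H3 : q%:R ^+ k * (c + (k ^ 2)%:R / r%:R) <= q%:R ^+ k * (2 * c).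
  by apply: ler_wpM2l; [rewrite exprn_ge0|clear -rc; lra].
have H4 : c <= q%:R ^+ k * c by rewrite -[leLHS]mul1r ler_wpM2r // ltW.
have -> : eps' * q%:R ^+ k = q%:R ^+ k * (2 * c) + q%:R ^+ k * c.
  by rewrite -mulrDr mulrC /c; congr (_ * _); clear; lra.
by apply: lerD => //; apply: ltW; apply: lt_le_trans tc _.
Qed.

(** The link density of one fixed vertex is an average over [k] variables, so [poly_lln] and
    Markov's inequality suffice. Repeated indices are subtracted, since [pat] drops edges meeting a
    block twice. *)
Theorem sample_rdeg k (mu delta : R) : 0 < mu -> 0 < delta ->
  exists r0 : nat,
  forall r (V Y : finType) (x : Y -> V) (G : kgraph k.+1 V) y,
  (r0 <= r)%N -> mu <= tdeg R G (x y) ->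
  1 - delta <= avg (fun tau : {ffun 'I_r -> V} =>
    (mu / 2 <= rdeg R (pat x (fun v (_ : 'I_1) => v) tau G) inr (inl y))%R%:R).
Proof.
move=> mu0 dl0; pose t := delta * mu / (8 * k.+1%:R).
have k1 : 0 < k.+1%:R :> R by rewrite ltr0n.
have t0 : 0 < t by rewrite divr_gt0 ?mulr_gt0.
have [r1 r1P] := exists_nat_ge (4 / t ^+ 2).
have [r2 r2P] := le_div_nat (2 * k%:R) t0.
have [r3 r3P] := le_div_nat (k ^ 2)%:R (ltac:(by rewrite divr_gt0) : 0 < mu / 4).
exists (r1 + r2 + r3).+1 => r V Y x G y rr Gd.
have [b1 b2 b3 b4] : [/\ r1 <= r, r2 <= r, r3 <= r & 0 < r]%N by clear -rr; split; lia.
have V0 : (0 < #|V|)%N by apply/card_gt0P; exists (x y).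
have T0 : (0 < #|{ffun 'I_r -> V}|)%N by rewrite card_ffun expn_gt0 V0.
pose f (s : {ffun 'I_k -> V}) : R := (ted G (ffcons (x y) s))%:R.
have f1 s : `|f s| <= 1 by rewrite /f; case: ted; rewrite ?normr1 ?normr0.
have tr : 4 <= t ^+ 2 * #|'I_r|%:R.
  rewrite card_ord mulrC -ler_pdivrMr ?exprn_gt0 //; apply: le_trans r1P _.
  by rewrite ler_nat.
have := poly_lln V0 (ltac:(by rewrite card_ord) : (0 < #|'I_r|)%N) f1 t0 tr.
rewrite card_ord -/(tdeg R G (x y)).
set E := avg _ => HE.
have HE' : E <= delta * (mu / 4).
  apply: le_trans HE _; have := r2P r b2; rewrite -mulrA => H.
  apply: (@le_trans _ _ (k.+1%:R * (t + t))).
    apply: ler_pM => //; last by rewrite lerD2l.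
    - by apply: addr_ge0; [exact: ltW|rewrite !mulr_ge0 ?invr_ge0 ?ler0n].
    - by rewrite ler_nat.
  have : t * (8 * k.+1%:R) = delta * mu by rewrite divfK // mulf_neq0 // lt0r_neq0.
  by clear; lra.
have mu40 : 0 < mu / 4 by rewrite divr_gt0.
have := markov (F := fun s : {ffun 'I_r -> V} =>
  `|avg (fun j : {ffun 'I_k -> 'I_r} => f (ffmap s j)) - tdeg R G (x y)|) (fun=> normr_ge0 _)
    mu40.
set A := avg _; rewrite -/E => HA.
have A1 : A <= delta by apply: le_trans HA _; rewrite ler_pdivrMr.
apply: (@le_trans _ _ (1 - A)); first by lra.
rewrite -[X in X - _](avg_const (1 : R) T0) /A -avgB; apply: le_avg => tau.
case: (leP (mu / 4) `|avg (fun j : {ffun 'I_k -> 'I_r} => f (ffmap tau j)) - tdeg R G (x y)|)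
  => [_|bad] /=; first by rewrite subrr ler0n.
suff -> : mu / 2 <= rdeg R (pat x (fun v (_ : 'I_1) => v) tau G) inr (inl y) by rewrite subr0.
have B : avg (fun j : {ffun 'I_k -> 'I_r} => f (ffmap tau j)) -
    avg (fun j : {ffun 'I_k -> 'I_r} => (~~ injectiveb j)%:R) <=
    rdeg R (pat x (fun v (_ : 'I_1) => v) tau G) inr (inl y).
  rewrite -avgB /rdeg -(avg_bij (h := fun j : {ffun 'I_k -> 'I_r} =>
    [ffun i => (j i, ord0 : 'I_1)])).
    apply: le_avg => j; rewrite /= ted_block.
    have -> : ffmap (place x (fun v _ => v) tau) (ffcons (inl y)
       (ffmap inr [ffun i => (j i, ord0 : 'I_1)])) = ffcons (x y) (ffmap tau j).
      by rewrite ffmap_cons; congr ffcons; apply/ffunP => i; rewrite !ffunE.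
    rewrite -/(f (ffmap tau j)); case: (injectiveP j) => [jinj|_] /=.
      suff -> : injectiveb (ffmap (@blk Y r 1) (ffcons (inl y)
        (ffmap inr [ffun i => (j i, ord0)]))) by rewrite subr0.
      apply/injectiveP => a b; rewrite ffmap_cons.
      case: (unliftP ord0 a) => [a'|] ->; case: (unliftP ord0 b) => [b'|] -> //;
        rewrite ?ffconsS ?ffcons0 ?ffunE //= => -[/jinj ->] //.
    apply: (@le_trans _ _ 0); last by rewrite ler0n.
    by rewrite /f subr_le0; case: ted; rewrite ?ler01.
  exists (fun v : {ffun 'I_k -> 'I_r * 'I_1} => ffmap fst v) => [j|v].
    by apply/ffunP => i; rewrite !ffunE.
  by apply/ffunP => i; rewrite !ffunE; case: (v i) => a b; congr pair; rewrite /= (ord1 b).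
have C := avg_noninj R 'I_k 'I_r; rewrite !card_ord in C; have := r3P r b3.
have := ler_norm (tdeg R G (x y) - avg (fun j : {ffun 'I_k -> 'I_r} => f (ffmap tau j))).
rewrite distrC; move: bad B C Gd; clear; lra.
Qed.

End Patterns.

(** * A positive proportion of random sets absorb a given tuple *)

Section AbsorberDensity.
Variable R : realType.

(** [lift_hom] supplies the hypothesis of [tile_blowup]: a sampled vertex may be replaced by any
    entry of its row of the array, a fixed vertex only by itself. *)
Lemma tile_pattern k m (F : kgraph k 'I_m) (V N Y : finType) r q b (x : Y -> V)
    (beta : N -> 'I_q -> V) (xi : {ffun 'I_r -> {ffun 'I_b -> N}}) (G : kgraph k V)
    (P : kgraph k (Y + 'I_r * 'I_q)%type) (C : (Y + 'I_r * 'I_q)%type -> {set V}) s :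
  (0 < k)%N -> (0 < m)%N -> (0 < b)%N ->
  (forall g : {ffun 'I_r -> 'I_b},
     edges (pat x beta [ffun i => xi i (g i)] G) = edges P) ->
  (forall y v, v \in C (inl y) -> v = x y) ->
  (forall w v, v \in C (inr w) -> exists j, v = beta (xi w.1 j) w.2) ->
  (forall w w', w != w' -> [disjoint C w & C w']) ->
  {in s, forall phi, is_hom F P phi} ->
  (forall w, #|C w| = \sum_(phi <- s) multiplicity w phi)%N ->
  tileable F G (\bigcup_w C w).
Proof.
move=> k0 m0 b0 EP Cl Cr dC sP cC; apply: tile_blowup dC _ cC => // phi /sP hphi psi psiC.
pose sig (g : {ffun (Y + 'I_r)%type -> 'I_b}) := place x beta (fun i => xi i (g (inr i))).
(* A fixed vertex puts no condition on [g], so any index serves; a sampled one remembers its index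
   in the row. *)
have ex a : exists j : 'I_b, forall g : {ffun (Y + 'I_r)%type -> 'I_b},
    g (blk (phi a)) = j -> psi a = sig g (phi a).
  have := psiC a; case: (phi a) => [y /Cl ->|w /Cr[j ->]]; first by exists (Ordinal b0).
  by exists j => g /= ->.
have [c cP] := fin_all_exists ex.
apply: (lift_hom (E := P) (p := @blk Y r q) (sig := sig) (phi := phi) (c := c)) => // g.
rewrite -(EP [ffun i => g (inr i)]); apply/setP => e; rewrite !inE.
rewrite (@eq_imset _ _ _ (sig g)) // => -[y|w] //=.
by rewrite !ffunE.
Qed.

Definition cells (V N : finType) r q b (beta : N -> 'I_q -> V)
    (xi : {ffun 'I_r -> {ffun 'I_b -> N}}) (T : 'I_r * 'I_q -> nat) (w : 'I_r * 'I_q) :=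
  [set beta (xi w.1 j) w.2 | j : 'I_b & (j < T w)%N].

Lemma cellsP (V N : finType) r q b (beta : N -> 'I_q -> V)
    (xi : {ffun 'I_r -> {ffun 'I_b -> N}}) T w v :
  v \in cells beta xi T w -> exists j, v = beta (xi w.1 j) w.2.
Proof. by case/imsetP => j _ ->; exists j. Qed.

Lemma cells_disjoint (V N : finType) r q b (beta : N -> 'I_q -> V)
    (xi : {ffun 'I_r -> {ffun 'I_b -> N}}) T w w' :
  injective (fun p => beta p.1 p.2) -> injective (uncurryf xi) ->
  w != w' -> [disjoint cells beta xi T w & cells beta xi T w'].
Proof.
move=> binj xinj ww'; rewrite disjoints_subset; apply/subsetP => v /cellsP[j vj].
rewrite inE; apply: contraNN ww' => /cellsP[j' vj'].
have /binj[E1 E2] : (fun p => beta p.1 p.2) (xi w.1 j, w.2) =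
  (fun p => beta p.1 p.2) (xi w'.1 j', w'.2) by rewrite /= -vj.
have /xinj[E3 _] : uncurryf xi (w.1, j) = uncurryf xi (w'.1, j') by rewrite !ffunE.
by rewrite (surjective_pairing w) (surjective_pairing w') E2 E3.
Qed.

Lemma card_cells (V N : finType) r q b (beta : N -> 'I_q -> V)
    (xi : {ffun 'I_r -> {ffun 'I_b -> N}}) T w :
  injective (fun p => beta p.1 p.2) -> injective (uncurryf xi) -> (T w <= b)%N ->
  #|cells beta xi T w| = T w.
Proof.
move=> binj xinj Tb; rewrite card_imset; last first.
  move=> j j' E; have /binj[E1] : (fun p => beta p.1 p.2) (xi w.1 j, w.2) =
    (fun p => beta p.1 p.2) (xi w.1 j', w.2) by [].
  by have /xinj[] : uncurryf xi (w.1, j) = uncurryf xi (w.1, j') by rewrite !ffunE.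
rewrite -sum1_card (eq_bigl (fun j : 'I_b => j < T w)%N) => [|j]; last by rewrite inE.
by rewrite (big_ord_narrow Tb) sum1_card card_ord.
Qed.

(** Disjointness is a premise inside the definition because a random [A] may meet [X]; it is
    supplied only for the pairs finally used. *)
Definition absorbs k m (F : kgraph k 'I_m) (V : finType) (G : kgraph k V)
    (A X : {set V}) : Prop :=
  tileable F G A /\ ([disjoint A & X] -> tileable F G (A :|: X)).

(** For each [x] at least half of the samples are patterns containing an absorber, and
    [colored_blowup] finds one such pattern in a constant fraction of arrays. The family itself does
    not depend on [x], as the later greedy choice serves all [x] at once. *)
Theorem absorber_density k m (F : kgraph k.+1 'I_m) (d mu : R) :
  (0 < m)%N -> F_Div R k.+1 m F -> F_Cov R k.+1 m F -> 0 < d <= 1 -> 0 < mu ->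
  exists2 eps : R, 0 < eps & exists2 c : R, 0 < c & exists a n0 : nat,
  forall (V : finType) (G : kgraph k.+1 V), (n0 <= #|V|)%N ->
  UniDen eps d G -> (forall v, mu <= tdeg R G v) ->
  exists (Om : finType) (A : Om -> {set V}),
  [/\ forall o, (#|A o| <= a)%N,
      forall Z : {set V}, avg (fun o => (~~ [disjoint A o & Z])%:R) <=
        a%:R * #|Z|%:R / #|V|%:R :> R
    & forall x : 'I_m -> V, injective x ->
        c <= avg (fun o => `[< absorbs F G (A o) [set x i | i : 'I_m] >]%:R) ].
Proof.
move=> m0 FD FC d01 mu0; have d01' : 0 <= d <= 1 by case/andP: d01 => /ltW -> ->.
have mu20 : 0 < mu / 2 by rewrite divr_gt0.
have [epsA epsA0 [sA sAP]] := absorber_vector m0 FD FC d01 mu20.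
have [eps eps0 [r1 r1P]] := sample_UniDen k.+1 (ltn0Sn 0) d01' epsA0 (ltac:(by rewrite
  divr_gt0) : 0 < 1 / 4 :> R).
have m0' : 0 < m%:R :> R by rewrite ltr0n.
have [r2 r2P] := sample_rdeg k mu0 (ltac:(by rewrite divr_gt0 // mulr_gt0) : 0 < 1 / (4 * m%:R)
  :> R).
pose r := (r1 + r2 + sA).+1.
pose W : finType := ('I_r * 'I_1)%type; pose Col : finType := {set {set ('I_m + W)%type}}.
(* Class sizes are fixed per edge set, so that an array and a guessed edge set determine the
   absorber before [x] is known. *)
have exT (E : Col) : exists T : W -> nat, forall P : kgraph k.+1 ('I_m + W)%type,
    edges P = E -> (exists T s0 s1, absorbing F P T s0 s1) ->
    exists s0 s1, absorbing F P T s0 s1.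
  have [[P0 [P0E [T [s0 [s1 abs]]]]]|no] := pselect (exists P0 : kgraph k.+1 ('I_m + W)%type,
      edges P0 = E /\ exists T s0 s1, absorbing F P0 T s0 s1).
    exists T => P PE _; exists s0, s1; case: abs => h0 h1 hr hl; split=> //.
      by move=> phi /h0; rewrite /is_hom PE P0E.
    by move=> phi /h1; rewrite /is_hom PE P0E.
  by exists (fun=> 0%N) => P PE abs; case: no; exists P.
have [T TP] := fin_all_exists exT.
pose b := (\max_E \max_w T E w).+1.
have Tb E w : (T E w <= b)%N.
  apply/leqW/(leq_trans (leq_bigmax w)).
  exact: (leq_bigmax (F := fun E => \max_w T E w)%N E).
have [c0 c00 [n1 n1P]] := colored_blowup R r b Col.
have Col0 : (0 < #|Col|)%N by apply/card_gt0P; exists set0.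
have Col0' : 0 < #|Col|%:R :> R by rewrite ltr0n.
exists eps => //; exists (c0 / #|Col|%:R); first by rewrite divr_gt0.
exists (r * b)%N, (n1.+1)%N => V G Vn GU Gd.
have V0 : (0 < #|V|)%N by apply: leq_trans Vn.
pose beta (v : V) (_ : 'I_1) := v.
have binj : injective (fun p => beta p.1 p.2).
  by move=> [v i] [v' i'] /= vv'; rewrite (ord1 i) (ord1 i'); congr pair.
(* An array and a guess of the pattern: the pattern depends on [x], but the family must not. The
   guess costs the factor [1 / |Col|]. *)
pose Om : finType := ({ffun 'I_r -> {ffun 'I_b -> V}} * Col)%type.
pose A (o : Om) := \bigcup_w cells beta o.1 (T o.2) w.
have A_sub o : A o \subset uncurryf o.1 @: [set: 'I_r * 'I_b].
  apply/bigcupsP => w _; apply/subsetP => v /cellsP[j ->].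
  by apply/imsetP; exists (w.1, j); rewrite ?inE // ffunE.
have xi0 : (0 < #|{ffun 'I_r -> {ffun 'I_b -> V}}|)%N by rewrite !card_ffun !expn_gt0 V0.
exists Om, A; split=> [o|Z|x xinj].
- apply: leq_trans (subset_leq_card (A_sub o)) _.
  by rewrite (leq_trans (leq_imset_card _ _)) // cardsT card_prod !card_ord.
- rewrite avg_pair; apply: le_trans (array_hits R r b Z); apply: le_avg => xi.
  apply: avg_le_const => [|E]; first exact: ler0n.
  rewrite ler_nat; case: (boolP [disjoint _ & _]) => // /pred0Pn[v /andP[/= vA vZ]].
  have /imsetP[p _ vp] := subsetP (A_sub _) _ vA.
  by rewrite (_ : hits _ _ = true) //; apply/existsP; exists p; rewrite -vp.
pose good (tau : {ffun 'I_r -> V}) :=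
  `[< UniDen epsA d (pull inr (pat x beta tau G)) /\
     forall i, mu / 2 <= rdeg R (pat x beta tau G) inr (inl i) >].
(* Failure probabilities: 1/4 for density and [1 / (4 * m)] for each of the [m] degrees. *)
have goodP : 1 / 2 <= avg (fun tau => (good tau)%:R : R).
  have H1 := r1P r V V 'I_m x beta G (ltac:(rewrite /r; clear; lia)) (fun _ _ _ vv => vv) V0
    (ltac:(clear; lia)) GU.
  have H2 i := r2P r V 'I_m x G i (ltac:(rewrite /r; clear; lia)) (Gd (x i)).
  have Tr0 : (0 < #|{ffun 'I_r -> V}|)%N by rewrite card_ffun expn_gt0 V0.
  pose u1 (tau : {ffun 'I_r -> V}) := `[< UniDen epsA d (pull inr (pat x beta tau G)) >].
  pose u2 i (tau : {ffun 'I_r -> V}) := mu / 2 <= rdeg R (pat x beta tau G) inr (inl i).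
  have pt tau : (u1 tau)%:R - \sum_i (1 - (u2 i tau)%:R) <= (good tau)%:R :> R.
    have nn i : 0 <= 1 - (u2 i tau)%:R :> R by case: (u2 i tau) => /=; lra.
    have S0 : 0 <= \sum_i (1 - (u2 i tau)%:R) :> R by apply: sumr_ge0.
    have [u1t|u1f] := boolP (u1 tau); last by have := ler0n R (good tau) => /=; lra.
    have [/forallP u2t|] := boolP [forall i, u2 i tau].
      suff -> : good tau by rewrite /=; lra.
      by apply/asboolP; split; [exact/asboolP|exact: u2t].
    rewrite negb_forall => /existsP[i /negPf u2i].
    have : 1 <= \sum_i (1 - (u2 i tau)%:R) :> R.
      by rewrite (bigD1 i) //= u2i subr0 lerDl; apply: sumr_ge0.
    by have := ler0n R (good tau) => /=; lra.
  apply: le_trans (le_avg pt); rewrite avgB avg_sum.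
  have : \sum_i avg (fun tau => 1 - (u2 i tau)%:R) <= 1 / 4 :> R.
    apply: (@le_trans _ _ (\sum_(i : 'I_m) 1 / (4 * m%:R))).
      by apply: ler_sum => i _; rewrite avgB avg_const //;
        have H2' : 1 - 1 / (4 * m%:R) <= avg (fun tau => (u2 i tau)%:R : R) := H2 i; lra.
    rewrite sumr_const card_ord -[X in X <= _]mulr_natl.
    have : (4 * m%:R)^-1 * (4 * m%:R) = 1 :> R by rewrite mulVf // mulf_neq0 // lt0r_neq0.
    by clear; lra.
  by have H1' : 1 - 1 / 4 <= avg (fun tau => (u1 tau)%:R : R) := H1; lra.
have [kap kapP] := n1P V (ltnW Vn) (fun tau => edges (pat x beta tau G) : Col) good goodP.
rewrite avg_pair; apply: (@le_trans _ _ (avg (fun xi : {ffun 'I_r -> {ffun 'I_b -> V}} =>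
  #|Col|%:R^-1 *
  (injectiveb (uncurryf xi) && transversals (fun s => good s && (edges (pat x beta s G) ==
    kap)) xi)%:R))).
  by rewrite avgZ mulrC ler_wpM2l // invr_ge0.
apply: le_avg => xi; case: (boolP (_ && _)) => [/andP[/injectiveP xiinj /forallP trans]|_];
  last first.
  by rewrite mulr0 avg_ge0.
suff abs : absorbs F G (A (xi, kap)) [set x i | i : 'I_m].
  rewrite mulr1 -(avg_delta R kap); apply: le_avg => E.
  by case: eqVneq => [<-|_]; rewrite ?ler0n // (asboolT abs).
pose g0 : {ffun 'I_r -> 'I_b} := [ffun=> ord0].
have /andP[/asboolP[PU Pd] /eqP PE] := trans g0.
set P := pat x beta _ G in PU Pd PE.
have [s0 [s1 [h0 h1 hr hl]]] := TP kap P PE (sAP W P (ltac:(by rewrite card_prod !card_ord /r;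
  clear; lia)) PU Pd).
have EP (g : {ffun 'I_r -> 'I_b}) : edges (pat x beta [ffun i => xi i (g i)] G) = edges P.
  by have /andP[_ /eqP ->] := trans g.
have sum_bigcup (C : ('I_m + W)%type -> {set V}) :
    \bigcup_w C w = (\bigcup_w C (inr w)) :|: \bigcup_i C (inl i).
  apply/setP => v; rewrite inE;
    apply/bigcupP/orP => [[[i|w] _ vC]|[/bigcupP[w _ vC]|/bigcupP[i _ vC]]].
  - by right; apply/bigcupP; exists i.
  - by left; apply/bigcupP; exists w.
  - by exists (inr w).
  - by exists (inl i).
split.
  pose C (w : ('I_m + W)%type) := if w is inr w then cells beta xi (T kap) w else set0.
  have -> : A (xi, kap) = \bigcup_w C w.
    by rewrite sum_bigcup [X in _ :|: X]big1 ?setU0.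
  apply: (tile_pattern (x := x) (beta := beta) (xi := xi) (P := P) (s := s0)) => //.
  - by move=> y v; rewrite inE.
  - by move=> w v /cellsP.
  - move=> [i|w] [i'|w'] ww' /=; try by rewrite -setI_eq0 ?set0I ?setI0.
    by apply: cells_disjoint => //; apply: contraNneq ww' => ->.
  - move=> [i|w] /=; first by rewrite cards0; case: (hl i).
    by rewrite card_cells //; case: (hr w).
move=> dA.
pose C (w : ('I_m + W)%type) := match w with inr w => cells beta xi (T kap) w | inl i => [set x
  i] end.
have -> : A (xi, kap) :|: [set x i | i : 'I_m] = \bigcup_w C w.
  rewrite sum_bigcup; congr (_ :|: _); apply/setP => v; apply/imsetP/bigcupP => [[i _ ->]|[i _]].
    by exists i; rewrite ?inE.
  by rewrite inE => /eqP ->; exists i.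
have dis w i : [disjoint cells beta xi (T kap) w & [set x i]].
  have sub : cells beta xi (T kap) w \subset A (xi, kap).
    exact: (bigcup_sup w (P := predT) (F := cells beta xi (T kap))).
  by apply: (disjointWl sub); apply: disjointWr dA; rewrite sub1set imset_f.
apply: (tile_pattern (x := x) (beta := beta) (xi := xi) (P := P) (s := s1)) => //.
- by move=> y v; rewrite inE => /eqP.
- by move=> w v /cellsP.
- move=> [i|w] [i'|w'] ww' /=; rewrite ?dis //; last 2 first.
  + by rewrite disjoint_sym dis.
  + by apply: cells_disjoint => //; apply: contraNneq ww' => ->.
  rewrite disjoints1 inE; apply: contraNN ww' => /eqP/xinj ->; exact: eqxx.
- move=> [i|w] /=; first by rewrite cards1; case: (hl i).
  by rewrite card_cells //; case: (hr w).
Qed.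

End AbsorberDensity.

(** * The absorbing set *)

Section AbsorbingSet.
Variable R : realType.

(* Derandomized choice: the potential summing [2^-1 ^+ (number of suitable chosen
   elements)] over [x] can always be multiplied by at most [1 - c / 4]. *)
Lemma greedy_family (Om X V : finType) (A : Om -> {set V}) (ok : Om -> X -> bool) (c : R) a t :
  0 < c -> c <= 1 -> (0 < #|X|)%N -> (forall o, (#|A o| <= a)%N) ->
  (forall Z : {set V}, (#|Z| <= a * t)%N ->
     avg (fun o => (~~ [disjoint A o & Z])%:R) <= c / 2) ->
  (forall x, c <= avg (fun o => (ok o x)%:R)) ->
  forall j, (j <= t)%N -> exists s : seq Om,
  [/\ size s = j, forall v, (count (fun o => v \in A o) s <= 1)%N,
      {in s, forall o, exists x, ok o x} &
      \sum_x 2^-1 ^+ count (ok^~ x) s <= #|X|%:R * (1 - c / 4) ^+ j].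
Proof.
move=> c0 c1 X0 Aa AZ okc; elim=> [|j IH] jt.
  exists [::]; split=> //; rewrite expr0 mulr1 (eq_bigr (fun=> 1)) ?sumr_const //.
have [s [sj sdis sok sP]] := IH (ltnW jt).
pose w x : R := 2^-1 ^+ count (ok^~ x) s.
have w0 x : 0 < w x by rewrite exprn_gt0 // invr_gt0.
pose Phi := \sum_x w x.
have Phi0 : 0 < Phi.
  have /card_gt0P[x0 _] := X0.
  by rewrite /Phi (bigD1 x0) //= ltr_pwDl //; apply: sumr_ge0 => x _; apply: ltW.
pose U := \bigcup_(o <- s) A o.
have UE v : (v \in U) = has (fun o => v \in A o) s.
  by rewrite /U; elim: (s) => [|o s' IHs]; rewrite ?big_nil ?inE // big_cons inE IHs.
have Ua : (#|U| <= a * t)%N.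
  apply: (@leq_trans (a * size s)); last by rewrite sj leq_mul2l ltnW ?orbT.
  rewrite /U; elim: (s) => [|o s' IHs]; first by rewrite big_nil cards0.
  by rewrite big_cons mulnS (leq_trans (leq_card_setU _ _)) // leq_add.
have Om0 : (0 < #|Om|)%N.
  have /card_gt0P[x0 _] := X0; case: posnP => // O0.
  by have := okc x0; rewrite /avg O0 invr0 mulr0 => /(lt_le_trans c0); rewrite ltxx.
pose g o := \sum_x w x * (ok o x && [disjoint A o & U])%:R.
have [o oP] := exists_ge_avg g Om0.
(* Probability [c] of being suitable, minus [c / 2] for meeting the union [U] of the earlier
   choices. *)
have gavg : c / 2 * Phi <= avg g.
  rewrite avg_sum /Phi mulr_sumr; apply: ler_sum => x _;
    rewrite avgZ mulrC ler_wpM2l ?(ltW (w0 x)) //.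
  have := okc x; have := AZ U Ua.
  set E1 := avg _; set E2 := avg _; set E3 := avg _ => h1 h2.
  have : E2 - E1 <= E3.
    rewrite /E1 /E2 /E3 -avgB; apply: le_avg => o'.
    by case: (ok o' x); case: [disjoint _ & _] => /=; lra.
  by lra.
(* Every summand of [g o] carries both conditions, so positivity makes [A o] disjoint from [U] and
   suitable for some [x]. *)
have go : 0 < g o by apply: lt_le_trans oP; apply: lt_le_trans gavg; rewrite mulr_gt0 // divr_gt0.
have [oU|oU] := boolP [disjoint A o & U]; last first.
  by move: go; rewrite /g big1 ?ltxx // => x _; rewrite (negPf oU) andbF mulr0.
have [x okx] : exists x, ok o x.
  apply: contrapT => /forallNP H; move: go; rewrite /g big1 ?ltxx // => x _.
  by have /negP/negPf -> := H x; rewrite mulr0.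
exists (o :: s); split.
- by rewrite /= sj.
- move=> v /=; have [vo|_] := boolP (v \in A o); last by rewrite add0n sdis.
  have := disjointFr oU vo; rewrite UE => /negbT; rewrite -all_predC => /allP H.
  rewrite (_ : count _ s = 0)%N //; apply/eqP; rewrite -leqn0 leqNgt -has_count.
  by apply/negP => /hasP[o' /H /= /negPf ->].
- by move=> o'; rewrite inE => /orP[/eqP ->|/sok //]; exists x.
(* Suitable [x] have their weight halved, so the potential drops by [g o / 2], at least
   [c / 4 * Phi]. *)
have -> : \sum_x 2^-1 ^+ count (ok^~ x) (o :: s) = Phi - 2^-1 * g o :> R.
  rewrite /Phi /g mulr_sumr -sumrB; apply: eq_bigr => y _ /=.
  by rewrite oU andbT /w; case: (ok o y) => /=; rewrite ?add1n ?add0n ?exprS; lra.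
rewrite exprSr mulrA; apply: (@le_trans _ _ (Phi * (1 - c / 4))).
  by move: gavg oP; lra.
by apply: ler_wpM2r => //; lra.
Qed.

Lemma mem_bigcup_seq (V : finType) (s : seq {set V}) v :
  (v \in \bigcup_(A <- s) A) = has (fun A : {set V} => v \in A) s.
Proof. by elim: s => [|A s IH]; rewrite ?big_nil ?inE // big_cons inE IH. Qed.

Lemma disjoint_count (V : finType) (A : {set V}) (s : seq {set V}) :
  (forall v, (count (fun B : {set V} => v \in B) (A :: s) <= 1)%N) ->
  [disjoint A & \bigcup_(B <- s) B].
Proof.
move=> H; rewrite disjoints_subset; apply/subsetP => v vA.
rewrite inE mem_bigcup_seq has_count -leqNgt.
by have := H v; rewrite /= vA.
Qed.

Lemma tileable_seq k m (F : kgraph k 'I_m) (V : finType) (G : kgraph k V) (s : seq {set V}) :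
  (forall v, (count (fun A : {set V} => v \in A) s <= 1)%N) ->
  {in s, forall A, tileable F G A} -> tileable F G (\bigcup_(A <- s) A).
Proof.
elim: s => [|A s IH] dis tA; first by rewrite big_nil; constructor.
rewrite big_cons; apply: tileable_disjointU; last exact: disjoint_count.
  by apply: tA; rewrite inE eqxx.
apply: IH => [v|B Bs]; last by apply: tA; rewrite inE Bs orbT.
by apply: leq_trans (dis v); rewrite /= leq_addl.
Qed.

(** Induction on the leftover blocks: the first uses up one absorber, which lowers the supply of
    every other block by at most one, while the number of blocks also falls by one. *)
Lemma absorb_all k m (F : kgraph k 'I_m) (V : finType) (G : kgraph k V) (s Xs : seq {set V}) :
  (forall v, (count (fun A : {set V} => v \in A) (s ++ Xs) <= 1)%N) ->
  {in s, forall A, tileable F G A} ->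
  {in Xs, forall X, (size Xs <= count (fun A => `[< absorbs F G A X >]) s)%N} ->
  tileable F G (\bigcup_(A <- s ++ Xs) A).
Proof.
elim: Xs s => [|X Xs IH] s dis tA cX.
  by apply: tileable_seq => [v|A]; [exact: dis|rewrite cats0; exact: tA].
have /hasP[A As /asboolP[tAA tAX]] : has (fun A => `[< absorbs F G A X >]) s.
  by rewrite has_count; apply: leq_trans (cX X _); rewrite ?inE ?eqxx.
have perm_s : perm_eq s (A :: rem A s) by apply: perm_to_rem.
have perm_sX : perm_eq (s ++ X :: Xs) (A :: X :: (rem A s ++ Xs)).
  apply: perm_trans (perm_cat perm_s (perm_refl (X :: Xs))) _.
  by rewrite /= perm_cons -cat1s perm_catCA.
have dis' v : (count (fun A : {set V} => v \in A) (A :: X :: (rem A s ++ Xs)) <= 1)%N.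
  by rewrite -(permP perm_sX).
have -> : \bigcup_(B <- s ++ X :: Xs) B = (A :|: X) :|: \bigcup_(B <- rem A s ++ Xs) B.
  apply/setP => v; rewrite !inE !mem_bigcup_seq has_count (permP perm_sX) /= has_count.
  by case: (v \in A); case: (v \in X).
have dAX := disjoint_count dis'.
apply: tileable_disjointU.
- apply: tAX; apply: disjointWr dAX; rewrite big_cons; exact: subsetUl.
- apply: IH => [v|B /mem_rem /tA //|Y YXs].
    by apply: leq_trans (dis' v); rewrite /= addnA leq_addl.
  have := cX Y; rewrite inE YXs orbT => /(_ isT); rewrite (permP perm_s) /=.
  by case: `[< _ >]; rewrite ?add1n ?add0n // => /ltnW.
- apply: disjoint_count => v; have := dis' v; rewrite /= inE.
  by case: (v \in A); case: (v \in X).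
Qed.

Lemma exp2_dominates C : exists q0, forall q, (q0 <= q)%N -> (C * q.+1 <= 2 ^ q)%N.
Proof.
exists (2 * (2 * C))%N => q; move/subnKC <-; elim: (q - _)%N => [|i IH]; last first.
  by rewrite addnS expnS; move: IH; rewrite mul2n -addnn; nia.
rewrite addn0; set s := (2 * C)%N.
have h : (s < 2 ^ s)%N by apply: ltn_expl.
by rewrite mul2n -addnn expnD; move: h; rewrite /s; nia.
Qed.

Lemma poly_lt_exp2 K m : (0 < K)%N -> exists n0, forall n, (n0 <= n)%N -> (n ^ m < 2 ^ (n %/
  K))%N.
Proof.
move=> K0; case: m => [|m].
  exists K => n Kn; rewrite expn0 -(expn0 2) ltn_exp2l // divn_gt0 //.
have [q0 q0P] := exp2_dominates (K * m.+1).
exists (K * (m.+1 * q0.+1))%N => n nn.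
set j := (n %/ K)%N; set q := (j %/ m.+1)%N.
have jn : (n < K * j.+1)%N by rewrite mulnC ltn_ceil.
have qj : (j < m.+1 * q.+1)%N by rewrite mulnC ltn_ceil.
have jge : (m.+1 * q0.+1 <= j)%N by rewrite leq_divRL // mulnC.
have qge : (q0 <= q)%N by rewrite leq_divRL //; apply: leq_trans jge;
  rewrite mulnC leq_mul2l leqnSn orbT.
apply: (@leq_trans ((2 ^ q) ^ m.+1)); last by rewrite -expnM leq_exp2l // leq_trunc_div.
rewrite ltn_exp2r //; apply: leq_trans (q0P q qge).
by apply: leq_trans jn _; rewrite -mulnA leq_mul2l qj orbT.
Qed.

Lemma split_blocks (V : finType) m l (L : {set V}) : #|L| = (m * l)%N ->
  exists Xs : seq {set V}, [/\ size Xs = l, {in Xs, forall X : {set V}, #|X| = m} &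
    forall v, count (fun X : {set V} => v \in X) Xs = (v \in L)].
Proof.
elim: l L => [|l IH] L Ll.
  exists [::]; split=> // v; move: Ll; rewrite muln0 => /eqP.
  by rewrite cards_eq0 => /eqP ->; rewrite inE.
have [X XL Xm] : exists2 X : {set V}, X \subset L & #|X| = m.
  by apply: subset_card; rewrite Ll mulnS leq_addr.
have [|Xs [Xsl Xsm Xsv]] := IH (L :\: X).
  by rewrite cardsD (setIidPr XL) Ll Xm mulnS addKn.
exists (X :: Xs); split=> [|Y|v] /=; first by rewrite Xsl.
  by rewrite inE => /orP[/eqP ->|/Xsm].
rewrite Xsv inE; have [vX|] := boolP (v \in X); last by rewrite add0n.
by rewrite (subsetP XL).
Qed.

Lemma set_param (V : finType) m (X : {set V}) : #|X| = m ->
  exists2 x : {ffun 'I_m -> V}, injective x & [set x i | i : 'I_m] = X.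
Proof.
move=> Xm; pose x : {ffun 'I_m -> V} := [ffun i => enum_val (cast_ord (esym Xm) i)].
have xinj : injective x by move=> i j; rewrite !ffunE => /enum_val_inj/cast_ord_inj.
exists x => //; apply/eqP; rewrite eqEcard card_imset // card_ord Xm leqnn andbT.
by apply/subsetP => _ /imsetP[i _ ->]; rewrite ffunE enum_valP.
Qed.

(** Bernoulli's inequality gives [(1 + c / 4) ^+ p >= 4] once [p >= 12 / c], and
    [(1 - z) * (1 + z) <= 1] inverts it. *)
Lemma pow_small (c : R) : 0 < c -> c <= 1 -> exists p, (1 - c / 4) ^+ p <= 4^-1.
Proof.
move=> c0 c1; have [p pP] := exists_nat_ge (12 / c).
have bernoulli z q : 0 <= z -> 1 + q%:R * z <= (1 + z) ^+ q :> R.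
  move=> z0; elim: q => [|q IH]; first by rewrite mul0r addr0 expr0.
  have z1 : 0 <= 1 + z by rewrite addr_ge0.
  rewrite exprS; apply: le_trans (ler_wpM2l z1 IH).
  rewrite -(natr1 q); have := mulr_ge0 (ler0n R q) (mulr_ge0 z0 z0); lra.
exists p; have z0 : 0 <= c / 4 by rewrite divr_ge0 // ltW.
have y0 : 0 <= 1 - c / 4 by lra.
have h1 : 4 <= (1 + c / 4) ^+ p.
  apply: le_trans (bernoulli _ p z0); move: pP; rewrite ler_pdivrMr //; lra.
have h2 : (1 - c / 4) ^+ p * (1 + c / 4) ^+ p <= 1.
  rewrite -exprMn; apply: exprn_ile1; first by rewrite mulr_ge0 // addr_ge0.
  by have := mulr_ge0 z0 z0; lra.
rewrite -(@ler_pM2r _ 4) // mulVf ?pnatr_eq0 //.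
by apply: le_trans h2; rewrite ler_wpM2l // exprn_ge0.
Qed.

(** After [t = p * t0] greedy choices the potential is at most [n ^ m * 4^-1 ^+ t0]. A tuple with
    fewer than [t0] absorbers would alone contribute at least [2^-1 ^+ t0], forcing
    [2 ^ t0 <= n ^ m], impossible as [t0] is linear in [n]. *)
Theorem absorbing_set k m (F : kgraph k.+1 'I_m) (d mu : R) :
  (0 < m)%N -> F_Div R k.+1 m F -> F_Cov R k.+1 m F -> 0 < d <= 1 -> 0 < mu ->
  exists2 eps : R, 0 < eps & exists2 xi : R, 0 < xi & exists n0 : nat,
  forall (V : finType) (G : kgraph k.+1 V), (n0 <= #|V|)%N ->
  UniDen eps d G -> (forall v, mu <= tdeg R G v) ->
  exists2 B : {set V}, (2 * #|B| <= #|V|)%N &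
  forall L : {set V}, [disjoint B & L] -> (m %| #|L|)%N -> #|L|%:R <= xi * #|V|%:R ->
  tileable F G (B :|: L).
Proof.
move=> m0 FD FC d01 mu0.
have [eps eps0 [c' c'0 [a [n1 n1P]]]] := absorber_density m0 FD FC d01 mu0.
pose c := Num.min c' 1; have c0 : 0 < c by rewrite lt_min c'0 ltr01.
have c1 : c <= 1 by rewrite ge_min lexx orbT.
have cc' : c <= c' by rewrite ge_min lexx.
have [p pP] := pow_small c0 c1.
have [K0 K0P] := exists_nat_ge (2 * a%:R * a%:R * p%:R / c).
(* [K0] keeps the chance of meeting the at most [a * t] used vertices within [c / 2]; [2 * a * p]
   makes these at most half of [V]. *)
pose K := (K0 + 2 * a * p).+1.
have [n2 n2P] := poly_lt_exp2 m (ltn0Sn (K0 + 2 * a * p)); rewrite -/K in n2P.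
(* With this capacity the leftover has at most [n %/ K] blocks, the number of absorbers guaranteed
   for each tuple. *)
exists eps => //; exists (2 * K%:R)^-1; first by rewrite invr_gt0 mulr_gt0 // ltr0n.
exists (n1 + n2 + m + 2 * K)%N => V G Vn GU Gd.
set n := #|V| in Vn *.
have [b1 b2 b3 b4] : [/\ n1 <= n, n2 <= n, m <= n & 2 * K <= n]%N by clear -Vn; split; lia.
have n0 : (0 < n)%N by clear -b4; rewrite /K in b4; lia.
have n0' : 0 < n%:R :> R by rewrite ltr0n.
have [Om [A [Aa AZ Ax]]] := n1P V G b1 GU Gd.
pose X : finType := {x : {ffun 'I_m -> V} | injectiveb x}.
pose ok (o : Om) (x : X) := `[< absorbs F G (A o) [set (val x) i | i : 'I_m] >].
pose t0 := (n %/ K)%N; pose t := (p * t0)%N.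
have t0n : (t0 * K <= n)%N by apply: leq_trunc_div.
have X0 : (0 < #|X|)%N.
  have [f finj] := ord_injection b3.
  have fi : injectiveb [ffun i => f i].
    by apply/injectiveP => i j; rewrite !ffunE => /finj.
  by apply/card_gt0P; exists (exist (fun x : {ffun 'I_m -> V} => injectiveb x) _ fi).
have AZ' (Z : {set V}) : (#|Z| <= a * t)%N ->
    avg (fun o => (~~ [disjoint A o & Z])%:R) <= c / 2.
  move=> Zt; apply: le_trans (AZ Z) _; rewrite -/n ler_pdivrMr //.
  have h1 : (#|Z|%:R <= a%:R * (p%:R * t0%:R) :> R) by rewrite -!natrM ler_nat.
  have h2 : t0%:R * K%:R <= n%:R :> R by rewrite -natrM ler_nat.
  have h3 : 2 * a%:R * a%:R * p%:R <= c * K%:R.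
    rewrite -ler_pdivrMl // [X in X <= _]mulrC; apply: le_trans K0P _.
    by rewrite ler_nat /K; clear; lia.
  apply: (@le_trans _ _ (a%:R * (a%:R * (p%:R * t0%:R)))).
    by rewrite ler_wpM2l ?ler0n.
  have h4 := ler_wpM2r (ler0n R t0) h3; have h5 := ler_wpM2l (ltW c0) h2.
  by move: h4 h5; clear; lra.
have [s [st sdis sok sP]] := greedy_family c0 c1 X0 Aa AZ'
  (fun x => le_trans cc' (Ax (val x) (elimT (injectiveP (val x)) (valP x)))) (leqnn t).
pose As := map A s.
have Asdis v : (count (fun B : {set V} => v \in B) As <= 1)%N by rewrite count_map; apply: sdis.
have enough (x : X) : (t0 <= count (fun B => `[< absorbs F G B [set (val x) i | i : 'I_m] >])
  As)%N.
  rewrite count_map leqNgt; apply/negP; set cn := count _ _ => lt0.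
  have : 2^-1 ^+ cn <= #|X|%:R * (1 - c / 4) ^+ t :> R.
    apply: le_trans sP; rewrite (bigD1 x) //= lerDl; apply: sumr_ge0 => y _.
    by rewrite exprn_ge0 ?invr_ge0.
  have h1 : #|X|%:R <= (n ^ m)%:R :> R.
    by rewrite ler_nat card_sig (leq_trans (max_card _)) // card_ffun card_ord.
  have h2 : (1 - c / 4) ^+ t <= 4^-1 ^+ t0 :> R.
    by rewrite /t exprM lerXn2r ?nnegrE ?invr_ge0 // exprn_ge0 //; move: c1; clear; lra.
  have h3 : 2^-1 ^+ t0 <= 2^-1 ^+ cn :> R.
    by apply: ler_wiXn2l (ltnW lt0); rewrite ?invr_ge0 ?invf_le1 ?ler1n.
  move=> /(le_trans h3) h4.
  have : (n ^ m)%:R < 2 ^+ t0 :> R by rewrite -natrX ltr_nat n2P.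
  apply/negP; rewrite -leNgt.
  have h5 : 2^-1 ^+ t0 <= (n ^ m)%:R * 4^-1 ^+ t0 :> R.
    apply: le_trans h4 _; apply: ler_pM => //.
    by rewrite exprn_ge0 //; move: c1; clear; lra.
  have := ler_wpM2r (exprn_ge0 t0 (ler0n R 4)) h5.
  rewrite -exprMn -mulrA -exprMn mulVf ?pnatr_eq0 // expr1n mulr1.
  by congr (_ ^+ _ <= _); clear; lra.
exists (\bigcup_(B <- As) B).
  have : (#|\bigcup_(B <- As) B| <= a * t)%N.
    rewrite -st /As; elim: (s) => [|o s' IHs]; first by rewrite big_nil cards0.
    by rewrite /= big_cons mulnS (leq_trans (leq_card_setU _ _)) // leq_add.
  move: t0n; rewrite /t /K -/n; clear; nia.
move=> L dL mL Ln.
have Ll : (#|L| %/ m <= t0)%N.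
  apply: leq_trans (leq_div _ _) _.
  have h1 : (#|L| * (2 * K) <= n)%N.
    rewrite -(ler_nat R) natrM mulrC -ler_pdivlMl ?ltr0n ?muln_gt0 //.
    by rewrite natrM.
  have h2 : (n < t0.+1 * K)%N by apply: ltn_ceil.
  by move: h1 h2; rewrite /K; clear; nia.
have Lm : #|L| = (m * (#|L| %/ m))%N by rewrite mulnC divnK.
have [Xs [Xsl Xsm Xsv]] := split_blocks Lm.
have -> : \bigcup_(B <- As) B :|: L = \bigcup_(B <- As ++ Xs) B.
  apply/setP => v; rewrite inE !mem_bigcup_seq has_cat; congr (_ || _).
  by rewrite has_count Xsv; case: (v \in L).
apply: absorb_all => [v|B /mapP[o os ->]|Y YXs].
- rewrite count_cat Xsv; have [vL|_] := boolP (v \in L); last by rewrite addn0.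
  have := disjointFl dL vL; rewrite mem_bigcup_seq => /negbT;
    rewrite has_count -leqNgt leqn0 => /eqP ->.
  by [].
- by have [x /asboolP[]] := sok o os.
- have [x xinj xY] := set_param (Xsm Y YXs).
  have xi : injectiveb x by apply/injectiveP.
  by rewrite Xsl (leq_trans Ll) //;
    have := enough (exist (fun x : {ffun 'I_m -> V} => injectiveb x) x xi); rewrite /= xY.
Qed.

End AbsorbingSet.

(** * Almost perfect tilings *)

Section AlmostTiling.
Variable R : realType.

(** Round [b * w] down: each homomorphism loses less than one, whence the term [|S| ^ m], and no
    vertex gets a load above [b]. *)
Lemma spa_tiles k m (F : kgraph k 'I_m) (W S : finType) (f : S -> W) (P : kgraph k W)
    (rho : R) b :
  (0 < m)%N -> injective f -> Spa rho (hom_digraph F (pull f P)) ->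
  exists s : seq {ffun 'I_m -> W}, [/\ {in s, forall phi, is_hom F P phi},
    forall w, (\sum_(phi <- s) multiplicity w phi <= b)%N &
    b%:R * ((1 - rho) * #|S|%:R) - (m * #|S| ^ m)%:R <= (m * size s)%:R :> R].
Proof.
move=> m0 finj [w [w01 wv wtot]]; set H := hom_digraph F _ in w01 wv wtot.
pose c phi := Num.trunc (b%:R * w phi).
have bw0 phi : phi \in H -> 0 <= b%:R * w phi.
  by move=> /w01/andP[w0 _]; rewrite mulr_ge0.
pose s := map (ffmap f) (nseqs (enum H) c).
exists s; split.
- move=> _ /mapP[phi /mem_nseqs + ->]; rewrite mem_enum inE; exact: hom_pull.
- move=> x; rewrite big_map sum_nseqs big_enum /=.
  rewrite (eq_bigr (fun phi => \sum_(v | f v == x) c phi * multiplicity v phi)%N); last first.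
    by move=> phi _; rewrite multiplicity_ffmap big_distrr.
  rewrite exchange_big /=.
  have bound v : (\sum_(phi in H) c phi * multiplicity v phi <= b)%N.
    rewrite -(ler_nat R) natr_sum.
    apply: (@le_trans _ _ (b%:R * \sum_(e in H) w e * (multiplicity v e)%:R)).
      rewrite mulr_sumr; apply: ler_sum => phi phiH; rewrite natrM mulrA.
      by rewrite ler_wpM2r // truncn_le bw0.
    by rewrite -[leRHS]mulr1 ler_wpM2l.
  have [v0 /eqP fv0|no] := pickP (fun v => f v == x); last by rewrite big_pred0.
  rewrite (big_pred1 v0) // => v; rewrite /= -fv0; apply/eqP/eqP => [/finj//|->//].
- rewrite size_map /nseqs size_flatten /shape -map_comp sumnE big_map big_enum /=.
  rewrite natrM lerBlDr -lerBlDl.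
  rewrite ler_pdivrMr ?ltr0n // in wtot.
  have tot : b%:R * \sum_(e in H) w e - (#|S| ^ m)%:R <= (\sum_(phi in H) c phi)%:R.
    rewrite lerBlDr natr_sum.
    have HS : (\sum_(e in H) 1 <= #|S| ^ m)%N.
      by rewrite sum1_card (leq_trans (max_card _)) // card_ffun card_ord.
    apply: (@le_trans _ _ (\sum_(e in H) (c e)%:R + (\sum_(e in H) 1)%N%:R)).
      rewrite natr_sum -big_split mulr_sumr /=; apply: ler_sum => e _.
      by rewrite natr1 ltW // truncnS_gt.
    by rewrite lerD2l ler_nat.
  have -> : (\sum_(j in H) size (nseq (c j) j) = \sum_(phi in H) c phi)%N.
    by apply: eq_bigr => phi _; rewrite size_nseq.
  have := ler_wpM2l (ler0n R m) tot; have := ler_wpM2l (ler0n R b) wtot.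
  rewrite natrM; lra.
Qed.

(** A partition of [U] into injective [m]-tuples. Tiles and arbitrary groups of uncovered vertices
    share this form, so both can be sampled as blocks. *)
Definition block_family (V : finType) m (U : {set V}) (E : {set {ffun 'I_m -> V}}) :=
  (forall e e' : {ffun 'I_m -> V}, e \in E -> e' \in E ->
     forall a a', e a = e' a' -> e = e' /\ a = a') /\
  forall v, v \in U <-> exists2 e : {ffun 'I_m -> V}, e \in E & exists a, v = e a.

Lemma block_family0 (V : finType) m : block_family (@set0 V) (@set0 {ffun 'I_m -> V}).
Proof.
split=> [e e'|v]; first by rewrite inE.
by rewrite inE; split=> // -[e]; rewrite inE.
Qed.

Lemma block_familyU (V : finType) m (U U' : {set V}) (E E' : {set {ffun 'I_m -> V}}) :
  [disjoint U & U'] -> block_family U E -> block_family U' E' ->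
  block_family (U :|: U') (E :|: E').
Proof.
move=> dU [Ei Ev] [Ei' Ev'].
have inU e a : e \in E -> e a \in U by move=> eE; apply/Ev; exists e => //; exists a.
have inU' e a : e \in E' -> e a \in U' by move=> eE; apply/Ev'; exists e => //; exists a.
split=> [e e'|v].
  rewrite !inE => /orP[eE|eE'] /orP[eE2|eE2'] a a' ee.
  - exact: Ei.
  - by have := disjointFr dU (inU _ a eE); rewrite ee inU'.
  - by have := disjointFr dU (inU _ a' eE2); rewrite -ee inU'.
  - exact: Ei'.
rewrite inE; split=> [/orP[/Ev|/Ev'] [e eE H]|[e]].
- by exists e; rewrite // inE eE.
- by exists e; rewrite // inE eE orbT.
by rewrite inE => /orP[eE|eE] [a ->]; [rewrite inU|rewrite inU' ?orbT].
Qed.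

Lemma block_family1 (V : finType) m (e : {ffun 'I_m -> V}) :
  injective e -> block_family (e @: [set: 'I_m]) [set e].
Proof.
move=> einj; split=> [e1 e2|v].
  by rewrite !inE => /eqP -> /eqP -> a a' /einj.
split=> [/imsetP[a _ ->]|[e']]; first by exists e; rewrite ?inE //; exists a.
by rewrite inE => /eqP -> [a ->]; rewrite imset_f ?inE.
Qed.

Lemma block_family_card (V : finType) m (U : {set V}) (E : {set {ffun 'I_m -> V}}) :
  block_family U E -> #|U| = (m * #|E|)%N.
Proof.
move=> [Ei Ev].
have -> : U = (fun p : {ffun 'I_m -> V} * 'I_m => p.1 p.2) @: setX E [set: 'I_m].
  apply/setP => v; apply/idP/imsetP => [/Ev[e eE [a ->]]|[[e a]]].
    by exists (e, a); rewrite ?inE ?eE.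
  by rewrite !inE andbT => eE ->; apply/Ev; exists e => //; exists a.
rewrite card_in_imset ?cardsX ?cardsT ?card_ord 1?mulnC //.
move=> [e a] [e' a']; rewrite !inE !andbT /= => eE eE' ee.
by have [-> ->] := Ei _ _ eE eE' _ _ ee.
Qed.

Lemma tileable_blocks k m (F : kgraph k 'I_m) (V : finType) (G : kgraph k V) U :
  tileable F G U -> exists2 E, block_family U E & {in E, forall e, is_hom F G e}.
Proof.
elim: U / => [|phi U hphi iphi dU _ [E EU EH]].
  by exists set0; [exact: block_family0|move=> e; rewrite inE].
exists (E :|: [set phi]); first by apply: block_familyU => //; apply: block_family1.
by move=> e; rewrite !inE => /orP[/EH|/eqP ->].
Qed.

Lemma exists_blocks (V : finType) m (U : {set V}) :
  (m %| #|U|)%N -> exists E : {set {ffun 'I_m -> V}}, block_family U E.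
Proof.
move=> /dvdnP[l]; elim: l U => [|l IH] U Ul.
  move: Ul => /eqP; rewrite mul0n cards_eq0 => /eqP ->.
  by exists set0; exact: block_family0.
have [X XU Xm] : exists2 X : {set V}, X \subset U & #|X| = m.
  by apply: subset_card; rewrite Ul mulSn leq_addr.
have [x xinj xX] := set_param Xm.
have [|E EU] := IH (U :\: X).
  by rewrite cardsD (setIidPr XU) Ul Xm mulSn addKn.
exists ([set x] :|: E).
have -> : U = (x @: [set: 'I_m]) :|: (U :\: X).
  rewrite imsetTE xX; apply/setP => v; rewrite !inE.
  by have [/(subsetP XU) ->|] := boolP (v \in X).
apply: block_familyU => //; last exact: block_family1.
by rewrite imsetTE xX -setI_eq0 setIDA setDIl setDv set0I.
Qed.

Lemma tileable_family k m (F : kgraph k 'I_m) (V : finType) (G : kgraph k V)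
    (U : {set V}) (E : {set {ffun 'I_m -> V}}) :
  block_family U E -> {in E, forall e, is_hom F G e} -> tileable F G U.
Proof.
move=> [Ei Ev] EH.
have -> : U = \bigcup_(e in E) (e @: [set: 'I_m]).
  apply/setP => v; apply/idP/bigcupP => [/Ev[e eE [a ->]]|[e eE /imsetP[a _ ->]]].
    by exists e => //; rewrite imset_f.
  by apply/Ev; exists e => //; exists a.
apply: tileable_bigcup => [e e' eE e'E ee'|e eE].
  rewrite disjoints_subset; apply/subsetP => _ /imsetP[a _ ->]; rewrite inE.
  by apply: contraNN ee' => /imsetP[a' _ /(Ei _ _ eE e'E)[-> _]].
rewrite -[_ @: _]set0U; apply: tileableU => //; first exact: EH.
- by move=> a a' /(Ei _ _ eE eE)[].
- by rewrite -setI_eq0 set0I.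
- by constructor.
Qed.

Lemma block_familyS (V : finType) m (U : {set V}) (E E' : {set {ffun 'I_m -> V}}) :
  E' \subset E -> block_family U E ->
  block_family (\bigcup_(e in E') (e @: [set: 'I_m])) E'.
Proof.
move=> EE' [Ei _]; have EE e : e \in E' -> e \in E by move/(subsetP EE').
split=> [e e' /EE eE /EE e'E|v]; first exact: Ei.
split=> [/bigcupP[e eE /imsetP[a _ ->]]|[e eE [a ->]]]; first by exists e => //; exists a.
by apply/bigcupP; exists e => //; rewrite imset_f.
Qed.

(* A largest tiling of [~: B] is almost perfect: otherwise sample blocks among
   its tiles and the uncovered vertices, and retile a blow-up of the sample. *)
Theorem almost_tiling k m (F : kgraph k.+1 'I_m) (d gam : R) :
  (0 < m)%N -> F_Spa R k.+1 m F -> 0 < d <= 1 -> 0 < gam <= 1 ->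
  exists2 eps : R, 0 < eps & exists n0 : nat,
  forall (V : finType) (G : kgraph k.+1 V), (n0 <= #|V|)%N -> UniDen eps d G ->
  forall B : {set V}, (2 * #|B| <= #|V|)%N -> (m %| #|~: B|)%N ->
  exists U : {set V},
    [/\ tileable F G U, U \subset ~: B & #|~: B :\: U|%:R <= gam * #|V|%:R].
Proof.
move=> m0 FS /andP[d0 d1] /andP[gam0 gam1].
have d01 : 0 <= d <= 1 by rewrite (ltW d0).
have d40 : 0 < d / 4 by rewrite divr_gt0.
have gam80 : 0 < gam / 8 by rewrite divr_gt0.
(* The core has degrees [d / 2] in the sample, and [d / 4] of this is left after deleting its
   complement. *)
have [epsS epsS0 [nS nS0 nSP]] := FS d (d / 4) (gam / 8) d0 d40 gam80.
pose eta := gam * d / (8 * k.+1%:R).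
have k1 : 1 <= k.+1%:R :> R by rewrite ler1n.
have eta0 : 0 < eta by rewrite divr_gt0 ?mulr_gt0 // ltr0n.
have etaE : eta * (8 * k.+1%:R) = gam * d by rewrite divfK // mulf_neq0 // pnatr_eq0.
have eta_gam : eta <= gam / 8.
  have : eta * 8 <= gam * d.
    by rewrite -etaE ler_wpM2l ?(ltW eta0) // ler_peMr.
  by have := ler_wpM2l (ltW gam0) d1; rewrite mulr1; lra.
have eta1 : eta <= 1 / 8 by lra.
have etak : k%:R * eta <= d / 4.
  have : eta * (8 * k.+1%:R) <= d by rewrite etaE ler_piMl // ltW.
  by rewrite -(natr1 k); lra.
have [epsJ epsJ0 [sJ sJP]] := high_degree_core k m0 d0 (ltac:(by apply/andP; split;
  [exact: eta0|lra]) : 0 < eta <= 1).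
have pk : 0 < 2 ^+ k.+1 :> R by rewrite exprn_gt0.
pose eps' := Num.min epsJ (epsS / 2 ^+ k.+1).
have eps'0 : 0 < eps' by rewrite lt_min epsJ0 divr_gt0.
have [eps eps0 [r0 r0P]] := sample_UniDen k.+1 m0 d01 eps'0
  (ltac:(by rewrite divr_gt0) : 0 < 1 / 4 :> R).
have [r2 r2P] := exists_nat_ge (4 / (gam / 8) ^+ 2).
pose r := (r0 + sJ + 2 * nS + r2).+1.
pose W : finType := ('I_r * 'I_m)%type.
have cW : #|W| = (r * m)%N by rewrite card_prod !card_ord.
have rW : (r <= #|W|)%N by rewrite cW leq_pmulr.
(* Rounding loses at most one tile for each of at most [|W| ^ m] maps; for this [b] that is at most
   [gam / 8 * b]. *)
have [b0 b0P] := exists_nat_ge (8 * (#|W| ^ m)%:R / gam).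
pose b := b0.+1.
(* Besides the edges, the colour records which sampled blocks are tiles, so that a blow-up contains
   tiles in the same proportion as the sample. *)
pose Col : finType := ({set {set (void + W)%type}} * {ffun 'I_r -> bool})%type.
have [c c0 [n1 n1P]] := colored_blowup R r b Col.
exists eps => //; exists (2 * (m * n1.+1))%N => V G Vn GU B BV mB.
pose PU (U : {set V}) := `[< tileable F G U >] && (U \subset ~: B).
have PU0 : PU set0 by rewrite /PU sub0set andbT; apply/asboolP; constructor.
case: (arg_maxnP (fun U : {set V} => #|U|) PU0) => U /andP[/asboolP tU UB] Umax.
have {}Umax U' : PU U' -> (#|U'| <= #|U|)%N := Umax U'.
exists U; split=> //; rewrite leNgt; apply/negP => Lbig.
have UL : U :|: (~: B :\: U) = ~: B.
  by apply/setP => v; rewrite !inE; have [/(subsetP UB)|] := boolP (v \in U); rewrite ?inE.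
have dUL : [disjoint U & ~: B :\: U].
  by rewrite disjoint_sym disjoints_subset setDE subsetIr.
have [Et EtU EtH] := tileable_blocks tU.
have cUL : #|~: B| = (#|U| + #|~: B :\: U|)%N.
  by rewrite -{1}UL cardsU disjoint_setI0 // cards0 subn0.
have mL : (m %| #|~: B :\: U|)%N.
  by move: mB; rewrite cUL dvdn_addr //; apply: tileable_card tU.
have [El ElL] := exists_blocks mL.
have EB : block_family (~: B) (Et :|: El) by rewrite -UL; apply: block_familyU.
set E := Et :|: El in EB.
pose N : finType := {e : {ffun 'I_m -> V} | e \in E}.
pose beta (e : N) (a : 'I_m) := val e a.
have binj : injective (fun p : N * 'I_m => beta p.1 p.2).
  move=> [e a] [e' a'] /= ee; have [H1 H2] := EB.1 _ _ (valP e) (valP e') _ _ ee.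
  by rewrite H2; congr pair; apply: val_inj.
have binj1 i : injective (beta^~ i).
  by move=> e e' ee; have /binj[] : (fun p : N * 'I_m => beta p.1 p.2) (e, i) =
    (fun p : N * 'I_m => beta p.1 p.2) (e', i) by [].
have cN : #|N| = #|E| by rewrite card_sig; apply: eq_card => e.
have cE := block_family_card EB.
have VN : (#|V| <= 2 * (m * #|N|))%N.
  by rewrite cN -cE; have := cardsC B; move: BV; clear; lia.
have N1 : (n1 < #|N|)%N.
  have : (2 * (m * n1.+1) <= 2 * (m * #|N|))%N by apply: leq_trans VN.
  by rewrite leq_pmul2l // leq_pmul2l.
have N0 : (0 < #|N|)%N by apply: leq_trans N1.
have N0' : 0 < #|N|%:R :> R by rewrite ltr0n.
pose isT (e : N) := val e \in Et.
have cEt := block_family_card EtU.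
have cEl := block_family_card ElL.
have NEl : (#|N| = #|Et| + #|El|)%N.
  apply/eqP; rewrite -(eqn_pmul2l m0) mulnDr cN -cE -cEt -cEl; exact/eqP.
(* More than [gam * |V|] uncovered vertices means that more than a fraction [gam] of the blocks are
   not tiles. *)
have fewT : avg (fun e => (isT e)%:R : R) <= 1 - gam.
  rewrite (@eq_avg _ _ _ (fun e => (e \in [set e | isT e])%:R)); last by move=> e; rewrite inE.
  rewrite avg_le_sum_pred ler_pdivrMr //.
  have -> : #|[set e | isT e]| = #|Et|.
    rewrite -(card_imset _ val_inj); apply: eq_card => e.
    apply/imsetP/idP => [[e' + ->]|eEt]; first by rewrite inE.
    have eE : e \in E by rewrite inE eEt.
    by exists (exist (fun e => e \in E) e eE); rewrite ?inE.
  have h1 : gam * (m%:R * #|N|%:R) < m%:R * #|El|%:R.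
    rewrite -!natrM -cEl; apply: le_lt_trans Lbig.
    by rewrite ler_wpM2l ?(ltW gam0) // ler_nat cN -cE max_card.
  have : gam * #|N|%:R < #|El|%:R.
    by rewrite -(@ltr_pM2l _ m%:R) ?ltr0n // mulrCA.
  by rewrite NEl natrD; clear; lra.
pose x (v : void) : V := match v with end.
pose typ (tau : {ffun 'I_r -> N}) : {ffun 'I_r -> bool} := [ffun i => isT (tau i)].
pose good (tau : {ffun 'I_r -> N}) :=
  `[< UniDen eps' d (pull inr (pat x beta tau G)) >] &&
  (avg (fun i => (isT (tau i))%:R : R) <= 1 - gam / 2).
have goodP : 1 / 2 <= avg (fun tau => (good tau)%:R : R).
  have r0r : (r0 <= r)%N by rewrite /r; clear; lia.
  have H1 := r0P r V N void x beta G r0r binj1 N0 VN GU.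
  have r2r : 4 <= (gam / 8) ^+ 2 * #|'I_r|%:R.
    rewrite card_ord mulrC -ler_pdivrMr ?exprn_gt0 //; apply: le_trans r2P _.
    by rewrite ler_nat /r; clear; lia.
  have psi1 (e : N) : `|(isT e)%:R : R| <= 1.
    by case: (isT e); rewrite ?normr1 ?normr0 ?ler01.
  have Ir0 : (0 < #|'I_r|)%N by rewrite card_ord.
  have H2 := @lln R 'I_r N (fun e => (isT e)%:R) (gam / 8) N0 Ir0 psi1 gam80 r2r.
  have gam20 : 0 < gam / 2 by rewrite divr_gt0.
  have H3 := markov (F := fun tau : {ffun 'I_r -> N} =>
     `|avg (fun i => (isT (tau i))%:R) - avg (fun e => (isT e)%:R)| : R) (fun=> normr_ge0 _)
       gam20.
  move: H3; set D := avg _ => H3.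
  have H4 : D <= 1 / 4.
    apply: le_trans H3 _; rewrite ler_pdivrMr //; apply: le_trans H2 _; clear; lra.
  move: H1; set A := avg _ => H1.
  apply: (@le_trans _ _ (A - D)); first by move: H1 H4; clear; lra.
  rewrite /A /D -avgB; apply: le_avg => tau; rewrite /good.
  case: (boolP `[< _ >]) => _ /=; last first.
    by rewrite sub0r oppr_le0.
  set y := avg (fun i => _); set z := avg (fun e => _) in fewT *.
  case: (leP (gam / 2) `|y - z|) => [_|yz] /=; first by rewrite subrr ler0n.
  suff -> : y <= 1 - gam / 2 by rewrite subr0.
  by have := ler_norm (y - z); move: yz fewT; clear; lra.
pose col (tau : {ffun 'I_r -> N}) : Col := (edges (pat x beta tau G), typ tau).
have [kap kapP] := n1P N (ltnW N1) col good goodP.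
have [xi] := exists_ge_avg (fun xi : {ffun 'I_r -> {ffun 'I_b -> N}} => (injectiveb (uncurryf
  xi) &&
     transversals (fun s => good s && (col s == kap)) xi)%:R : R)
  (ltac:(by rewrite !card_ffun !expn_gt0 N0)).
move=> /(le_trans kapP);
  case: (boolP (_ && _)) => [/andP[/injectiveP xinj /forallP trans] _|_ /=]; last first.
  by move=> /(lt_le_trans c0); rewrite ltxx.
pose g0 : {ffun 'I_r -> 'I_b} := [ffun=> ord0].
have /andP[/andP[/asboolP PUn Pfew] /eqP PE] := trans g0.
set tau0 := [ffun i => xi i (g0 i)] in PUn Pfew PE.
set P := pat x beta tau0 G in PUn PE.
have EP (g : {ffun 'I_r -> 'I_b}) : edges (pat x beta [ffun i => xi i (g i)] G) = edges P.
  have /andP[_ /eqP E1] := trans g.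
  by have := congr1 fst E1; rewrite -PE.
have typE i j : isT (xi i j) = isT (tau0 i).
  have /andP[_ /eqP E1] := trans [ffun=> j].
  by have := congr1 (fun c : Col => c.2 i) E1; rewrite -PE /= !ffunE.
have sJW : (sJ <= #|W|)%N by apply: leq_trans rW; rewrite /r; clear; lia.
have [J [Jc Jm Jd]] := sJP W (pull inr P) sJW
  (UniDen_le (ltac:(by rewrite ge_min lexx) : eps' <= epsJ) (lexx d) PUn).
have W0 : (0 < #|W|)%N by apply: leq_trans rW.
have W0' : 0 < #|W|%:R :> R by rewrite ltr0n.
have JW : (#|W| <= 2 * #|J|)%N.
  have : (2 * #|~: J| <= #|W|)%N.
    by rewrite -(ler_nat R) natrM; move: Jc W0' eta1; clear; nra.
  by have := cardsC J; clear; lia.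
pose S : finType := 'I_#|J|; pose f : S -> W := enum_val.
have finj : injective f by apply: enum_val_inj.
have SJ : #|S| = #|J| by rewrite card_ord.
have SpaJ : Spa (gam / 8) (hom_digraph F (pull f (pull inr P))).
  apply: nSP; first by rewrite SJ; move: JW rW; rewrite /r; clear; lia.
  split.
    have : UniDen (2 ^+ k.+1 * eps') d (pull f (pull inr P)).
      by apply: UniDen_restrict => //; rewrite ?SJ // ltW.
    apply: UniDen_le => //; rewrite mulrC -ler_pdivlMr //.
    by rewrite ge_min lexx orbT.
  apply: tdeg_MinDeg; first exact: ltW.
  move=> a; apply: (le_trans _ (tdeg_restrict _ _ a finj)).
  have cof : k%:R * #|~: (f @: [set: S])|%:R / #|W|%:R <= d / 4.
    rewrite (_ : #|~: (f @: [set: S])| = #|~: J|); last first.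
      by rewrite card_coimage // SJ -(cardsC J) addKn.
    by apply: le_trans etak; rewrite -mulrA ler_wpM2l // ler_pdivrMr.
  by move: (Jd _ (enum_valP a)) cof; rewrite -/(f a); clear; lra.
have [s [sH sb ssize]] := spa_tiles b m0 finj SpaJ.
pose T w := (\sum_(phi <- s) multiplicity w phi)%N.
have Tb w : (T w <= b)%N := sb w.
pose C (w : (void + W)%type) := if w is inr w then cells beta xi T w else set0.
have tC : tileable F G (\bigcup_w C w).
  apply: (tile_pattern (x := x) (beta := beta) (xi := xi) (P := P) (s := map (ffmap inr) s)) =>
    //.
  - by move=> w v /cellsP.
  - by move=> [//|w] [//|w'] ww' /=; apply: cells_disjoint => //; apply: contraNneq ww' => ->.
  - by move=> _ /mapP[phi /sH hphi ->]; apply: hom_pull hphi.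
  - move=> [//|w] /=; rewrite (card_cells binj xinj (Tb w)) // [RHS]big_map.
    by apply: eq_bigr => phi _; rewrite multiplicity_ffmap (big_pred1 w).
(* The tiles given up: all those in the array, even where the new tiling leaves some of their
   vertices uncovered. *)
pose Ef := Et :&: [set val (xi p.1 p.2) | p : 'I_r * 'I_b].
have r0' : 0 < r%:R :> R by rewrite ltr0n.
have Efb : (#|Ef|%:R <= (1 - gam / 2) * (b * r)%:R :> R).
  have h1 : (#|Ef| <= #|[set i | isT (tau0 i)]| * b)%N.
    rewrite -[b in leqRHS]card_ord -cardsT -cardsX.
    apply: leq_trans (leq_imset_card (fun p : 'I_r * 'I_b => val (xi p.1 p.2)) _).
    apply: subset_leq_card; apply/subsetP => e; rewrite inE => /andP[eEt /imsetP[p _ ep]].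
    apply/imsetP; exists p => //; rewrite !inE andbT -(typE _ p.2).
    by rewrite /isT -ep.
  move: Pfew; rewrite (@eq_avg _ _ _ (fun i => (i \in [set i | isT (tau0 i)])%:R)); last first.
    by move=> i; rewrite inE.
  rewrite avg_le_sum_pred card_ord ler_pdivrMr // => h2.
  apply: (@le_trans _ _ (#|[set i | isT (tau0 i)]|%:R * b%:R)).
    by rewrite -natrM ler_nat.
  by rewrite natrM [b%:R * _]mulrC mulrA ler_wpM2r.
(* In units of [b * r]: at least [(1 - gam / 8) ^ 2 - gam / 8] new tiles, after the losses in [Spa],
   in the core and by rounding, against at most [1 - gam / 2] old ones. *)
have sbig : (#|Ef| < size s)%N.
  have mR : 0 < m%:R :> R by rewrite ltr0n.
  rewrite -(ltr_nat R) -(@ltr_pM2l _ m%:R) // -[X in _ < X]natrM; apply: lt_le_trans ssize.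
  have Sn : (1 - gam / 8) * (r * m)%:R <= #|S|%:R :> R.
    have : #|J|%:R + #|~: J|%:R = #|W|%:R :> R by rewrite -natrD cardsC.
    rewrite SJ -cW; have := ler_wpM2r (ltW W0') eta_gam.
    by move: Jc; clear; lra.
  have Sm : (m * #|S| ^ m)%:R <= m%:R * (gam / 8 * b%:R).
    rewrite natrM ler_wpM2l //; apply: (@le_trans _ _ (#|W| ^ m)%:R).
      by rewrite ler_nat leq_exp2r // SJ max_card.
    move: b0P; rewrite ler_pdivrMr //.
    by rewrite /b -(natr1 b0); move: gam0; clear; lra.
  have b1 : 1 <= b%:R :> R by rewrite ler1n.
  have r1 : 1 <= r%:R :> R by rewrite ler1n.
  have g8 : 0 <= 1 - gam / 8 by move: gam1; clear; lra.
  have h1 := ler_wpM2l (ler0n R b) (ler_wpM2l g8 Sn).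
  have h2 := ler_wpM2l (ltW mR) Efb.
  have br : 0 < m%:R * (b%:R * r%:R) * gam :> R.
    by rewrite !mulr_gt0 // (lt_le_trans ltr01).
  have h3 : m%:R * (gam / 8 * b%:R) <= m%:R * (b%:R * r%:R) * gam / 8.
    have := ler_wpM2l (ltW (mulr_gt0 mR (mulr_gt0 gam0 (lt_le_trans ltr01 b1)))) r1.
    by clear; lra.
  have h4 : 0 <= m%:R * (b%:R * r%:R) * (gam * gam).
    by rewrite !mulr_ge0 // ltW.
  rewrite !natrM in h1 h2 Sm *.
  by move: h1 h2 br h3 h4 Sm; clear; lra.
pose U1 := \bigcup_(e in Et :\: Ef) (e @: [set: 'I_m]).
have fU1 : block_family U1 (Et :\: Ef) by apply: block_familyS EtU; apply: subsetDl.
have tU1 : tileable F G U1.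
  by apply: tileable_family fU1 _ => e; rewrite inE => /andP[_ /EtH].
have CP v : v \in \bigcup_w C w -> exists i j a, v = val (xi i j) a.
  case/bigcupP => -[//|w] _ /= /cellsP[j ->].
  by exists w.1, j, w.2.
have CE : \bigcup_w C w = \bigcup_w cells beta xi T w.
  apply/setP => v; apply/bigcupP/bigcupP => [[[//|w] _ vw]|[w _ vw]]; first by exists w.
  by exists (inr w).
have dU1 : [disjoint \bigcup_w C w & U1].
  rewrite disjoints_subset; apply/subsetP => v /CP[i [j [a va]]]; rewrite inE.
  apply/negP => /(fU1.2 _).1 [e]; rewrite inE => /andP[eEf eEt] [a' va'].
  have eE : e \in E by rewrite inE eEt.
  have [ee _] := EB.1 _ _ (valP (xi i j)) eE a a' (etrans (esym va) va').
  move: eEf; rewrite inE eEt -ee /= => /negP; apply.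
  by apply/imsetP; exists (i, j).
have cC : #|\bigcup_w C w| = (m * size s)%N.
  rewrite CE -sum1_card partition_disjoint_bigcup /=; last first.
    by move=> w w' ww'; apply: cells_disjoint.
  rewrite (eq_bigr T) => [|w _]; last first.
    by rewrite sum1_card (card_cells binj xinj (Tb w)).
  rewrite exchange_big /= (eq_bigr (fun=> m)) => [|phi _]; last exact: sum_multiplicity.
  by rewrite big_const_seq count_predT iter_addn_0.
have PUU : PU (\bigcup_w C w :|: U1).
  apply/andP; split; first by apply/asboolP/tileable_disjointU.
  rewrite subUset; apply/andP; split; apply/subsetP => v.
    by move=> /CP[i [j [a ->]]]; apply/EB.2; exists (val (xi i j)); [exact: valP|exists a].
  move=> /(fU1.2 _).1 [e]; rewrite inE => /andP[_ eEt] [a ->].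
  by apply/EB.2; exists e; [rewrite inE eEt|exists a].
have := Umax _ PUU.
rewrite cardsU disjoint_setI0 // cards0 subn0 cC (block_family_card fU1) cEt.
rewrite cardsD (setIidPr _) ?subsetIl // -mulnDr leq_pmul2l //.
have : (#|Ef| <= #|Et|)%N by apply: subset_leq_card; apply: subsetIl.
by move: sbig; clear; lia.
Qed.

End AlmostTiling.

(** * Sufficiency *)

Section Sufficiency.
Variable R : realType.

Theorem Til_of_Spa_Div_Cov k m (F : kgraph k.+1 'I_m) : (0 < m)%N ->
  F_Spa R k.+1 m F -> F_Div R k.+1 m F -> F_Cov R k.+1 m F -> F_Til R k.+1 m F.
Proof.
move=> m0 FS FD FC d mu d0 mu0.
pose d' := Num.min d 1.
have d'01 : 0 < d' <= 1 by rewrite lt_min d0 ltr01 ge_min lexx orbT.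
have d'd : d' <= d by rewrite ge_min lexx.
have mu20 : 0 < mu / 2 by rewrite divr_gt0.
have [eps1 eps10 [xi xi0 [n1 n1P]]] := absorbing_set m0 FD FC d'01 mu20.
(* What the almost perfect tiling leaves over must stay within the capacity [xi] of the absorbing
   set. *)
pose gam := Num.min xi 1.
have gam01 : 0 < gam <= 1 by rewrite lt_min xi0 ltr01 ge_min lexx orbT.
have gamxi : gam <= xi by rewrite ge_min lexx.
have [eps2 eps20 [n2 n2P]] := almost_tiling m0 FS d'01 gam01.
have [n3 n3P] := le_div_nat (k ^ 2 + k)%:R (ltac:(by rewrite divr_gt0) : 0 < 1 / 2 :> R).
exists (Num.min eps1 eps2); first by rewrite lt_min eps10.
exists (n1 + n2 + n3)%N => n nn mn V G Vn [/= GU GM].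
have [b1 b2 b3] : [/\ n1 <= #|V|, n2 <= #|V| & n3 <= #|V|]%N.
  by rewrite Vn; clear -nn; split; lia.
have GU1 : UniDen eps1 d' G by apply: UniDen_le GU; rewrite ?ge_min ?lexx.
have GU2 : UniDen eps2 d' G by apply: UniDen_le GU; rewrite ?ge_min ?lexx ?orbT.
have Gd v : mu / 2 <= tdeg R G v.
  apply: le_trans (MinDeg_tdeg v (ltW mu0) GM); rewrite ler_wpM2l ?(ltW mu0) //.
  by have := n3P _ b3; lra.
have [B BV BL] := n1P V G b1 GU1 Gd.
(* Absorbing the empty set shows that [B] itself is tileable; its complement then has order
   divisible by [m], as [almost_tiling] requires. *)
have mB : (m %| #|B|)%N.
  rewrite -(setU0 B); apply: tileable_card (BL set0 _ _ _).
  - by rewrite -setI_eq0 setI0.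
  - by rewrite cards0 dvdn0.
  - by rewrite cards0 mulr_ge0 // ltW.
have mCB : (m %| #|~: B|)%N by rewrite -(dvdn_addr _ mB) cardsC Vn.
have [U [tU UB Usmall]] := n2P V G b2 GU2 B BV mCB.
have UL : U :|: (~: B :\: U) = ~: B.
  by apply/setP => v; rewrite !inE; have [/(subsetP UB)|] := boolP (v \in U); rewrite ?inE.
have dUL : [disjoint U & ~: B :\: U].
  by rewrite disjoint_sym disjoints_subset setDE subsetIr.
have cUL : #|~: B| = (#|U| + #|~: B :\: U|)%N.
  by rewrite -{1}UL cardsU disjoint_setI0 // cards0 subn0.
have tL : tileable F G (B :|: (~: B :\: U)).
  apply: BL.
  - by rewrite disjoint_sym disjoints_subset setDE subsetIl.
  - by rewrite -(dvdn_addr _ (tileable_card tU)) -cUL.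
  - by apply: le_trans Usmall _; rewrite ler_wpM2r.
apply: tileable_perfect.
have -> : [set: V] = U :|: (B :|: (~: B :\: U)).
  by rewrite setUCA UL setUCr.
apply: tileable_disjointU => //.
rewrite disjoints_subset; apply/subsetP => v vU; rewrite !inE vU /= orbF.
by have := subsetP UB v vU; rewrite inE.
Qed.

End Sufficiency.

Local Open Scope classical_set_scope.

Theorem corollary4p16 (R : realType) (k m : nat) (hk : (2 <= k)%N) :
  F_Til R k m = F_Spa R k m `&` F_Div R k m `&` F_Cov R k m.
Proof.
case: k hk => [//|k _]; apply/seteqP; split=> [F FT|F [[FS FD] FC]].
  split; first split.
  - case: m F FT => [|m] F FT; [exact: F_Spa0|exact: Til_Spa].
  - move=> d mu d0 mu0; have [eps e0 [n0 H]] := FT d mu d0 mu0.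
    exists eps => //; exists n0 => n nn mn V G Vn GG.
    exact/perfect_Div/(H n).
  - move=> d mu d0 mu0; have [eps e0 [n0 H]] := FT d mu d0 mu0.
    exists eps => //; exists n0 => n nn mn V G Vn GG.
    exact/perfect_Cov/(H n).
case: m F FS FD FC => [|m] F FS FD FC; first exact: eventually_forced0.
exact: Til_of_Spa_Div_Cov.
Qed.
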